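(* Let $x^{+}=f(x,u)$, $\dim(x)=n$, $\dim(u)=m$, be a flat discrete-time system and let $y^{j}=\varphi^{j}(\zeta_{[-q_{1}]},\dots,\zeta_{[-1]},x,u)$, $j=1,\ldots,m$, be a flat output which is independent of future values of $u$, with associated multi-index $R$. For every such flat output the shifting procedure described in the context terminates after $s\leq m$ steps. The multi-index $\kappa=(\kappa_{1},\ldots,\kappa_{s})$ formed by the constructed multi-indices $\kappa_{i}=(\kappa_{i}^{1},\ldots,\kappa_{i}^{m_{i}})$ has the following properties: (i) $\kappa\leq R$. (ii) $\#\kappa\geq n$, and $\#\kappa=n$ if and only if the flat output is independent of the variables $\zeta_{[-q_{1}]},\dots,\zeta_{[-1]}$. (iii) Say that a multi-index $A=(a^1,\dots,a^m)$ with all $a^j\ge0$ is feasible if, with $\underline a=\min_j a^j$, the differentials $$\mathrm{d}\zeta_{[-q_{1}+\underline a]},\ldots,\mathrm{d}\zeta_{[-1]},\ \mathrm{d}x,\ \mathrm{d}\delta^{A}(\varphi),\ldots,\mathrm{d}\delta^{R-1}(\varphi)$$ are linearly independent. Then $A=\kappa$ is feasible, and $\#\kappa\leq\#A$ for all other feasible multi-indices $A$. Furthermore, in the coordinates constructed by the procedure, the flat output and its forward-shifts up to the orders $\kappa_i$ are of the form $$\begin{array}{rcl} y_{1,[0,\kappa_{1}-1]} & = & \varphi_{1,[0,\kappa_{1}-1]}(\zeta_{[-q_{1},-1]},x)\\ y_{1,[\kappa_{1}]} & = & v_{1}\\ y_{2,[0,\kappa_{2}-1]} & = & \varphi_{2,[0,\kappa_{2}-1]}(\zeta_{[-q_{1},-1]},x,v_{1,[0,r_{1}-\kappa_{1}-1]})\\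 y_{2,[\kappa_{2}]} & = & v_{2}\\ & \vdots & \\ y_{s,[0,\kappa_{s}-1]} & = & \varphi_{s,[0,\kappa_{s}-1]}(\zeta_{[-q_{1},-1]},x,v_{1,[0,r_{1}-\kappa_{1}-1]},\ldots,v_{s-1,[0,r_{s-1}-\kappa_{s-1}-1]})\\ y_{s,[\kappa_{s}]} & = & v_{s}, \end{array}$$ i.e. for each $i=1,\dots,s$, $y_{i,[\kappa_i]}=v_i$ and $y_{i,[0,\kappa_i-1]}$ depends only on $\zeta_{[-q_1,-1]}$, $x$ and $v_{l,[0,r_l-\kappa_l-1]}$ with $l<i$, where $r_{i}=(r_{i}^{1},\ldots,r_{i}^{m_{i}})$ denotes the components of $R$ corresponding to the components $y_{i}=(y_{i}^{1},\ldots,y_{i}^{m_{i}})$ of the flat output.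
   Context: System. All functions are smooth and all considerations are local, in a suitable neighborhood of an equilibrium $(x_0,u_0)$, $x_0=f(x_0,u_0)$. The system is $x^{i,+}=f^i(x,u)$, $i=1,\dots,n$, $u=(u^1,\dots,u^m)$, with $\mathrm{rank}(\partial_{(x,u)}f)=n$. Fix $m$ functions $g(x,u)$ such that $(x,u)\mapsto(x^+,\zeta)=(f(x,u),g(x,u))$ is locally invertible. Shifts. Trajectories on a finite time interval are identified with points of a manifold with coordinates $(\zeta_{[-l_\zeta]},\dots,\zeta_{[-1]},x,u,u_{[1]},\dots,u_{[l_u]})$, where $\zeta_{[-\beta]}$ stands for $\zeta(k-\beta)$, $u_{[\alpha]}$ for $u(k+\alpha)$, and $l_\zeta,l_u$ are sufficiently large. The forward-shift operator is $$\delta(h(\dots,\zeta_{[-2]},\zeta_{[-1]},x,u,u_{[1]},\dots))=h(\dots,\zeta_{[-1]},g(x,u),f(x,u),u_{[1]},u_{[2]},\dots).$$ Flatness. The system is flat around $(x_0,u_0)$ if $x$ and $u$ can be expressed locally by an $m$-tuple of functions $y^j=\varphi^j(\zeta_{[-q_1]},\dots,\zeta_{[-1]},x,u,\dots,u_{[q_2]})$ (a flat output) and their forward-shifts $y_{[\alpha]}=\delta^\alpha(\varphi)$ up to some finite order. The representation is unique and has the form $x=F_x(y_{[0,R-1]})$, $u=F_u(y_{[0,R]})$, where the multi-index $R=(r^1,\dots,r^m)$ consists of the numbers of forward-shifts of each component of the flat output needed to express $x$ and $u$. Multi-indices. $\le$, $+$, $-$ are componentwise; $A\pm c=(a^1\pm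 c,\dots,a^m\pm c)$; $\#A=\sum_j a^j$; $y_{[A]}=(y^1_{[a^1]},\dots,y^m_{[a^m]})$; $y_{[A,B]}$ collects all $y^j_{[\alpha]}$ with $a^j\le\alpha\le b^j$ (empty for $j$ if $a^j>b^j$). A lower index $0$ means all lower indices are $0$. For blocks $y_i$ the first subscript is the block and the bracketed subscript the shift. $\zeta_{[-q_1,-1]}=(\zeta_{[-q_1]},\dots,\zeta_{[-1]})$. In the list of differentials, $\mathrm{d}\delta^{A}(\varphi),\ldots,\mathrm{d}\delta^{R-1}(\varphi)$ means all $\mathrm{d}\delta^\alpha(\varphi^j)$ with $a^j\le\alpha\le r^j-1$, and the $\zeta$-part is empty if $-q_1+\underline a>-1$. The procedure. Set $\varphi_{rest_0}=\varphi$, $u_{rest_0}=u$. Step 1: determine $K_1=(k_1^1,\dots,k_1^m)$ such that $\delta^{k_1^j-1}(\varphi^j)$ depends only on $\zeta_{[-q_1,-1]},x$ while $\delta^{k_1^j}(\varphi^j)=\varphi^j_{[k_1^j]}(\zeta_{[-q_1,-1]},x,u)$ depends explicitly on $u$ (i.e. $k_1^j$ is the first order of shift with explicit dependence on $u$). Put $m_1=\mathrm{rank}(\partial_u\varphi_{[K_1]})$. Reorder the components of the flat output and of $u$ such that $\mathrm{rank}(\partial_{u_1}\varphi_{1,[\kappa_1]})=m_1$, where $\varphi_1$, $u_1$, $\kappa_1$ consist of the first $m_1$ components of $\varphi$, $u$, $K_1$. Apply the coordinate transformation $v_{1,[\alpha]}=\varphi_{1,[\kappa_1+\alpha]}$,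 $\alpha\ge0$, which replaces $u_1$ and its forward-shifts by $v_1$ and its forward-shifts; the remaining inputs $u_{rest_1}=(u^{m_1+1},\dots,u^m)$ and their forward-shifts stay as coordinates. Let $\varphi_{rest_1}=(\varphi^{m_1+1},\dots,\varphi^m)$, and express it and its shifts in the new coordinates. Step $i\ge2$: determine the multi-index $K_i$ (one entry $k_i^j$ for each component of $\varphi_{rest_{i-1}}$) such that $\delta^{k_i^j-1}(\varphi^j_{rest_{i-1}})$ depends only on $\zeta_{[-q_1,-1]},x,v_1,v_{1,[1]},\dots,v_{i-1},v_{i-1,[1]},\dots$ while $\delta^{k_i^j}(\varphi^j_{rest_{i-1}})$ depends explicitly also on $u_{rest_{i-1}}$ (first order of shift for which this happens). Put $m_i=\mathrm{rank}(\partial_{u_{rest_{i-1}}}\varphi_{rest_{i-1},[K_i]})$, reorder the components of $\varphi_{rest_{i-1}}$ and $u_{rest_{i-1}}$ such that $\mathrm{rank}(\partial_{u_i}\varphi_{i,[\kappa_i]})=m_i$, where $\varphi_i,u_i,\kappa_i$ consist of the first $m_i$ components of $\varphi_{rest_{i-1}},u_{rest_{i-1}},K_i$, and apply the coordinate transformation $v_{i,[\alpha]}=\varphi_{i,[\kappa_i+\alpha]}$, $\alpha\ge0$, replacing $u_i$ and its forward-shifts by $v_i$ and its forward-shifts, with the remaining inputs $u_{rest_i}$ and their forward-shifts left unchanged. (Because the manifold is finite-dimensional, some of the highest forward-shifts of inputs may have to be kept as coordinates; this is immaterial if $l_u$ is sufficiently large.) Let $\varphi_{rest_i}$ be the remaining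 components. The procedure terminates in the step $s$ in which $\mathrm{rank}(\partial_{u_{rest_{s-1}}}\varphi_{rest_{s-1},[K_s]})=\dim(u_{rest_{s-1}})$; then $\varphi_s=\varphi_{rest_{s-1}}$, $\kappa_s=K_s$. The final coordinates are $(\dots,\zeta_{[-2]},\zeta_{[-1]},x,v,v_{[1]},v_{[2]},\dots)$ with $v=(v_1,\dots,v_s)=\delta^\kappa(\varphi)$. Correspondingly $y=(y_1,\dots,y_s)$, $\dim(y_i)=m_i$, and the components of $R$ are ordered consistently with the reordered components of $y$.
   Formalization: That the procedure can be carried through to termination is shown assuming the ranks defining the numbers m_i are constant near the equilibrium (otherwise m_i is undefined); the bound s ≤ m, (i)–(iii) and the triangular form hold for every completed run without this assumption. *)

(* Defs.v *)
From HB Require Import structures.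
From mathcomp Require Import all_boot all_order all_algebra.
From mathcomp Require Import all_classical all_reals topology normedtype derive.

Set Implicit Arguments.
Unset Strict Implicit.
Unset Printing Implicit Defensive.

Import Order.TTheory GRing.Theory Num.Theory numFieldNormedType.Exports.

Local Open Scope classical_set_scope.
Local Open Scope ring_scope.

(* Trajectories are points of F^I for a countable set I of coordinates, with
   the product topology: a neighbourhood constrains finitely many coordinates
   only, and a smooth function depends on finitely many coordinates only.  So
   every function and every neighbourhood lives on a finite-dimensional
   truncation, without a choice of bounds l_zeta and l_u. *)

(* [Zeta b j] is the coordinate zeta^j_[-(b+1)] (so that zeta_[-1] has b = 0),
   [Xc i] is x^i, and [Uc a j] is u^j_[a]. *)
Inductive coord (n m : nat) : Type :=
  | Zeta of nat & 'I_m
  | Xc of 'I_n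
  | Uc of nat & 'I_m.
Arguments Zeta {n m}.
Arguments Xc {n m}.
Arguments Uc {n m}.

Section CoordEq.
Variables n m : nat.

Definition coord_code (c : coord n m) :
    ((nat * 'I_m) + 'I_n + (nat * 'I_m))%type :=
  match c with
  | Zeta b j => inl (inl (b, j))
  | Xc i => inl (inr i)
  | Uc a j => inr (a, j)
  end.

Definition coord_decode (c : ((nat * 'I_m) + 'I_n + (nat * 'I_m))%type) :
    coord n m :=
  match c with
  | inl (inl (b, j)) => Zeta b j
  | inl (inr i) => Xc i
  | inr (a, j) => Uc a j
  end.

Lemma coord_codeK : cancel coord_code coord_decode.
Proof. by case. Qed.

HB.instance Definition _ := Equality.copy (coord n m) (can_type coord_codeK).

End CoordEq.

Section Smooth.
Variable F : realType.

(* C^infinity on a neighbourhood of a: on one and the same neighbourhood all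
   iterated partial derivatives are (Frechet) differentiable. *)
Definition smooth_at (N : nat) (W : normedModType F) (G : 'rV[F]_N -> W)
    (a : 'rV[F]_N) : Prop :=
  \forall z \near a, forall s : seq 'I_N,
    differentiable (foldr (fun i h => 'D_('e_i) h) G s) z.

(* Near w0, H is a smooth function of finitely many coordinates lying in C. *)
Definition smooth_fun_of (I : eqType) (C : pred I) (w0 : {ptws I -> F})
    (H : {ptws I -> F} -> F) : Prop :=
  exists (N : nat) (t : 'I_N -> I) (G : 'rV[F]_N -> F),
    [/\ forall i, C (t i),
        smooth_at (W := F) G (\row_i w0 (t i)) &
        \forall w \near w0, H w = G (\row_i w (t i))].

(* Near p0, h can be expressed by the functions Y c with c in C. *)
Definition expr_by (J I : eqType) (Y : {ptws J -> F} -> {ptws I -> F})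
    (C : pred I) (p0 : {ptws J -> F}) (h : {ptws J -> F} -> F) : Prop :=
  exists H, smooth_fun_of C (Y p0) H /\ \forall p \near p0, h p = H (Y p).

Definition pder (I : eqType) (c : I) (H : {ptws I -> F} -> F)
    (w : {ptws I -> F}) : F :=
  derive1 (fun s : F => H (fun c' => if c' == c then s else w c')) (w c).

(* The covectors (dh)_p, h in hs, are linearly independent; dh is identified
   with the family of the partial derivatives of h. *)
Definition lin_indep_at (I : eqType) (p : {ptws I -> F})
    (hs : seq ({ptws I -> F} -> F)) : Prop :=
  forall a : 'I_(size hs) -> F,
    (forall c : I, \sum_i a i * pder c (nth (fun=> 0) hs i) p = 0) ->
    forall i, a i = 0.

Definition local_coords (J I : eqType) (Y : {ptws J -> F} -> {ptws I -> F})
    (C : pred I) (p0 : {ptws J -> F}) : Prop :=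
  (forall c : J, expr_by Y C p0 (fun p => p c)) /\
  (forall s : seq I, uniq s -> all C s ->
     \forall p \near p0, lin_indep_at p [seq fun q => Y q c | c <- s]).

End Smooth.

(* The arguments (x,u) of f and g are given as the row vector [row_mx x u]. *)
Record dtsystem (F : realType) (n m : nat) : Type := DTSystem {
  sys_f : 'rV[F]_(n + m) -> 'rV[F]_n;
  sys_g : 'rV[F]_(n + m) -> 'rV[F]_m;
  sys_x0 : 'rV[F]_n;
  sys_u0 : 'rV[F]_m;
  sys_equilibrium : sys_x0 = sys_f (row_mx sys_x0 sys_u0);
  sys_f_smooth : smooth_at sys_f (row_mx sys_x0 sys_u0);
  sys_g_smooth : smooth_at sys_g (row_mx sys_x0 sys_u0);
  sys_f_rank : \forall z \near row_mx sys_x0 sys_u0, \rank ('J sys_f z) = n;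
  sys_invertible :
    let Phi z := row_mx (sys_f z) (sys_g z) in
    exists Psi : 'rV[F]_(n + m) -> 'rV[F]_(n + m),
      [/\ smooth_at Psi (Phi (row_mx sys_x0 sys_u0)),
          \forall z \near row_mx sys_x0 sys_u0, Psi (Phi z) = z &
          \forall w \near Phi (row_mx sys_x0 sys_u0), Phi (Psi w) = w]
}.

Section Flat.
Variables (F : realType) (n m : nat) (sys : dtsystem F n m).

Definition traj : Type := {ptws coord n m -> F}.

Definition xu_of (p : traj) : 'rV[F]_(n + m) :=
  row_mx (\row_i p (Xc i)) (\row_j p (Uc 0 j)).

Definition shift (p : traj) : traj := fun c =>
  match c with
  | Zeta 0 j => sys_g sys (xu_of p) 0 j
  | Zeta b.+1 j => p (Zeta b j)
  | Xc i => sys_f sys (xu_of p) 0 i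
  | Uc a j => p (Uc a.+1 j)
  end.

(* delta^a *)
Definition fshift (a : nat) (h : traj -> F) : traj -> F :=
  fun p => h (iter a shift p).

Definition eq_traj : traj := fun c =>
  match c with
  | Zeta _ j => sys_g sys (row_mx (sys_x0 sys) (sys_u0 sys)) 0 j
  | Xc i => sys_x0 sys 0 i
  | Uc _ j => sys_u0 sys 0 j
  end.

Local Notation p0 := eq_traj.

Variables (q1 : nat) (phi : 'I_m -> traj -> F).

Definition zxu_vars : pred (coord n m) := fun c =>
  match c with
  | Zeta b _ => (b < q1)%N
  | Xc _ => true
  | Uc a _ => a == 0%N
  end.

Definition no_zeta_vars : pred (coord n m) := fun c =>
  if c is Zeta _ _ then false else true.

(* The functions y^j_[a] = delta^a(phi^j), indexed by (a, j). *)
Definition yshifts (p : traj) : {ptws (nat * 'I_m)%type -> F} :=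
  fun c => fshift c.1 (phi c.2) p.

(* x = F_x(y_[0,R-1]) and u = F_u(y_[0,R]) *)
Definition flat_repr (R : 'I_m -> nat) : Prop :=
  (forall i : 'I_n, expr_by yshifts
     (fun c => c.1 < R c.2)%N p0 (fun p => p (Xc i))) /\
  (forall j : 'I_m, expr_by yshifts
     (fun c => c.1 <= R c.2)%N p0 (fun p => p (Uc 0 j))).

(* No multi-index A which suffices to express x and u by y_[0,A] is smaller
   than R in some component. *)
Definition flat_repr_minimal (R : 'I_m -> nat) : Prop :=
  forall A : 'I_m -> nat,
    (forall i : 'I_n, expr_by yshifts
       (fun c => c.1 <= A c.2)%N p0 (fun p => p (Xc i))) ->
    (forall j : 'I_m, expr_by yshifts
       (fun c => c.1 <= A c.2)%N p0 (fun p => p (Uc 0 j))) ->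
    forall j, (R j <= A j)%N.

(* phi is a flat output of the form phi(zeta_[-q1,-1],x,u) with associated
   multi-index R. *)
Definition flat_output (R : 'I_m -> nat) : Prop :=
  [/\ forall j, smooth_fun_of zxu_vars p0 (phi j),
      flat_repr R & flat_repr_minimal R].

(* Instead of reordering components, a step of the procedure selects the set
   [st_out] of the components of the flat output which form phi_i and the set
   [st_in] of the components of u which form u_i; all multi-indices keep the
   original numbering of the components.  [st_K] is K_i; only its values at
   the components of phi_rest_{i-1} matter. *)
Record step : Type := Step {
  st_K : 'I_m -> nat;
  st_out : {set 'I_m};
  st_in : {set 'I_m}
}.

Definition outs (r : seq step) : {set 'I_m} := \bigcup_(st <- r) st_out st.
Definition ins (r : seq step) : {set 'I_m} := \bigcup_(st <- r) st_in st.

(* The entries of kappa_1, ..., kappa_i; the value is irrelevant at the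
   components which have not been selected yet. *)
Definition kap (r : seq step) (j : 'I_m) : nat :=
  foldr (fun st k => if j \in st_out st then st_K st j else k) 0%N r.

(* [inl c] is an original coordinate, [inr (a, j)] is the coordinate
   v^j_[a] = phi^j_[kappa^j + a]. *)
Definition vcoord : Type := (coord n m + nat * 'I_m)%type.

Definition chart (k : 'I_m -> nat) (p : traj) : {ptws vcoord -> F} := fun c =>
  match c with
  | inl c' => p c'
  | inr (a, j) => fshift (k j + a) (phi j) p
  end.

(* The coordinates (.., zeta_[-1], x, v_1, .., v_i, u_rest_i and shifts) after
   the steps r. *)
Definition chart_vars (r : seq step) : pred vcoord := fun c =>
  match c with
  | inl (Uc _ j) => j \notin ins r
  | inl _ => true
  | inr (_, j) => j \in outs r
  end.

(* zeta_[-q1,-1], x, v_1, v_1,[1], .., v_i, v_i,[1], .. *)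
Definition zxv_vars (r : seq step) : pred vcoord := fun c =>
  match c with
  | inl (Zeta b _) => (b < q1)%N
  | inl (Xc _) => true
  | inl (Uc _ _) => false
  | inr (_, j) => j \in outs r
  end.

Definition depends_only_zxv (r : seq step) (h : traj -> F) : Prop :=
  expr_by (chart (kap r)) (zxv_vars r) p0 h.

(* k is the first order of shift of phi^j which depends explicitly also on
   u_rest. *)
Definition first_order (r : seq step) (j : 'I_m) (k : nat) : Prop :=
  (forall k' : nat, (k' < k)%N -> depends_only_zxv r (fshift k' (phi j))) /\
  ~ depends_only_zxv r (fshift k (phi j)).

(* H represents phi_rest,[Ki] in the coordinates reached after the steps r. *)
Definition coord_repr (r : seq step) (Ki : 'I_m -> nat)
    (H : 'I_m -> {ptws vcoord -> F} -> F) : Prop :=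
  forall j, j \notin outs r ->
    smooth_fun_of (chart_vars r) (chart (kap r) p0) (H j) /\
    \forall p \near p0, fshift (Ki j) (phi j) p = H j (chart (kap r) p).

Definition first_orders (r : seq step) (Ki : 'I_m -> nat) : Prop :=
  forall j, j \notin outs r -> first_order r j (Ki j).

(* The Jacobian matrix of (H_j), j in A, with respect to (u^l), l in B. *)
Definition jac_u (H : 'I_m -> {ptws vcoord -> F} -> F) (A B : {set 'I_m})
    (w : {ptws vcoord -> F}) : 'M[F]_(#|A|, #|B|) :=
  \matrix_(a, b) pder (inl (Uc 0 (enum_val b)) : vcoord) (H (enum_val a)) w.

(* A step after the steps r; m_i = #|st_out st|.  The ranks are required on a
   neighbourhood of the equilibrium. *)
Definition is_step (r : seq step) (st : step) : Prop :=
  [/\ outs r != [set: 'I_m]%SET,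
      first_orders r (st_K st),
      st_out st \subset ~: outs r,
      st_in st \subset ~: ins r /\ #|st_in st| = #|st_out st| &
      exists2 H, coord_repr r (st_K st) H &
        \forall p \near p0,
          \rank (jac_u H (~: outs r) (~: ins r) (chart (kap r) p))
            = #|st_out st| /\
          \rank (jac_u H (st_out st) (st_in st) (chart (kap r) p))
            = #|st_out st| ].

Inductive is_run : seq step -> Prop :=
  | run_nil : is_run [::]
  | run_rcons r st : is_run r -> is_step r st -> is_run (rcons r st).

(* The rank found in the last step equals dim(u_rest) iff no component is
   left. *)
Definition is_complete_run (r : seq step) : Prop :=
  is_run r /\ outs r = [set: 'I_m]%SET.

(* The ranks occurring in the procedure are constant near the equilibrium. *)
Definition constant_ranks : Prop :=
  forall r Ki H, is_run r -> outs r != [set: 'I_m]%SET ->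
    first_orders r Ki -> coord_repr r Ki H ->
    exists rho : nat, \forall p \near p0,
      \rank (jac_u H (~: outs r) (~: ins r) (chart (kap r) p)) = rho.

Definition zeta_free : Prop :=
  forall j, smooth_fun_of no_zeta_vars p0 (phi j).

Definition msum (A : 'I_m -> nat) : nat := (\sum_(j < m) A j)%N.

Definition mmin (A : 'I_m -> nat) : nat :=
  (\big[minn / (\max_(j < m) A j)]_(j < m) A j)%N.

(* zeta_[-q1 + min A], .., zeta_[-1], x, delta^A(phi), .., delta^{R-1}(phi);
   zeta_[-b-1] is listed for b < q1 - min A (truncated subtraction). *)
Definition feasible_list (R A : 'I_m -> nat) : seq (traj -> F) :=
  [seq (fun p : traj => p (Zeta b j)) |
     b <- iota 0 (q1 - mmin A), j <- enum 'I_m]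
  ++ [seq (fun p : traj => p (Xc i)) | i <- enum 'I_n]
  ++ [seq fshift a (phi j) | j <- enum 'I_m, a <- iota (A j) (R j - A j)].

Definition feasible (R A : 'I_m -> nat) : Prop :=
  \forall p \near p0, lin_indep_at p (feasible_list R A).

(* zeta_[-q1,-1], x and v_l,[0,r_l - kappa_l - 1] for the components l selected
   in the steps r1. *)
Definition tri_vars (R k : 'I_m -> nat) (r1 : seq step) : pred vcoord := fun c =>
  match c with
  | inl (Zeta b _) => (b < q1)%N
  | inl (Xc _) => true
  | inl (Uc _ _) => false
  | inr (a, l) => (l \in outs r1) && (a < R l - k l)%N
  end.

Definition triangular_form (R : 'I_m -> nat) (r : seq step) : Prop :=
  forall r1 st r2, r = r1 ++ st :: r2 ->
  forall j, j \in st_out st ->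
    (forall a : nat, (a < kap r j)%N ->
       expr_by (chart (kap r)) (tri_vars R (kap r) r1) p0
         (fshift a (phi j))) /\
    (forall p, fshift (kap r j) (phi j) p
       = chart (kap r) p (inr (0%N, j) : vcoord)).

End Flat.

(* Main.v *)
From HB Require Import structures.
From mathcomp Require Import all_boot all_order all_algebra.
From mathcomp Require Import all_classical all_reals topology normedtype derive.
From mathcomp Require Import landau realfun perm ring lra zify.
Require Import Defs.

(** Everything rests on two facts about the differentials dy^j_[a] of the
shifted flat output at the equilibrium p0.  Since the shift fixes p0, a linear
relation between differentials at p0 may be shifted.

First, all the dy^j_[a] are linearly independent ([dy_indep]).  Suppose that a
relation expresses dy^j_[N] by the lower orders and by the dy^l_[N], l <> j.
Shifting it eliminates all the later dy^j, so that dy_[0], ..., dy_[N+B-1] lie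
in the span of N m + B (m - 1) covectors.  By flatness du_[0], ...,
du_[N+B-1-max R] lie there as well, and for large B these are too many.
Second, dy^j_[k] with k >= R^j is not a combination of dzeta, dx and the
remaining dy ([dy_notin_dzx]): q shifts turn zeta_[-q,-1] and x into functions
of y_[0,R+q-1], so the shifted relation would be one between the dy in which
dy^j_[k+q] occurs only once.

The charts.  After any steps of the procedure the whole trajectory can be
recovered from the new coordinates, as soon as the unshifted input can be
recovered by a smooth map U0 of (zeta, x, v, u_rest): the input at a later time
is U0 applied to the shifted coordinates, and the shift can be carried out in
the new coordinates.  Such a map exists by induction on the steps
([charted_run]); the induction step solves phi_[kappa] = v for the inputs u_i
by the implicit function theorem [implicit_exchange], which needs only finitely
many coordinates and follows from [inverse_function].

Termination.  If the rank in a step were zero, the first-order shifts would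
not depend on u_rest at all ([rank_pos]), so each step selects a component.
First orders exist, and are at most R, by [dy_notin_dzx] ([depends_lt]); this
gives kappa <= R.

Triangular form.  If y^j_[a], a < kappa^j, depends on v^l_[b] with
kappa^l + b >= R^l, then so does y^j_[a+q1] on y^l_[kappa^l+b+q1], and nothing
else in that expression involves this covector.  This contradicts independence
of the dy, which persists near p0; and points of the form delta^q1(p) fill a
neighbourhood of p0, since the system is invertible ([repr_pder_zero]).

Counting.  For N >= R the covectors dzeta_[-q,-1], dx and dy_[kappa,N-1] are
independent, being differentials of coordinates ([near_lindep_kap]); there are
q m + n + N m - #kappa of them.  For q = 0 they lie in the span of the N m
covectors dy_[0,N-1], so #kappa >= n.  In case of equality they span the same
space, hence dphi minus its u-part is a combination of dx and the dy as well as
of dzeta and dx, so the zeta-part vanishes ([kap_eq_zeta_free]).  Conversely,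
if zeta does not occur, the dy_[0,N-1] lie in the span of dx and
dy_[kappa,N-1].  Finally, for a feasible A the covectors dzeta_[-q1,-1], dx and
dy_[A,N-1] are independent ([lindep_extend]) and lie in the span of
dzeta_[-q1,-1], dx and dy_[kappa,N-1], so #kappa <= #A. *)

Set Implicit Arguments.
Unset Strict Implicit.
Unset Printing Implicit Defensive.

Import Order.TTheory GRing.Theory Num.Theory numFieldNormedType.Exports.

Local Open Scope classical_set_scope.
Local Open Scope ring_scope.

(** * Differential calculus in finite dimension *)
Lemma cvg_sumr (F : realType) (T I : Type) (L : set_system T) (r : seq I)
    (f : I -> T -> F) (a : I -> F) {FL : Filter L} :
  (forall i, f i x @[x --> L] --> a i) ->
  \sum_(i <- r) f i x @[x --> L] --> \sum_(i <- r) a i.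
Proof.
move=> fa; elim: r => [|i r IH].
  rewrite big_nil; under eq_fun do rewrite big_nil; exact: cvg_cst.
by rewrite big_cons; under eq_fun do rewrite big_cons; exact: cvgD.
Qed.

(** This and the next few lemmas restate filter lemmas for [nbhs], so that no
filter instance has to be found on matrix or product types. *)
Lemma near_forall (T : topologicalType) (I : finType) (P : I -> T -> Prop) (a : T) :
  (forall i, \forall z \near a, P i z) -> \forall z \near a, forall i, P i z.
Proof. by move=> nP; exact: (@filter_forall _ _ P (nbhs a)). Qed.

Lemma near_all (T : topologicalType) (P : T -> Prop) (a : T) :
  (forall z, P z) -> \forall z \near a, P z.
Proof. by move=> nP; exact: (@filterE _ (nbhs a)). Qed.

Lemma nearS (T : topologicalType) (P Q : T -> Prop) (a : T) :
  (forall z, P z -> Q z) -> (\forall z \near a, P z) -> \forall z \near a, Q z.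
Proof. exact: (@filterS _ (nbhs a)). Qed.

Lemma nearS2 (T : topologicalType) (P Q S : T -> Prop) (a : T) :
  (forall z, P z -> Q z -> S z) ->
  (\forall z \near a, P z) -> (\forall z \near a, Q z) -> \forall z \near a, S z.
Proof. exact: (@filterS2 _ (nbhs a)). Qed.

Lemma near_open (T : topologicalType) (U : set T) (a : T) :
  open U -> U a -> \forall z \near a, U z.
Proof. by move=> oU Ua; exact: open_nbhs_nbhs. Qed.

Lemma cts_ltP (F : realType) (T : topologicalType) (V : normedModType F)
    (f : T -> V) (a : T) :
  {for a, continuous f} <->
  forall e : F, 0 < e -> \forall z \near a, `|f a - f z| < e.
Proof. exact: (@cvgrPdist_lt F V T (nbhs a)). Qed.

Lemma near_comp (T T' : topologicalType) (f : T -> T') (a : T) (P : T' -> Prop) :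
  {for a, continuous f} -> (\forall y \near f a, P y) ->
  \forall z \near a, P (f z).
Proof. by move=> cf nP; exact: (cf P). Qed.

Lemma near_and (T : topologicalType) (P Q : T -> Prop) (a : T) :
  (\forall z \near a, P z) -> (\forall z \near a, Q z) ->
  \forall z \near a, P z /\ Q z.
Proof. by move=> nP nQ; apply: (nearS2 _ nP nQ). Qed.

Lemma near_seq (T : topologicalType) (I : eqType) (s : seq I) (P : I -> T -> Prop) (a : T) :
  (forall c, c \in s -> \forall z \near a, P c z) ->
  \forall z \near a, forall c, c \in s -> P c z.
Proof.
elim: s => [|c s IH] H; first by apply: near_all.
have Hs : \forall z \near a, forall c, c \in s -> P c z.
  by apply: IH => d ds; apply: H; rewrite in_cons ds orbT.
have Hc : \forall z \near a, P c z by apply: H; rewrite mem_head.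
apply: (nearS2 _ Hc Hs) => z Pc Ps d.
by rewrite in_cons => /orP[/eqP ->|/Ps].
Qed.

Lemma near_near (T : topologicalType) (P : T -> Prop) (a : T) :
  (\forall z \near a, P z) -> \forall z \near a, \forall y \near z, P y.
Proof. by move=> nP; exact: (nbhs_interior nP). Qed.

Section Gradient.
Variables (F : realType) (N : nat).
Implicit Types (g h : 'rV[F]_N -> F) (z v : 'rV[F]_N) (c : 'I_N -> F).

Definition dotv c v : F := \sum_i v 0 i * c i.

Lemma dotv_linear c : linear (dotv c : 'rV[F]_N -> F).
Proof.
move=> a u v; rewrite /dotv scaler_sumr -big_split; apply: eq_bigr => i _ /=.
by rewrite !mxE mulrDl -mulrA.
Qed.

HB.instance Definition _ c :=
  GRing.isLinear.Build F 'rV[F]_N F _ (dotv c) (dotv_linear c).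

Lemma dotv_continuous c : continuous (dotv c).
Proof.
move=> v; apply: (@cvg_sumr F _ _ (nbhs v) (index_enum 'I_N)
  (fun i w => w 0 i * c i) (fun i => v 0 i * c i)) => i.
by apply: cvgMr_tmp; exact: coord_continuous.
Qed.

Lemma dotv_e c i : dotv c 'e_i = c i.
Proof.
rewrite /dotv (bigD1 i) //= mxE !eqxx mul1r big1 ?addr0 // => j ji.
by rewrite mxE eqxx (negbTE ji) mul0r.
Qed.

(** [c] is the gradient of [g] at [z]; the estimate avoids the little-o
notation, whose equations are hard to obtain for the implicitly defined
functions below. *)
Definition frechet g z c := forall e : F, 0 < e ->
  \forall h \near (0 : 'rV[F]_N), `|g (h + z) - g z - dotv c h| <= e * `|h|.

Lemma frechet_diff g z c : frechet g z c ->
  differentiable g z /\ forall v, 'd g z v = dotv c v.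
Proof.
move=> gc.
have D := @diff_unique F 'rV[F]_N F g (dotv c) z (@dotv_continuous c).
have {}D : 'd g z = dotv c :> ('rV[F]_N -> F).
  apply: D; apply/eqaddoP => e e0; have := gc e e0; apply: filterS => h.
  by rewrite opprD addrA.
split; last by move=> v; rewrite D.
apply/diff_locallyP; rewrite D; split; first exact: dotv_continuous.
apply/eqaddoP => e e0; have := gc e e0; apply: filterS => h.
by rewrite opprD addrA.
Qed.

Lemma frechet_dotv z c : frechet (dotv c) z c.
Proof.
move=> e e0; apply: (@filterE _ (nbhs (0 : 'rV[F]_N))) => h; rewrite linearD /= addrK subrr normr0.
by rewrite mulr_ge0 // ltW.
Qed.

Lemma diff_frechet g z : differentiable g z -> frechet g z (fun i => 'D_('e_i) g z).
Proof.
move=> dg e e0; have /diff_locallyP [_ /eqaddoP/(_ e e0)] := dg.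
apply: filterS => h; rewrite opprD addrA.
have -> // : dotv (fun i => 'D_('e_i) g z) h = 'd g z h.
rewrite [in RHS](row_sum_delta h) linear_sum; apply: eq_bigr => i _.
by rewrite linearZ /= deriveE.
Qed.

Lemma frechet_D g z c : frechet g z c -> forall v, 'D_v g z = dotv c v.
Proof. by move=> /frechet_diff [dg dE] v; rewrite deriveE. Qed.

Lemma diff_D g z v : differentiable g z ->
  'D_v g z = dotv (fun i => 'D_('e_i) g z) v.
Proof. by move=> /diff_frechet/frechet_D. Qed.

Lemma near_eq_frechet g h z c : (\forall y \near z, g y = h y) ->
  frechet g z c -> frechet h z c.
Proof.
move=> gh gc e e0; have := gc e e0.
have gh0 : \forall y \near (0 : 'rV[F]_N), g (y + z) = h (y + z).
  by move: gh; rewrite [\forall y \near z, _](near_shift 0 z) subr0 /=.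
apply: filterS2 gh0 => y gy.
by rewrite gy (nbhs_singleton gh).
Qed.

Lemma near_eq_differentiable g h z : (\forall y \near z, g y = h y) ->
  differentiable g z -> differentiable h z.
Proof. by move=> gh /diff_frechet/(near_eq_frechet gh)/frechet_diff[]. Qed.

End Gradient.

Section Ck.
Variable F : realType.

(** The order of differentiability is an explicit recursion parameter: closure
under products and composition is proved by induction on it, as the
derivative of a product or composite is made of the functions themselves and of
their derivatives, which are one order less differentiable. *)
Fixpoint Ck N (U : set 'rV[F]_N) (k : nat) (g : 'rV[F]_N -> F) : Prop :=
  (forall z, U z -> differentiable g z) /\
  (if k is k'.+1 then forall i, Ck U k' ('D_('e_i) g) else True).

Definition Cinf N (U : set 'rV[F]_N) (g : 'rV[F]_N -> F) := forall k, Ck U k g.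

Section Basic.
Variables (N : nat) (U : set 'rV[F]_N).
Implicit Types (g h : 'rV[F]_N -> F).

Lemma Ck_diff k g z : Ck U k g -> U z -> differentiable g z.
Proof. by case: k => [|k] [+ _]; apply. Qed.

Lemma CkW k g : Ck U k.+1 g -> Ck U k g.
Proof. by elim: k g => [|k IH] g [dg Dg]; split=> // i; exact: IH. Qed.

Lemma Ck_sub (V : set 'rV[F]_N) k g : (forall z, V z -> U z) ->
  Ck U k g -> Ck V k g.
Proof.
move=> VU; elim: k g => [|k IH] g [dg Dg]; split=> //; try by move=> z /VU/dg.
by move=> i; exact: IH (Dg i).
Qed.

Hypothesis oU : open U.

Lemma Ck_ext k g h : (forall z, U z -> g z = h z) -> Ck U k g -> Ck U k h.
Proof.
elim: k g h => [|k IH] g h gh [dg Dg]; split=> //.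
- move=> z Uz; apply: near_eq_differentiable (dg z Uz).
  by apply: nearS (near_open oU Uz).
- move=> z Uz; apply: near_eq_differentiable (dg z Uz).
  by apply: nearS (near_open oU Uz).
- move=> i; apply: IH (Dg i) => z Uz; apply: near_eq_derive.
  by apply: nearS (near_open oU Uz).
Qed.

Lemma Ck_cst k (a : F) : Ck U k (fun=> a).
Proof.
elim: k a => [|k IH] a; split=> //; try by move=> z _; exact: differentiable_cst.
by move=> i; apply: Ck_ext (IH 0) => z _; rewrite derive_cst.
Qed.

Lemma Ck_dotv k c : Ck U k (dotv c).
Proof.
have dd z : differentiable (dotv c) z by have [] := frechet_diff (frechet_dotv z c).
case: k => [|k]; split=> // i; apply: Ck_ext (Ck_cst k (c i)) => z _.
by rewrite (frechet_D (frechet_dotv z c)) dotv_e.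
Qed.

Lemma Ck_coord k j : Ck U k (fun z => z 0 j).
Proof.
apply: Ck_ext (Ck_dotv k (fun i => (i == j)%:R)) => z _.
rewrite /dotv (bigD1 j) //= eqxx mulr1 big1 ?addr0 // => i ij.
by rewrite (negbTE ij) mulr0.
Qed.

Lemma CkD k g h : Ck U k g -> Ck U k h -> Ck U k (fun z => g z + h z).
Proof.
elim: k g h => [|k IH] g h [dg Dg] [dh Dh]; split=> //;
  try by move=> z Uz; apply: differentiableD; [exact: dg|exact: dh].
move=> i; apply: Ck_ext (IH _ _ (Dg i) (Dh i)) => z Uz.
by rewrite deriveD //; apply: diff_derivable; [exact: dg|exact: dh].
Qed.

Lemma CkM k g h : Ck U k g -> Ck U k h -> Ck U k (fun z => g z * h z).
Proof.
elim: k g h => [|k IH] g h Cg Ch; split=> //;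
  try by move=> z Uz; apply: differentiableM; [exact: Ck_diff Cg Uz|exact: Ck_diff Ch Uz].
move=> i; have [_ Dg] := Cg; have [_ Dh] := Ch.
apply: Ck_ext (CkD (IH _ _ (CkW Cg) (Dh i)) (IH _ _ (CkW Ch) (Dg i))) => z Uz.
by rewrite deriveM //; apply: diff_derivable; [exact: Ck_diff Cg Uz|exact: Ck_diff Ch Uz].
Qed.

Lemma CkN k g : Ck U k g -> Ck U k (fun z => - g z).
Proof.
move=> Cg; apply: Ck_ext (CkM (Ck_cst k (-1)) Cg) => z _; exact: mulN1r.
Qed.

Lemma Ck_sum k (I : Type) (r : seq I) (G : I -> 'rV[F]_N -> F) :
  (forall i, Ck U k (G i)) -> Ck U k (fun z => \sum_(i <- r) G i z).
Proof.
move=> CG; elim: r => [|i r IH].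
  by apply: Ck_ext (Ck_cst k 0) => z _; rewrite big_nil.
by apply: Ck_ext (CkD (CG i) IH) => z _; rewrite big_cons.
Qed.

Lemma CkV k g : (forall z, U z -> g z != 0) -> Ck U k g ->
  Ck U k (fun z => (g z)^-1).
Proof.
move=> g0; elim: k g g0 => [|k IH] g g0 Cg; split=> //;
  try by move=> z Uz; apply: differentiableV; [exact: Ck_diff Cg Uz|exact: g0].
move=> i; have [_ Dg] := Cg; have iC := IH _ g0 (CkW Cg).
apply: Ck_ext (CkM (CkN (CkM iC iC)) (Dg i)) => z Uz.
rewrite deriveV ?g0 //; last by apply: diff_derivable; exact: Ck_diff Cg Uz.
by rewrite -exprVn expr2 scaleNr mulNr.
Qed.

End Basic.

Section Comp.
Variables (N M : nat) (U : set 'rV[F]_N) (V : set 'rV[F]_M).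
Hypotheses (oU : open U) (oV : open V).
Variable Phi : 'rV[F]_N -> 'rV[F]_M.

Lemma diff_row z : (forall j, differentiable (fun y => Phi y 0 j) z) ->
  differentiable Phi z.
Proof.
move=> dP; rewrite (_ : Phi = \sum_j (fun y => Phi y 0 j *: ('e_j : 'rV[F]_M))).
  by apply: differentiable_sum => j; exact: differentiableZl.
by apply/funext => y; rewrite fct_sumE -row_sum_delta.
Qed.

Lemma derive_comp g z v : differentiable g (Phi z) ->
  (forall j, differentiable (fun y => Phi y 0 j) z) ->
  'D_v (fun y => g (Phi y)) z =
    \sum_j 'D_v (fun y => Phi y 0 j) z * 'D_('e_j) g (Phi z).
Proof.
move=> dg dP; have dPhi := diff_row dP.
rewrite deriveE; last exact: (@differentiable_comp _ _ _ _ Phi g).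
rewrite (@diff_comp _ _ _ _ Phi g) //= -deriveE // -deriveE //.
rewrite (diff_D _ dg) derive_mx; last exact: diff_derivable.
by apply: eq_bigr => j _; rewrite mxE.
Qed.

Lemma Ck_comp k g : (forall z, U z -> V (Phi z)) ->
  (forall j, Ck U k (fun z => Phi z 0 j)) -> Ck V k g ->
  Ck U k (fun z => g (Phi z)).
Proof.
move=> UV; elim: k g => [|k IH] g CP Cg; split=> //.
- move=> z Uz; apply: (@differentiable_comp _ _ _ _ Phi g).
    by apply: diff_row => j; exact: Ck_diff (CP j) Uz.
  by apply: (Ck_diff Cg); exact: UV.
- move=> z Uz; apply: (@differentiable_comp _ _ _ _ Phi g).
    by apply: diff_row => j; exact: Ck_diff (CP j) Uz.
  by apply: (Ck_diff Cg); exact: UV.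
- move=> i; have [_ Dg] := Cg.
  have CP' j : Ck U k (fun z => Phi z 0 j) by exact: CkW.
  have CS : Ck U k (fun z => \sum_j
      'D_('e_i) (fun y => Phi y 0 j) z * 'D_('e_j) g (Phi z)).
    apply: Ck_sum => // j; apply: CkM => //; last exact: (IH _ CP' (Dg j)).
    by have [_ /(_ i)] := CP j.
  apply: Ck_ext CS => // z Uz; rewrite derive_comp //.
    by apply: (Ck_diff Cg); exact: UV.
  by move=> j; exact: Ck_diff (CP j) Uz.
Qed.

End Comp.
End Ck.

Section SmoothAt.
Variable F : realType.

Lemma Cinf_foldr N (U : set 'rV[F]_N) (g : 'rV[F]_N -> F) :
  Cinf U g <-> forall s z, U z ->
    differentiable (foldr (fun i h => 'D_('e_i) h) g s) z.
Proof.
split=> [Cg s|Dg k].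
  elim/last_ind: s g Cg => [|s i IH] g Cg z Uz; first exact: Ck_diff (Cg 0%N) Uz.
  by rewrite foldr_rcons; apply: IH => // k; have [_ ] := Cg k.+1; apply.
elim: k g Dg => [|k IH] g Dg; split=> //; try exact: (Dg [::]).
by move=> i; apply: IH => s z Uz; rewrite -foldr_rcons; exact: Dg.
Qed.

(** One and the same open set serves all orders, which is what makes
closure under composition follow from the case of a fixed order. *)
Lemma smooth_atP N (g : 'rV[F]_N -> F) a :
  smooth_at g a <-> exists U : set 'rV[F]_N, [/\ open U, U a & Cinf U g].
Proof.
split=> [sg|[U [oU Ua /Cinf_foldr Cg]]]; last first.
  by apply: nearS (near_open oU Ua) => z Uz s; exact: Cg.
exists (interior [set z | forall s, differentiable (foldr (fun i h => 'D_('e_i) h) g s) z]).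
split; [exact: open_interior|exact: sg|].
by apply/Cinf_foldr => s z /interior_subset/(_ s).
Qed.

Lemma smooth_rowP N M (Phi : 'rV[F]_N -> 'rV[F]_M) a :
  (forall j, smooth_at (fun z => Phi z 0 j : F) a) ->
  exists U : set 'rV[F]_N,
    [/\ open U, U a & forall j, Cinf U (fun z => Phi z 0 j)].
Proof.
move=> sP; exists (interior [set z | forall j s,
  differentiable (foldr (fun i h => 'D_('e_i) h) (fun z => Phi z 0 j) s) z]).
split; first exact: open_interior.
  have : \forall z \near a, forall j s,
      differentiable (foldr (fun i h => 'D_('e_i) h) (fun z => Phi z 0 j) s) z.
    by apply: near_forall => j; exact: sP.
  by [].
by move=> j; apply/Cinf_foldr => s z /interior_subset/(_ j s).
Qed.

Lemma smooth_near N (g : 'rV[F]_N -> F) a :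
  smooth_at g a -> \forall z \near a, smooth_at g z.
Proof.
move=> /smooth_atP [U [oU Ua Cg]].
apply: nearS (near_open oU Ua) => z Uz.
by apply/smooth_atP; exists U.
Qed.

Lemma smooth_diff N (g : 'rV[F]_N -> F) a : smooth_at g a -> differentiable g a.
Proof. by move=> /nbhs_singleton /(_ [::]). Qed.

Lemma smooth_cts N (g : 'rV[F]_N -> F) a : smooth_at g a -> {for a, continuous g}.
Proof. by move=> /smooth_diff/differentiable_continuous. Qed.

Lemma smooth_D N (g : 'rV[F]_N -> F) a i :
  smooth_at g a -> smooth_at ('D_('e_i) g : _ -> F) a.
Proof.
apply: nearS => z Dg s; have := Dg (rcons s i).
by rewrite foldr_rcons.
Qed.

Lemma smooth_ext N (g h : 'rV[F]_N -> F) a : (\forall z \near a, g z = h z) ->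
  smooth_at g a -> smooth_at h a.
Proof.
move=> gh /smooth_atP [U [oU Ua Cg]]; apply/smooth_atP.
have [V [oV Va gV]] : exists V : set 'rV[F]_N,
    [/\ open V, V a & forall z, V z -> g z = h z].
  exists (interior [set z | g z = h z]).
  by split; [exact: open_interior|exact: gh|move=> z /interior_subset].
exists (U `&` V); split; [exact: openI|by []|].
move=> k; apply: (@Ck_ext _ _ _ _ _ g); first exact: openI.
  by move=> z [_ /gV].
by apply: Ck_sub (Cg k) => z [].
Qed.

Lemma row_cts (T : topologicalType) M (Phi : T -> 'rV[F]_M) a :
  (forall j, {for a, continuous (fun z => Phi z 0 j : F)}) ->
  {for a, continuous Phi}.
Proof.
move=> cP; apply/cts_ltP => e e0.
have : \forall z \near a, forall j, `|Phi a 0 j - Phi z 0 j| < e.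
  by apply: near_forall => j; have /cts_ltP/(_ e e0) := cP j.
apply: nearS => z Hz.
rewrite [ltLHS]/Num.Def.normr /= mx_normrE.
apply/bigmax_ltP; split=> // -[i j] _ /=.
by rewrite !mxE ord1; exact: Hz.
Qed.

Lemma smooth_comp N M (Phi : 'rV[F]_N -> 'rV[F]_M) (g : 'rV[F]_M -> F) a :
  (forall j, smooth_at (fun z => Phi z 0 j : F) a) ->
  smooth_at g (Phi a) -> smooth_at (fun z => g (Phi z)) a.
Proof.
move=> sP /smooth_atP [V [oV VPa Cg]]; apply/smooth_atP.
have [U [oU Ua CP]] := smooth_rowP sP.
exists (interior (U `&` Phi @^-1` V)); split; first exact: open_interior.
  apply: filterI; first exact: open_nbhs_nbhs.
  have : {for a, continuous Phi} by apply: row_cts => j; exact: smooth_cts.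
  by apply; exact: open_nbhs_nbhs.
move=> k; apply: (@Ck_comp _ _ _ _ V) => //; first exact: open_interior.
- by move=> z /interior_subset [].
- by move=> j; apply: Ck_sub (CP j k) => z /interior_subset [].
Qed.

Lemma smooth_cst N (b : F) (a : 'rV[F]_N) : smooth_at (fun=> b) a.
Proof.
by apply/smooth_atP; exists setT; split=> //; [exact: openT|move=> k; exact/Ck_cst/openT].
Qed.

Lemma smooth_coord N (a : 'rV[F]_N) j : smooth_at (fun z => z 0 j : F) a.
Proof.
by apply/smooth_atP; exists setT; split=> //; [exact: openT|move=> k; exact/Ck_coord/openT].
Qed.

Lemma smooth_sum N (I : Type) (r : seq I) (G : I -> 'rV[F]_N -> F) a :
  (forall i, smooth_at (G i) a) -> smooth_at (fun z => \sum_(i <- r) G i z) a.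
Proof.
move=> sG; elim: r => [|i r IH].
  by apply: smooth_ext (smooth_cst 0 a); apply: near_all => z; rewrite big_nil.
have /smooth_atP [U [oU Ua CU]] := sG i.
have /smooth_atP [V [oV Va CV]] := IH.
apply/smooth_atP; exists (U `&` V); split; [exact: openI|by []|move=> k].
apply: (@Ck_ext _ _ _ _ _ (fun z => G i z + \sum_(i <- r) G i z)).
- exact: openI.
- by move=> z _; rewrite big_cons.
- apply: CkD; first exact: openI.
    by apply: Ck_sub (CU k) => z [].
  by apply: Ck_sub (CV k) => z [].
Qed.

Lemma smooth_scale N (b : F) (g : 'rV[F]_N -> F) a :
  smooth_at g a -> smooth_at (fun z => b * g z) a.
Proof.
move=> /smooth_atP [U [oU Ua Cg]]; apply/smooth_atP; exists U; split=> // k.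
by apply: CkM => //; exact: Ck_cst.
Qed.

End SmoothAt.

(** * The inverse function theorem *)
Section Exchange.
Variables (F : realType) (N : nat).
Implicit Types (y z w : 'rV[F]_N) (t : F).

Definition upd z (c : 'I_N) t : 'rV[F]_N := \row_i (if i == c then t else z 0 i).

Lemma upd_same z c t : upd z c t 0 c = t. Proof. by rewrite mxE eqxx. Qed.
Lemma upd_other z c t i : i != c -> upd z c t 0 i = z 0 i.
Proof. by move=> ic; rewrite mxE (negbTE ic). Qed.
Lemma upd_upd z c t t' : upd (upd z c t) c t' = upd z c t'.
Proof. by apply/rowP => i; rewrite !mxE; case: eqP. Qed.
Lemma upd_id z c : upd z c (z 0 c) = z.
Proof. by apply/rowP => i; rewrite !mxE; case: eqP => [->|]. Qed.

(** The same shape as the invertibility hypothesis on the system: the germ of an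
inverse, smooth together with the map. *)
Definition local_diffeo (Phi : 'rV[F]_N -> 'rV[F]_N) a :=
  (forall j, smooth_at (fun z => Phi z 0 j : F) a) /\
  exists Psi : 'rV[F]_N -> 'rV[F]_N,
  [/\ forall j, smooth_at (fun z => Psi z 0 j : F) (Phi a),
      \forall z \near a, Psi (Phi z) = z &
      \forall w \near Phi a, Phi (Psi w) = w].

Lemma smooth_row_cts M (Phi : 'rV[F]_N -> 'rV[F]_M) a :
  (forall j, smooth_at (fun z => Phi z 0 j : F) a) -> {for a, continuous Phi}.
Proof. by move=> sP; apply: row_cts => j; exact: smooth_cts. Qed.

Lemma local_diffeo_ext Phi Phi' a : (\forall z \near a, Phi z = Phi' z) ->
  local_diffeo Phi a -> local_diffeo Phi' a.
Proof.
move=> PP [sP [Psi [sPsi PK PK']]].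
have e := nbhs_singleton PP.
split=> [j|].
  by apply: smooth_ext (sP j); apply: nearS PP => z ->.
exists Psi; split; rewrite -?e //.
  by apply: nearS2 PP PK => z ->.
have Pa : Psi (Phi a) = a by exact: (nbhs_singleton PK).
have : \forall w \near Phi a, Phi (Psi w) = Phi' (Psi w).
  by apply: (near_comp (P := fun z => Phi z = Phi' z) (smooth_row_cts sPsi)); rewrite Pa.
by apply: nearS2 PK' => w wK <-.
Qed.

Lemma local_diffeo_comp Phi Phi' a : local_diffeo Phi a ->
  local_diffeo Phi' (Phi a) -> local_diffeo (Phi' \o Phi) a.
Proof.
move=> [sP [Psi [sPsi PK PK']]] [sP' [Psi' [sPsi' PK2 PK2']]].
have Pa : Psi (Phi a) = a by exact: (nbhs_singleton PK).
have Pa' : Psi' (Phi' (Phi a)) = Phi a by exact: (nbhs_singleton PK2).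
split=> [j|]; first exact: (@smooth_comp F N N Phi (fun y => Phi' y 0 j) a sP (sP' j)).
exists (Psi \o Psi'); split=> /=.
- move=> j; apply: (@smooth_comp F N N Psi' (fun y => Psi y 0 j) _ sPsi').
  by rewrite Pa'; exact: sPsi.
- have : \forall z \near a, Psi' (Phi' (Phi z)) = Phi z.
    exact: (near_comp (P := fun y => Psi' (Phi' y) = y) (smooth_row_cts sP)).
  by apply: nearS2 PK => z zK ->.
- have : \forall w \near Phi' (Phi a), Phi (Psi (Psi' w)) = Psi' w.
    by apply: (near_comp (P := fun y => Phi (Psi y) = y) (smooth_row_cts sPsi')); rewrite Pa'.
  by apply: nearS2 PK2' => w wK ->.
Qed.

Lemma local_diffeo_id a : local_diffeo id a.
Proof.
split; first by move=> j; exact: smooth_coord.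
exists id; split; first by move=> j; exact: smooth_coord.
- exact: near_all.
- exact: near_all.
Qed.

Lemma smooth_upd c (h : 'rV[F]_N -> F) a : smooth_at h a ->
  forall j, smooth_at (fun z => upd z c (h z) 0 j : F) a.
Proof.
move=> sh j; have [->|jc] := eqVneq j c.
  by apply: smooth_ext sh; apply: near_all => z; rewrite upd_same.
by apply: smooth_ext (smooth_coord a j); apply: near_all => z; rewrite upd_other.
Qed.

End Exchange.

Section Lines.
Variables (F : realType) (N : nat).
Implicit Types (y z v : 'rV[F]_N) (h : 'rV[F]_N -> F).

(** Restriction to lines reduces the mean value theorem and the intermediate
value theorem to functions of one variable. *)
Lemma is_derive_line h z v (t : F) : differentiable h (z + t *: v) ->
  is_derive t 1 (fun t => h (z + t *: v)) ('D_v h (z + t *: v)).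
Proof.
move=> dh.
have E : (fun s : F => s^-1 *: (((fun t => h (z + t *: v)) \o
            pseudometric_normed_Zmodule.shift t) (s *: 1) - h (z + t *: v)))
   = (fun s : F => s^-1 *: ((h \o pseudometric_normed_Zmodule.shift (z + t *: v))
            (s *: v) - h (z + t *: v))).
  apply/funext => s /=; congr (_ *: (h _ - _)).
  by rewrite -[s *: 1]/(s * 1) mulr1 scalerDl addrCA.
split; last by rewrite /derive E.
rewrite /derivable E; exact: diff_derivable.
Qed.

Lemma upd_line z c t : upd z c t = upd z c 0 + t *: 'e_c.
Proof.
apply/rowP => i; rewrite !mxE eqxx /=.
by have [_|ic] := eqVneq i c; rewrite ?mulr1 ?mulr0 ?add0r ?addr0.
Qed.

Lemma near_box (P : 'rV[F]_N -> Prop) z : (\forall y \near z, P y) ->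
  exists r : F, 0 < r /\ forall y, (forall i, `|y 0 i - z 0 i| <= r) -> P y.
Proof.
move=> /nbhs_ballP [e /= e0 eP]; exists (e / 2); split; first by rewrite divr_gt0.
move=> y yz; apply: eP; rewrite -ball_normE /=.
apply: (@le_lt_trans _ _ (e / 2)); last by rewrite ltr_pdivrMr // ltr_pMr // ltr1n.
rewrite [leLHS]/Num.Def.normr /= mx_normrE.
apply/bigmax_leP; split; first by rewrite ltW // divr_gt0.
by move=> -[i j] _ /=; rewrite !mxE ord1 distrC.
Qed.

Lemma near_coord z (r : F) i : 0 < r ->
  \forall y \near z, `|(y : 'rV[F]_N) 0 i - z 0 i| < r.
Proof.
move=> r0; have /cts_ltP/(_ r r0) := @coord_continuous F _ _ 0 i z.
by apply: nearS => y; rewrite distrC.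
Qed.

Lemma MVT_line h z v (s t : F) : s < t ->
  (forall x, s <= x <= t -> differentiable h (z + x *: v)) ->
  exists2 x, s < x < t &
    h (z + t *: v) - h (z + s *: v) = 'D_v h (z + x *: v) * (t - s).
Proof.
move=> st dh.
have dd x : x \in `[s, t] -> derivable (fun x : F => h (z + x *: v)) x 1.
  by rewrite in_itv /= => /dh /is_derive_line [].
have [] := @MVT F (fun x : F => h (z + x *: v)) (fun x : F => 'D_v h (z + x *: v)) s t st.
- move=> x; rewrite in_itv /= => /andP[sx xt]; apply: is_derive_line.
  by apply: dh; rewrite !ltW.
- exact: derivable_within_continuous.
- by move=> x; rewrite in_itv /= => xst E; exists x.
Qed.

Lemma IVT_line h z v (s t w : F) : s <= t ->
  (forall x, s <= x <= t -> differentiable h (z + x *: v)) ->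
  h (z + s *: v) <= w <= h (z + t *: v) ->
  exists2 x, s <= x <= t & h (z + x *: v) = w.
Proof.
move=> st dh /andP[sw wt].
have [] := @IVT F (fun x : F => h (z + x *: v)) s t w st.
- apply: derivable_within_continuous => x; rewrite in_itv /=.
  by move=> /dh /is_derive_line [].
- by rewrite ge_min sw /= le_max wt orbT.
- by move=> x; rewrite in_itv /= => xst E; exists x.
Qed.

End Lines.

(** Replacing the coordinate [c] of [z] by [h z] is a local diffeomorphism if
dh/dz_c > 0.  On a closed box around [a] where this derivative is positive, [h]
increases along the direction [c], so [h = w_c] has exactly one solution
between the two faces whenever [w_c] lies between the values of [h] there. *)
Section ScalarImplicit.
Variables (F : realType) (N : nat) (U : set 'rV[F]_N) (h : 'rV[F]_N -> F).
Variables (a : 'rV[F]_N) (c : 'I_N) (r : F).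
Implicit Types (w : 'rV[F]_N) (s t : F).
Hypotheses (Ch : Cinf U h) (r0 : 0 < r) (oU : open U).
Hypothesis box : forall y : 'rV[F]_N, (forall i, `|y 0 i - a 0 i| <= r) ->
  U y /\ 0 < 'D_('e_c) h y.

Let lo := a 0 c - r.
Let hi := a 0 c + r.

Let inB (w : 'rV[F]_N) := forall i, i != c -> `|w 0 i - a 0 i| < r.

Let inB_upd w t i : inB w -> lo <= t <= hi -> `|upd w c t 0 i - a 0 i| <= r.
Proof.
move=> Bw tI; have [->|ic] := eqVneq i c; last by rewrite upd_other // ltW // Bw.
by rewrite upd_same ler_distl.
Qed.

Let dh_upd w t : inB w -> lo <= t <= hi -> differentiable h (upd w c t).
Proof.
move=> Bw tI; apply: (Ck_diff (Ch 0%N)).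
by have [] := @box (upd w c t) (fun i => inB_upd i Bw tI).
Qed.

Let h_incr w s t : inB w -> lo <= s -> s < t -> t <= hi ->
  h (upd w c s) < h (upd w c t).
Proof.
move=> Bw ls st th.
have I x : s <= x <= t -> lo <= x <= hi.
  by move=> /andP[sx xt]; rewrite (le_trans ls sx) (le_trans xt th).
have [|x /andP[sx xt] E] := @MVT_line F N h (upd w c 0) 'e_c s t st.
  by move=> x /I xI; rewrite -upd_line; exact: dh_upd.
rewrite -subr_gt0 (upd_line w c t) (upd_line w c s) E -upd_line.
rewrite mulr_gt0 ?subr_gt0 //.
have xI : lo <= x <= hi by apply: I; rewrite !ltW.
by have [] := @box (upd w c x) (fun i => inB_upd i Bw xI).
Qed.

(** The points w for which the solution is strictly inside the box; being
open, V carries the inverse. *)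
Let V : set 'rV[F]_N := [set w | inB w /\
   (h (upd w c lo) < w 0 c < h (upd w c hi))].

Let loI : lo <= lo <= hi.
Proof. by rewrite lexx /= lerD2l ge0_cp // ltW. Qed.
Let hiI : lo <= hi <= hi.
Proof. by rewrite lexx andbT /= lerD2l ge0_cp // ltW. Qed.

Let cts_upd t w : {for w, continuous (fun w : 'rV[F]_N => upd w c t)}.
Proof.
by apply: row_cts => j; exact: smooth_cts (smooth_upd c (smooth_cst t w) j).
Qed.

Let cts_hupd t w : inB w -> lo <= t <= hi ->
  {for w, continuous (fun w : 'rV[F]_N => h (upd w c t) - w 0 c)}.
Proof.
move=> Bw tI.
have c1 : {for w, continuous (fun w : 'rV[F]_N => h (upd w c t))}.
  apply/cts_ltP => e e0.
  apply: (near_comp (P := fun y => `|h (upd w c t) - h y| < e) (@cts_upd t w)).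
  have /cts_ltP := differentiable_continuous (dh_upd Bw tI); exact.
have c2 := @coord_continuous F _ _ 0 c w.
exact: cvgB c1 c2.
Qed.

Let near_lt0 (f : 'rV[F]_N -> F) w : {for w, continuous f} -> f w < 0 ->
  \forall y \near w, f y < 0.
Proof.
move=> /cts_ltP cf fw; have := cf (- f w); rewrite oppr_gt0 => /(_ fw).
apply: nearS => y; rewrite ltr_distlC => /andP[_].
by rewrite addrN.
Qed.

Let near_gt0 (f : 'rV[F]_N -> F) w : {for w, continuous f} -> 0 < f w ->
  \forall y \near w, 0 < f y.
Proof.
move=> /cts_ltP cf fw; have := cf (f w) fw.
apply: nearS => y; rewrite ltr_distlC => /andP[+ _].
by rewrite subrr.
Qed.

Let near_inB w : inB w -> \forall y \near w, inB y.
Proof.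
move=> Bw; apply: near_forall => i.
have [->|ic] := eqVneq i c; first by apply: near_all.
have /cts_ltP cc := @coord_continuous F _ _ 0 i w.
have := cc (r - `|w 0 i - a 0 i|); rewrite subr_gt0 => /(_ (Bw i ic)).
apply: nearS => y yw _.
rewrite -(subrK (w 0 i) (y 0 i)) -addrA (le_lt_trans (ler_normD _ _)) //.
by rewrite -ltrBrDr distrC.
Qed.

Let openV : open V.
Proof.
rewrite openE => w [Bw /andP[wl wh]].
have l0 : h (upd w c lo) - w 0 c < 0 by rewrite subr_lt0.
have h0 : 0 < h (upd w c hi) - w 0 c by rewrite subr_gt0.
have A1 := near_lt0 (cts_hupd Bw loI) l0.
have A2 := near_gt0 (cts_hupd Bw hiI) h0.
have A3 := nearS2 (S := fun y => h (upd y c lo) - y 0 c < 0 < h (upd y c hi) - y 0 c)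
  (fun y y1 y2 => introT andP (conj y1 y2)) A1 A2.
rewrite /interior /=.
apply: (@nearS2 _ _ _ (fun y => V y) w _ (near_inB Bw) A3) => y By.
by rewrite subr_lt0 subr_gt0.
Qed.

(** The solution of h = w_c on the line through w; outside V the value of [get]
is arbitrary. *)
Let G (w : 'rV[F]_N) : F := get (fun t => (lo <= t <= hi) /\ h (upd w c t) = w 0 c).

Let GP w : V w -> lo < G w < hi /\ h (upd w c (G w)) = w 0 c.
Proof.
move=> [Bw /andP[wl wh]].
have lh : lo <= hi by have /andP[] := loI.
have [||t tI Et] := @IVT_line F N h (upd w c 0) 'e_c lo hi (w 0 c) lh.
- by move=> x xI; rewrite -upd_line; exact: dh_upd.
- by rewrite -!upd_line !ltW.
rewrite -upd_line in Et.
have [/andP[lG Gh] EG] := @getPex _ (fun t => (lo <= t <= hi) /\ h (upd w c t) = w 0 c)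
  (ex_intro _ t (conj tI Et)).
rewrite -/(G w) in lG Gh EG *; split=> //; rewrite !lt_neqAle lG Gh !andbT.
by apply/andP; split; apply/eqP => E; move: wl wh;
  rewrite -EG ?E ?ltxx // -E ltxx.
Qed.

Let G_uniq w t : V w -> lo <= t <= hi -> h (upd w c t) = w 0 c -> G w = t.
Proof.
move=> Vw /andP[lt th] Et; have [/andP[lG Gh] EG] := GP Vw; have [Bw _] := Vw.
case: (ltgtP (G w) t) => // Gt.
  by have := h_incr Bw (ltW lG) Gt th; rewrite EG Et ltxx.
by have := h_incr Bw lt Gt (ltW Gh); rewrite EG Et ltxx.
Qed.

(** The values of h at G w - e and G w + e (cut off at the faces) enclose w_c,
and still do so for y near w; by monotonicity the solution at y is caught in
between. *)
Let G_cts w : V w -> forall e : F, 0 < e ->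
  \forall y \near w, `|G y - G w| < e.
Proof.
move=> Vw e e0; have [/andP[lG Gh] EG] := GP Vw; have [Bw _] := Vw.
pose s := Order.max lo (G w - e); pose t := Order.min hi (G w + e).
have sG : s < G w by rewrite gt_max lG /= ltrBlDr ltrDl.
have Gt : G w < t by rewrite lt_min Gh /= ltrDl.
have ls : lo <= s by rewrite le_max lexx.
have th : t <= hi by rewrite ge_min lexx.
have sI : lo <= s <= hi by rewrite ls /= (le_trans (ltW sG)) // ltW.
have tI : lo <= t <= hi by rewrite th andbT (le_trans (ltW lG)) // ltW.
have l0 : h (upd w c s) - w 0 c < 0.
  by rewrite subr_lt0 -[ltRHS]EG; apply: h_incr => //; exact: ltW.
have h0 : 0 < h (upd w c t) - w 0 c.
  by rewrite subr_gt0 -[ltLHS]EG; apply: h_incr => //; exact: ltW.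
have A1 := near_lt0 (cts_hupd Bw sI) l0.
have A2 := near_gt0 (cts_hupd Bw tI) h0.
have A3 := nearS2 (S := fun y => h (upd y c s) - y 0 c < 0 < h (upd y c t) - y 0 c)
  (fun y y1 y2 => introT andP (conj y1 y2)) A1 A2.
apply: (@nearS2 _ _ _ _ w _ (near_open openV Vw) A3) => y Vy.
rewrite subr_lt0 subr_gt0 => /andP[ys yt].
have [/andP[lGy Gyh] EGy] := GP Vy; have [By _] := Vy.
have sGy : s < G y.
  rewrite ltNge; apply/negP; rewrite le_eqVlt => /orP[/eqP E|Gs].
    by move: ys; rewrite -E EGy ltxx.
  have := h_incr By (ltW lGy) Gs (proj2 (andP sI)).
  by rewrite EGy => /(lt_trans ys); rewrite ltxx.
have Gyt : G y < t.
  rewrite ltNge; apply/negP; rewrite le_eqVlt => /orP[/eqP E|Gs].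
    by move: yt; rewrite E EGy ltxx.
  have := h_incr By (proj1 (andP tI)) Gs (ltW Gyh).
  by rewrite EGy => /(lt_trans yt); rewrite ltxx.
rewrite ltr_distl.
rewrite (le_lt_trans _ sGy) ?le_max ?lexx ?orbT //=.
by rewrite (lt_le_trans Gyt) // ge_min lexx orbT.
Qed.

Let Psi (w : 'rV[F]_N) : 'rV[F]_N := upd w c (G w).

Let PsiU w : V w -> U (Psi w) /\ 0 < 'D_('e_c) h (Psi w).
Proof.
move=> Vw; have [/andP[lG Gh] _] := GP Vw; have [Bw _] := Vw.
by apply: box => i; apply: inB_upd => //; rewrite !ltW.
Qed.

(** The gradient of G, found by differentiating h(Psi w) = w_c. *)
Let gam w (i : 'I_N) : F :=
  (if i == c then 1 else - 'D_('e_i) h (Psi w)) / 'D_('e_c) h (Psi w).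

Let norm_coord (v : 'rV[F]_N) i : `|v 0 i| <= `|v|.
Proof.
rewrite [leRHS]/Num.Def.normr /= mx_normrE.
exact: (le_bigmax _ (fun ij : 'I_1 * 'I_N => `|v ij.1 ij.2|) (0, i)).
Qed.

(** With D the increment of G and d the derivative dh/dz_c, linearising
h(Psi w) = w_c gives d (D - gam x) = error, where the error is small relative
to |x| + |D|.  This first bounds |D| by a multiple of |x|, and then makes the
error small relative to |x|. *)
Let G_frechet w : V w -> frechet G w (gam w).
Proof.
move=> Vw e e0; have [UP d0] := PsiU Vw.
set z := Psi w in UP d0 *; set d := 'D_('e_c) h z in d0.
have /diff_frechet fh := Ck_diff (Ch 0%N) UP.
pose C := \sum_i `|gam w i|.
have C0 : 0 <= C by apply: sumr_ge0.
have dotC v : `|dotv (gam w) v| <= C * `|v|.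
  rewrite /dotv /C mulr_suml (le_trans (ler_norm_sum _ _ _)) //.
  apply: ler_sum => i _; rewrite normrM mulrC ler_wpM2l //.
have C2 : 0 < 2 * C + 2 by rewrite ltr_wpDl // mulr_ge0.
(* 1/2 lets the term e1 |D| be absorbed on the left; the second bound makes
   the final error at most e |x|. *)
pose e1 := Order.min 2^-1 (e / (2 * C + 2)).
have e10 : 0 < e1 by rewrite lt_min invr_gt0 ltr0n divr_gt0.
have e2d : 0 < e1 * d by rewrite mulr_gt0.
have [rho [rho0 rhoP]] := near_box (fh (e1 * d) e2d).
have A1 : \forall x \near (0 : 'rV[F]_N), `|G (x + w) - G w| < rho.
  have := G_cts Vw rho0.
  by rewrite [\forall y \near w, _](near_shift 0 w) subr0.
have A2 : \forall x \near (0 : 'rV[F]_N), V (x + w).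
  have := near_open openV Vw.
  by rewrite [\forall y \near w, _](near_shift 0 w) subr0.
have A3 : \forall x \near (0 : 'rV[F]_N), forall i, `|(x : 'rV[F]_N) 0 i| < rho.
  apply: near_forall => i; apply: nearS (near_coord 0 i rho0) => y /=.
  have -> : (0 : 'rV[F]_N) 0 i = 0 by rewrite mxE.
  by rewrite subr0.
apply: (@nearS2 _ _ _ _ _ _ (nearS2 (fun y y1 y2 => conj y1 y2) A1 A2) A3).
move=> x [xG Vx] xr.
set D := G (x + w) - G w in xG *.
pose k : 'rV[F]_N := upd x c D.
have kz : k + z = Psi (x + w).
  apply/rowP => i; rewrite !mxE; case: ifP => // _.
  by rewrite /D subrK.
have kr i : `|k 0 i - (0 : 'rV[F]_N) 0 i| <= rho.
  have -> : (0 : 'rV[F]_N) 0 i = 0 by rewrite mxE.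
  rewrite subr0 mxE; case: ifP => _; first exact: ltW.
  by rewrite ltW.
have := rhoP k kr; rewrite kz.
have [_ ->] := GP Vx; have [_ ->] := GP Vw.
rewrite mxE addrK => key.
have dk : dotv (fun i => 'D_('e_i) h z) k = d * (D - dotv (gam w) x) + x 0 c.
  rewrite /dotv (bigD1 c) //= upd_same [X in D - X](bigD1 c) //= {1}/gam eqxx -/z -/d.
  have -> : \sum_(i < N | i != c) k 0 i * 'D_('e_i) h z =
      - (d * \sum_(i < N | i != c) x 0 i * gam w i).
    rewrite mulr_sumr -sumrN; apply: eq_bigr => i ic.
    rewrite upd_other // /gam (negbTE ic) -/z -/d.
    by field; rewrite gt_eqF.
  by field; rewrite gt_eqF.
rewrite dk opprD addrCA subrr addr0 normrN normrM (gtr0_norm d0) in key.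
have kn : `|k| <= `|x| + `|D|.
  rewrite [leLHS]/Num.Def.normr /= mx_normrE; apply/bigmax_leP; split.
    by rewrite addr_ge0.
  move=> -[i j] _ /=; rewrite ord1 mxE; case: ifP => _.
    by rewrite lerDr.
  by rewrite (le_trans (norm_coord x j)) // lerDl.
have key2 : `|D - dotv (gam w) x| <= e1 * (`|x| + `|D|).
  rewrite -(ler_pM2l d0) (le_trans key) // mulrA (mulrC d) ler_wpM2l //.
  by rewrite ltW.
have e1h : e1 <= 2^-1 by rewrite ge_min lexx.
have e1e : e1 <= e / (2 * C + 2) by rewrite ge_min lexx orbT.
have nD : `|D| <= (2 * C + 1) * `|x|.
  have h1 : `|D| <= `|dotv (gam w) x| + `|D - dotv (gam w) x|.
    by rewrite (le_trans _ (ler_normD _ _)) // addrC subrK.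
  have h2 : e1 * (`|x| + `|D|) <= 2^-1 * (`|x| + `|D|).
    by rewrite ler_wpM2r // addr_ge0.
  have h3 := dotC x.
  have : 0 <= `|x| by [].
  move: (`|D|) (`|x|) h1 h2 h3 key2 => nD nx h1 h2 h3 h4 h5.
  by lra.
rewrite (le_trans key2) //.
have h5 : e1 * (`|x| + `|D|) <= e1 * ((2 * C + 2) * `|x|).
  apply: ler_wpM2l; first exact: ltW.
  by move: nD; set nD := `|D|; set nx := `|x| => ?; lra.
rewrite (le_trans h5) // mulrA ler_wpM2r // -ler_pdivlMr //.
Qed.

Let Psi_row k : Ck V k G -> forall j, Ck V k (fun w => Psi w 0 j).
Proof.
move=> CG j; have [->|jc] := eqVneq j c.
  by apply: Ck_ext CG => // w _; rewrite upd_same.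
apply: (Ck_ext openV) (Ck_coord openV k j) => w _.
by rewrite upd_other.
Qed.

(** The gradient of G is a rational expression in derivatives of h at Psi w, and
Psi is as smooth as G: bootstrap on the order. *)
Let G_Ck k : Ck V k G.
Proof.
elim: k => [|k IH]; split=> //; try by move=> w /G_frechet/frechet_diff[].
have PU w : V w -> (U `&` [set z | 0 < 'D_('e_c) h z]) (Psi w).
  by move=> /PsiU [].
move=> i; apply: (Ck_ext openV (g := fun w => (if i == c then 1 else
    - 'D_('e_i) h (Psi w)) * ('D_('e_c) h (Psi w))^-1)) => [w Vw|].
  by rewrite (frechet_D (G_frechet Vw)) dotv_e.
have CD j : Ck V k (fun w => 'D_('e_j) h (Psi w)).
  apply: (@Ck_comp F N N V U openV Psi k ('D_('e_j) h)).
    by move=> w /PsiU [].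
    exact: Psi_row.
  by have [_ ] := Ch k.+1; apply.
apply: CkM => //; last by apply: CkV => // w /PsiU [_ d0]; rewrite gt_eqF.
by case: (i == c); [exact: Ck_cst|exact: CkN].
Qed.

Lemma exchange_box : local_diffeo (fun z => upd z c (h z)) a.
Proof.
have [Ua da] : U a /\ 0 < 'D_('e_c) h a.
  by apply: box => i; rewrite subrr normr0 ltW.
have sh : smooth_at h a by apply/smooth_atP; exists U.
have Ba : inB a by move=> i _; rewrite subrr normr0.
have la : lo < a 0 c by rewrite ltrBlDr ltrDl.
have ah : a 0 c < hi by rewrite ltrDl.
have Va : V (upd a c (h a)).
  split; first by move=> i ic; rewrite upd_other // subrr normr0.
  rewrite !upd_upd upd_same -{2 3}(upd_id a c).
  by apply/andP; split; apply: h_incr => //; exact: ltW.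
split; first exact: smooth_upd.
exists Psi; split.
- move=> j; apply/smooth_atP; exists V; split=> // k; exact/Psi_row/G_Ck.
- have A1 : \forall z \near a, V (upd z c (h z)).
    apply: (near_comp (P := V) (f := fun z => upd z c (h z))).
      exact: smooth_row_cts (smooth_upd c sh).
    exact: near_open.
  apply: (nearS2 _ A1 (near_coord a c r0)) => z Vz zc.
  rewrite /Psi (G_uniq Vz (t := z 0 c)) ?upd_upd ?upd_same ?upd_id //.
  by rewrite -ler_distl ltW.
- apply: nearS (near_open openV Va) => w Vw; have [_ Gw] := GP Vw.
  by rewrite /Psi Gw upd_upd upd_id.
Qed.

End ScalarImplicit.

Section InverseFunction.
Variables (F : realType) (N : nat).
Implicit Types (h : 'rV[F]_N -> F) (a : 'rV[F]_N) (Phi : 'rV[F]_N -> 'rV[F]_N).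

Lemma exchange_pos h a c : smooth_at h a -> 0 < 'D_('e_c) h a ->
  local_diffeo (fun z => upd z c (h z)) a.
Proof.
move=> sh dpos; have /smooth_atP [U [oU Ua CU]] := sh.
have nd : \forall z \near a, U z /\ 0 < 'D_('e_c) h z.
  have /cts_ltP cd := smooth_cts (smooth_D c sh).
  apply: (nearS2 _ (near_open oU Ua) (cd _ dpos)) => z Uz.
  by rewrite ltr_distlC => /andP[+ _]; rewrite subrr => dz.
have [r [r0 box]] := near_box nd.
exact: (exchange_box CU r0 oU box).
Qed.

(** The derivative of d h is d^2 > 0, whatever the sign of d; dividing the
coordinate by d afterwards restores h. *)
Lemma exchange h a c : smooth_at h a -> 'D_('e_c) h a != 0 ->
  local_diffeo (fun z => upd z c (h z)) a.
Proof.
move=> sh d0; set d := 'D_('e_c) h a in d0.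
have sdh : smooth_at (fun z => d * h z) a by exact: smooth_scale.
have L1 : local_diffeo (fun z => upd z c (d * h z)) a.
  apply: exchange_pos => //.
  rewrite (_ : (fun z => d * h z) = d \*: h) //.
  rewrite deriveZ; last exact/diff_derivable/smooth_diff.
  by rewrite -[_ *: _]/(d * d) -expr2 exprn_even_gt0.
have L2 b : local_diffeo (fun z => upd z c (d^-1 * z 0 c)) b.
  split; first by apply: smooth_upd; apply: smooth_scale; exact: smooth_coord.
  exists (fun z => upd z c (d * z 0 c)); split.
  - by apply: smooth_upd; apply: smooth_scale; exact: smooth_coord.
  - by apply: near_all => z; rewrite upd_same upd_upd mulVKf // upd_id.
  - by apply: near_all => z; rewrite upd_same upd_upd mulKf // upd_id.
apply: local_diffeo_ext (local_diffeo_comp L1 (L2 _)).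
by apply: near_all => z /=; rewrite upd_same upd_upd mulKf.
Qed.

(** The transpose of the usual Jacobian matrix, so that [jac_comp] has the order
of row vectors multiplied from the right. *)
Definition jac Phi a : 'M[F]_N := \matrix_(i, j) 'D_('e_i) (fun z => Phi z 0 j) a.

Lemma jac_comp Phi Phi' a : (forall j, smooth_at (fun z => Phi z 0 j : F) a) ->
  (forall j, smooth_at (fun z => Phi' z 0 j : F) (Phi a)) ->
  jac (Phi' \o Phi) a = jac Phi a *m jac Phi' (Phi a).
Proof.
move=> sP sP'; apply/matrixP => i j; rewrite !mxE.
rewrite (@derive_comp F N N Phi (fun y => Phi' y 0 j)); last 2 first.
- exact: smooth_diff.
- by move=> k; exact: smooth_diff.
by apply: eq_bigr => k _; rewrite !mxE.
Qed.

Lemma jac_ext Phi Phi' a : (\forall z \near a, Phi z = Phi' z) ->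
  jac Phi a = jac Phi' a.
Proof.
move=> PP; apply/matrixP => i j; rewrite !mxE; apply: near_eq_derive.
by apply: nearS PP => z ->.
Qed.

Lemma derive_coord (z v : 'rV[F]_N) (j : 'I_N) : 'D_v (fun y : 'rV[F]_N => y 0 j : F) z = v 0 j.
Proof.
have E : (fun y : 'rV[F]_N => y 0 j : F) = dotv (fun i => (i == j)%:R).
  apply/funext => y; rewrite /dotv (bigD1 j) //= eqxx mulr1 big1 ?addr0 // => i ij.
  by rewrite (negbTE ij) mulr0.
by rewrite E (frechet_D (frechet_dotv _ _)) -E.
Qed.

Definition swap (i c : 'I_N) (z : 'rV[F]_N) : 'rV[F]_N := \row_j z 0 (tperm i c j).

Lemma swap_diffeo i c a : local_diffeo (swap i c) a.
Proof.
have ss b j : smooth_at (fun z => swap i c z 0 j : F) b.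
  apply: smooth_ext (smooth_coord b (tperm i c j)).
  by apply: near_all => z; rewrite mxE.
split=> //; exists (swap i c); split=> //.
- by apply: near_all => z; apply/rowP => j; rewrite !mxE tpermK.
- by apply: near_all => z; apply/rowP => j; rewrite !mxE tpermK.
Qed.

(** Induction on the number of coordinates which [Phi] changes.  As long as
some coordinate i outside S is left, invertibility of the Jacobian gives a
coordinate c outside S on which Phi_i really depends; the exchange of z_c for
Phi_i, followed by the transposition of i and c, is a local diffeomorphism Q,
and Phi o Q^-1 fixes the coordinates in S and also the coordinate i. *)
Lemma inverse_function_aux k Phi a (S : {set 'I_N}) :
  (#|~: S| <= k)%N ->
  (forall i, i \in S -> \forall z \near a, Phi z 0 i = z 0 i) ->
  (forall j, smooth_at (fun z => Phi z 0 j : F) a) ->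
  jac Phi a \in unitmx -> local_diffeo Phi a.
Proof.
elim: k Phi a S => [|k IH] Phi a S Sk PS sP Ju.
  apply: local_diffeo_ext (local_diffeo_id a).
  have : \forall z \near a, forall i, Phi z 0 i = z 0 i.
    apply: near_forall => i; apply: PS.
    by move: Sk; rewrite leqn0 cards_eq0 => /eqP/setP/(_ i); rewrite !inE => /negbFE.
  by apply: nearS => z zi; apply/rowP => i; rewrite zi.
have [E|[i]] := set_0Vmem (~: S); first by apply: (IH _ _ S) => //; rewrite E cards0.
rewrite inE => iS.
have Jdelta r j : j \in S -> jac Phi a r j = (r == j)%:R.
  move=> jS; rewrite mxE (near_eq_derive _ (PS j jS)) derive_coord mxE eqxx /=.
  by rewrite eq_sym.
have [c cS Jc] : exists2 c, c \notin S & jac Phi a c i != 0.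
  suff /existsP [c /andP[cS Jc]] :
    [exists c, (c \notin S) && (jac Phi a c i != 0)] by exists c.
  apply: contraT; rewrite negb_exists => /forallP H.
  (* If Phi_i depended only on coordinates in S, the column i of the Jacobian
   would be a combination of unit columns; x is the resulting kernel vector. *)
pose x : 'cV[F]_N := \col_r ((r == i)%:R - (r \in S)%:R * jac Phi a r i).
  have Jx : jac Phi a *m x = 0.
    apply/colP => r; rewrite [LHS]mxE [RHS]mxE.
    have E s : jac Phi a r s * x s 0 =
        (if s == i then jac Phi a r i else 0) -
        (if s == r then (r \in S)%:R * jac Phi a r i else 0).
      rewrite [x s 0]mxE mulrBr; congr (_ - _).
        by have [->|_] := eqVneq s i; rewrite ?mulr1 ?mulr0.
      have [sS|sS] := boolP (s \in S).
        rewrite Jdelta // eq_sym; have [sr|_] := eqVneq s r; last by rewrite mul0r.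
        by rewrite -sr sS !mul1r.
      rewrite mul0r mulr0; have [sr|//] := eqVneq s r.
      by rewrite -sr (negbTE sS) mul0r.
    rewrite (eq_bigr _ (fun s _ => E s)) sumrB -!big_mkcond /= !big_pred1_eq.
    have [_|rS] := boolP (r \in S); first by rewrite mul1r subrr.
    rewrite mul0r subr0; apply/eqP.
    by have := H r; rewrite rS /= negbK.
  have : x i 0 = 0.
    by rewrite -[x](mulKmx Ju) Jx mulmx0 mxE.
  rewrite mxE eqxx (negbTE iS) mul0r subr0 => /eqP.
  by rewrite oner_eq0.
pose E z := upd z c (Phi z 0 i).
pose Q z := swap i c (E z).
have dE : local_diffeo E a by apply: exchange => //; move: Jc; rewrite mxE.
have dQ : local_diffeo Q a := local_diffeo_comp dE (swap_diffeo i c _).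
have [sQ [Q' [sQ' QK Q'K]]] := dQ.
have Q'a : Q' (Q a) = a by exact: (nbhs_singleton QK).
have Qi z : Q z 0 i = Phi z 0 i by rewrite mxE tpermL upd_same.
have Qj z j : j \in S -> Q z 0 j = z 0 j.
  move=> jS; rewrite mxE tpermD ?upd_other //.
  - by apply: contraNneq cS => <-.
  - by apply: contraNneq iS => ->.
  - by apply: contraNneq cS => ->.
have sPQ j : smooth_at (fun w => (Phi \o Q') w 0 j : F) (Q a).
  by apply: (@smooth_comp F N N Q' (fun y => Phi y 0 j) _ sQ'); rewrite Q'a.
have PQ : \forall z \near a, ((Phi \o Q') \o Q) z = Phi z.
  by apply: nearS QK => z /= ->.
apply: (local_diffeo_ext PQ).
apply: local_diffeo_comp dQ _.
apply: (IH _ _ (i |: S)) => //.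
- have iC : i \in ~: S by rewrite inE.
  have -> : ~: (i |: S) = (~: S) :\ i.
    by apply/setP => j; rewrite !inE negb_or.
  by rewrite -ltnS (leq_trans _ Sk) // [in X in (_ < X)%N](cardsD1 i) iC.
- move=> j; rewrite !inE => /orP[/eqP ->|jS].
    by apply: nearS Q'K => w wK /=; rewrite -Qi wK.
  have nP : \forall w \near Q a, Phi (Q' w) 0 j = Q' w 0 j.
    apply: (near_comp (P := fun y : 'rV[F]_N => Phi y 0 j = y 0 j) (smooth_row_cts sQ')).
    by rewrite Q'a; exact: PS.
  apply: (nearS2 _ nP Q'K) => w -> wK.
  by rewrite -[in RHS]wK Qj.
- have := Ju; rewrite -(jac_ext PQ) jac_comp // unitmx_mul.
  by case/andP.
Qed.

Theorem inverse_function Phi a :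
  (forall j, smooth_at (fun z => Phi z 0 j : F) a) ->
  jac Phi a \in unitmx -> local_diffeo Phi a.
Proof.
move=> sP Ju.
have S0 (i : 'I_N) : i \in (finset.set0 : {set 'I_N}) -> \forall z \near a, Phi z 0 i = z 0 i.
  by rewrite finset.in_set0.
exact: (inverse_function_aux (leqnn _) S0 sP Ju).
Qed.

End InverseFunction.

(** * Smooth functions of finitely many coordinates *)
Section Ptws.
Variable F : realType.
Local Notation Pt I := {ptws I -> F}.

Section Nbhs.
Variable I : eqType.
Implicit Types (p w : Pt I) (C : pred I).

Lemma eval_cts (c : I) p : {for p, continuous (fun w : Pt I => w c)}.
Proof. exact: (@proj_continuous I (fun=> F) c p). Qed.

Lemma near_eval (s : seq I) p (e : F) : 0 < e ->
  \forall w \near p, forall c, c \in s -> `|(w : Pt I) c - p c| < e.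
Proof.
move=> e0; apply: near_seq => c _.
have /cts_ltP/(_ e e0) := @eval_cts c p.
by apply: nearS => w; rewrite distrC.
Qed.

Lemma ptws_cvg (L : set_system (Pt I)) p : Filter L ->
  (forall c, (fun w : Pt I => w c) @ L --> p c) -> L --> p.
Proof.
move=> FL H; apply/cvg_sup => c; apply/cvg_image => //.
  by apply/seteqP; split=> [//|y _]; exists (fun=> y).
move=> A /H LA; exists ((fun w : Pt I => w c) @^-1` A) => //.
rewrite eqEsubset; split => y /=; first by case=> w Aw <-.
by move=> Ay; exists (fun=> y).
Qed.

(** Continuity into a product may be checked coordinatewise, although the
neighbourhoods constrain several coordinates at once. *)
Lemma into_ptws_cts (T : topologicalType) (Y : T -> Pt I) a :
  (forall c, {for a, continuous (fun q => Y q c)}) -> {for a, continuous Y}.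
Proof.
move=> H; rewrite /prop_for /continuous_at.
apply: ptws_cvg => c; exact: H.
Qed.

Definition setc p (c : I) (x : F) : Pt I := fun c' => if c' == c then x else p c'.

Lemma setc_cts p c (x : F) : {for x, continuous (setc p c)}.
Proof.
apply: into_ptws_cts => d; have [dc|dc] := eqVneq d c.
  rewrite (_ : (fun q => _) = id); first exact: cvg_id.
  by apply/funext => q; rewrite /setc dc eqxx.
rewrite (_ : (fun q => _) = (fun=> p d)); first exact: cst_continuous.
by apply/funext => q; rewrite /setc (negbTE dc).
Qed.

Lemma setc_id p c : setc p c (p c) = p.
Proof. by apply/funext => d; rewrite /setc; case: eqP => [->|]. Qed.

Lemma pder_near (H H' : Pt I -> F) w c : (\forall y \near w, H y = H' y) ->
  pder c H w = pder c H' w.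
Proof.
move=> HH; rewrite /pder !derive1E.
have n1 : \forall x \near w c, H (setc w c x) = H' (setc w c x).
  apply: (near_comp (P := fun y => H y = H' y) (@setc_cts w c (w c))).
  by rewrite setc_id.
exact: near_eq_derive n1.
Qed.

(** The truncation to the coordinates listed in [s], through which smooth
functions are handled. *)
Definition res (s : seq I) p : 'rV[F]_(size s) := \row_i p (tnth (in_tuple s) i).

Lemma res_cts s p : {for p, continuous (res s)}.
Proof.
apply/cts_ltP => e e0; apply: nearS (near_eval s p e0) => w H.
rewrite [ltLHS]/Num.Def.normr /= mx_normrE.
apply/bigmax_ltP; split=> // -[i j] _ /=.
by rewrite !mxE distrC H ?mem_tnth.
Qed.

Lemma res_setc s p i x : uniq s ->
  res s (setc p (tnth (in_tuple s) i) x) = upd (res s p) i x.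
Proof.
move=> us; apply/rowP => j; rewrite !mxE /setc.
by rewrite (inj_eq (tuple_uniqP (in_tuple s) us)).
Qed.

Lemma pder_res s (G : 'rV[F]_(size s) -> F) w i : uniq s ->
  pder (tnth (in_tuple s) i) (fun w => G (res s w)) w = 'D_('e_i) G (res s w).
Proof.
move=> us; rewrite /pder -/(setc w (tnth (in_tuple s) i)) /derive1 /derive.
rewrite [X in lim (X @ _)](_ : _ = (fun h : F => h^-1 *: ((G \o
  pseudometric_normed_Zmodule.shift (res s w)) (h *: 'e_i) - G (res s w)))) //.
apply/funext => h /=.
rewrite !res_setc //.
have -> : w (tnth (in_tuple s) i) = res s w 0 i by rewrite mxE.
rewrite upd_id; congr (_ *: (G _ - _)); apply/rowP => j; rewrite !mxE /=.
by have [->|_] := eqVneq j i; rewrite ?mulr1 ?mulr0 ?add0r.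
Qed.

Lemma pder_res0 s (G : 'rV[F]_(size s) -> F) w c : c \notin s ->
  pder c (fun w => G (res s w)) w = 0.
Proof.
move=> cs; rewrite /pder.
rewrite (_ : (fun x => _) = (fun=> G (res s w))) ?derive1_cst //.
apply/funext => x; congr G; apply/rowP => j; rewrite !mxE.
by case: eqP => // E; move: cs; rewrite -E mem_tnth.
Qed.

(** A smooth function of finitely many coordinates together with the list of
the coordinates; for lists without repetition its partial derivatives are those
of [G]. *)
Definition sf_on (s : seq I) (w0 : Pt I) (H : Pt I -> F) (G : 'rV[F]_(size s) -> F) :=
  smooth_at G (res s w0) /\ \forall w \near w0, H w = G (res s w).

(** A representation may be moved to any larger list, so that finitely many
functions can be given a common one. *)
Lemma sf_onP C w0 H (s0 : seq I) : smooth_fun_of C w0 H -> all C s0 ->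
  exists s, [/\ uniq s, all C s, {subset s0 <= s} &
    forall s', uniq s' -> {subset s <= s'} -> exists G, @sf_on s' w0 H G].
Proof.
move=> [N [t [G [Ct sG HG]]]] Cs0.
exists (undup (s0 ++ codom t)); split; first exact: undup_uniq.
- rewrite all_undup all_cat Cs0 /=; apply/allP => c /codomP [i ->]; exact: Ct.
- by move=> c cs; rewrite mem_undup mem_cat cs.
move=> s' us' ss'.
have /choice [f fP] : forall i, exists k, t i = tnth (in_tuple s') k.
  move=> i; apply/tnthP; apply: ss'.
  by rewrite mem_undup mem_cat codom_f orbT.
have E w : \row_i (w : Pt I) (t i) = \row_i res s' w 0 (f i).
  by apply/rowP => i; rewrite !mxE fP.
exists (fun z => G (\row_i z 0 (f i))); split.
  apply: (@smooth_comp F _ _ (fun z => \row_i z 0 (f i)) G).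
    move=> j; apply: smooth_ext (smooth_coord (res s' w0) (f j)).
    by apply: near_all => z; rewrite mxE.
  by rewrite -E.
by apply: nearS HG => w ->; rewrite E.
Qed.

Lemma sf_norm C w0 H : smooth_fun_of C w0 H ->
  exists s G, [/\ uniq s, all C s & @sf_on s w0 H G].
Proof.
move=> sH; have [//|s [us Cs _ /(_ s us (fun _ c => c)) [G GP]]] := sf_onP sH (s0 := [::]).
by exists s, G.
Qed.

Lemma sf_on_sf C w0 H s G : all C s -> @sf_on s w0 H G -> smooth_fun_of C w0 H.
Proof.
move=> /allP Cs [sG HG]; exists (size s), (tnth (in_tuple s)), G; split=> //.
by move=> i; apply: Cs; exact: mem_tnth.
Qed.

Lemma sf_on_cts w0 H s G : @sf_on s w0 H G -> {for w0, continuous H}.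
Proof.
move=> [sG HG]; apply/cts_ltP => e e0.
have /cts_ltP/(_ e e0) cG := smooth_cts sG.
have n1 := near_comp (P := fun z => `|G (res s w0) - G z| < e) (@res_cts s w0) cG.
apply: (nearS2 _ HG n1) => w ->.
by rewrite (nbhs_singleton HG).
Qed.

Lemma sf_on_near w0 H s G : @sf_on s w0 H G -> \forall w \near w0, @sf_on s w H G.
Proof.
move=> [sG HG].
have n1 := near_comp (P := fun z => smooth_at G z) (@res_cts s w0) (smooth_near sG).
exact: (nearS2 (fun w H1 H2 => conj H2 H1) (near_near HG) n1).
Qed.

Lemma sf_on_pder w0 H s G i : uniq s -> @sf_on s w0 H G ->
  pder (tnth (in_tuple s) i) H w0 = 'D_('e_i) G (res s w0).
Proof. by move=> us [sG HG]; rewrite (pder_near _ HG) pder_res. Qed.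

Lemma sf_on_pder0 w0 H s G c : c \notin s -> @sf_on s w0 H G -> pder c H w0 = 0.
Proof. by move=> us [sG HG]; rewrite (pder_near _ HG) pder_res0. Qed.

Lemma sf_cts C w0 H : smooth_fun_of C w0 H -> {for w0, continuous H}.
Proof.
by move=> /sf_norm [s [G [us Cs /sf_on_cts]]].
Qed.

Lemma sf_near C w0 H : smooth_fun_of C w0 H -> \forall w \near w0, smooth_fun_of C w H.
Proof.
move=> /sf_norm [s [G [us Cs]]].
by move=> /sf_on_near; apply: nearS => w /(sf_on_sf Cs).
Qed.

Lemma sf_ext C w0 H H' : (\forall w \near w0, H w = H' w) ->
  smooth_fun_of C w0 H -> smooth_fun_of C w0 H'.
Proof.
move=> HH [N [t [G [Ct sG HG]]]]; exists N, t, G; split=> //.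
by apply: (nearS2 _ HH HG) => w ->.
Qed.

Lemma sf_sub C (C' : pred I) w0 H : (forall c, C c -> C' c) ->
  smooth_fun_of C w0 H -> smooth_fun_of C' w0 H.
Proof.
by move=> CC [N [t [G [Ct sG HG]]]]; exists N, t, G; split=> // i; exact: CC.
Qed.

Lemma sf_coord (C : pred I) w0 c : C c -> smooth_fun_of C w0 (fun w : Pt I => w c).
Proof.
move=> Cc; exists 1%N, (fun=> c), (fun z => z 0 0); split=> //.
  exact: smooth_coord.
by apply: near_all => w; rewrite mxE.
Qed.

Lemma sf_cst C w0 (x : F) : smooth_fun_of C w0 (fun=> x).
Proof.
exists 0%N, (fun i : 'I_0 => match i with Ordinal _ Hi => False_rect I (notF Hi) end), (fun=> x).
by split=> [[]||] //; [exact: smooth_cst|exact: near_all].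
Qed.

Lemma sf_pder C w0 H c : smooth_fun_of C w0 H -> smooth_fun_of C w0 (pder c H).
Proof.
move=> /sf_norm [s [G [us Cs GP]]]; have [sG _] := GP; have nG := sf_on_near GP.
have [/(@tnthP _ _ (in_tuple s)) [i ->]|cs] := boolP (c \in s).
  apply: (sf_on_sf Cs (G := 'D_('e_i) G)); split; first exact: smooth_D.
  by apply: nearS nG => w /(sf_on_pder i us).
apply: sf_ext (sf_cst C w0 0).
by apply: nearS nG => w /(sf_on_pder0 cs).
Qed.

End Nbhs.
End Ptws.

Section SmoothFun.
Variable F : realType.
Local Notation Pt I := {ptws I -> F}.

Section One.
Variable I : eqType.
Implicit Types (p w : Pt I) (C : pred I) (H : Pt I -> F).

Lemma sf_family (K : finType) C w0 (H : K -> Pt I -> F) (s0 : seq I) :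
  (forall k, smooth_fun_of C w0 (H k)) -> all C s0 ->
  exists s, [/\ uniq s, all C s, {subset s0 <= s} &
    exists G, forall k, @sf_on F I s w0 (H k) (G k)].
Proof.
move=> sH Cs0.
have /choice [f fP] := fun k => sf_onP (sH k) Cs0.
pose s := undup (s0 ++ flatten [seq f k | k <- enum K]).
have us : uniq s by exact: undup_uniq.
have sk k : {subset f k <= s}.
  move=> c ck; rewrite mem_undup mem_cat; apply/orP; right.
  by apply/flattenP; exists (f k) => //; apply: map_f; rewrite mem_enum.
exists s; split=> //.
- rewrite all_undup all_cat Cs0 /=; apply/allP => c /flattenP [t /mapP[k _ ->]].
  by have [_ /allP Cf _ _] := fP k; exact: Cf.
- by move=> c cs; rewrite mem_undup mem_cat cs.
have /choice [G GP] : forall k, exists G, @sf_on F I s w0 (H k) G.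
  by move=> k; have [_ _ _] := fP k; apply.
by exists G.
Qed.

Lemma pder_cst c (x : F) w : pder c (fun=> x) w = 0.
Proof. by rewrite /pder derive1_cst. Qed.

Lemma pder_coord c d w : pder c (fun w => w d) w = (c == d)%:R.
Proof.
have [->|cd] := eqVneq c d.
  rewrite /pder (_ : (fun s => _) = id); last by apply/funext => s; rewrite eqxx.
  by rewrite derive1_id.
rewrite /pder (_ : (fun s => _) = (fun=> w d)); first exact: derive1_cst.
by apply/funext => s; rewrite eq_sym (negbTE cd).
Qed.

Lemma sf_family2 C w0 H H' : smooth_fun_of C w0 H -> smooth_fun_of C w0 H' ->
  exists s, [/\ uniq s, all C s &
    exists G G', @sf_on F I s w0 H G /\ @sf_on F I s w0 H' G'].
Proof.
move=> sH sH'.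
have sHb (b : bool) : smooth_fun_of C w0 (if b then H else H') by case: b.
have [//|s [us Cs _ [G GP]]] := sf_family sHb (s0 := [::]).
by exists s; split=> //; exists (G true), (G false); split; [exact: (GP true)|exact: (GP false)].
Qed.

Lemma sfD C w0 H H' : smooth_fun_of C w0 H -> smooth_fun_of C w0 H' ->
  smooth_fun_of C w0 (fun w => H w + H' w).
Proof.
move=> sH sH'; have [s [us Cs [G [G' [[sG GP] [sG' GP']]]]]] := sf_family2 sH sH'.
apply: (sf_on_sf Cs (G := fun z => G z + G' z)); split.
  have := @smooth_sum F _ bool [:: true; false] (fun b => if b then G else G') (res s w0).
  move=> /(_ _) E; apply: smooth_ext (E _); last by case.
  by apply: near_all => z; rewrite !big_cons big_nil addr0.
by apply: (nearS2 _ GP GP') => w -> ->.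
Qed.

Lemma sfZ C w0 H (a : F) : smooth_fun_of C w0 H ->
  smooth_fun_of C w0 (fun w => a * H w).
Proof.
move=> /sf_norm [s [G [us Cs [sG GP]]]].
apply: (sf_on_sf Cs (G := fun z => a * G z)); split; first exact: smooth_scale.
by apply: nearS GP => w ->.
Qed.

Lemma pderD C w0 H H' c : smooth_fun_of C w0 H -> smooth_fun_of C w0 H' ->
  pder c (fun w => H w + H' w) w0 = pder c H w0 + pder c H' w0.
Proof.
move=> sH sH'; have [s [us Cs [G [G' [GP GP']]]]] := sf_family2 sH sH'.
have n1 : \forall w \near w0, H w + H' w = G (res s w) + G' (res s w).
  by apply: (nearS2 _ (proj2 GP) (proj2 GP')) => w -> ->.
rewrite (pder_near _ n1).
have [/(@tnthP _ _ (in_tuple s)) [i ->]|cs] := boolP (c \in s).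
  rewrite (pder_res (fun z => G z + G' z)) // (sf_on_pder _ us GP) (sf_on_pder _ us GP').
  by rewrite deriveD //; apply/diff_derivable/smooth_diff; [case: GP|case: GP'].
by rewrite (pder_res0 (fun z => G z + G' z)) // (sf_on_pder0 cs GP) (sf_on_pder0 cs GP') addr0.
Qed.

Lemma pderZ C w0 H c (a : F) : smooth_fun_of C w0 H ->
  pder c (fun w => a * H w) w0 = a * pder c H w0.
Proof.
move=> /sf_norm [s [G [us Cs GP]]].
have n1 : \forall w \near w0, a * H w = a * G (res s w).
  by apply: nearS (proj2 GP) => w ->.
rewrite (pder_near _ n1).
have [/(@tnthP _ _ (in_tuple s)) [i ->]|cs] := boolP (c \in s).
  rewrite (pder_res (fun z => a * G z)) // (sf_on_pder _ us GP).
  rewrite (_ : (fun z => a * G z) = a \*: G) // deriveZ //.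
  by apply/diff_derivable/smooth_diff; case: GP.
by rewrite (pder_res0 (fun z => a * G z)) // (sf_on_pder0 cs GP) mulr0.
Qed.

Lemma sf_sum (K : Type) (r : seq K) C w0 (H : K -> Pt I -> F) (a : K -> F) :
  (forall k, smooth_fun_of C w0 (H k)) ->
  smooth_fun_of C w0 (fun w => \sum_(k <- r) a k * H k w).
Proof.
move=> sH; elim: r => [|k r IH].
  by apply: sf_ext (sf_cst C w0 0); apply: near_all => w; rewrite big_nil.
apply: sf_ext (sfD (sfZ (a k) (sH k)) IH).
by apply: near_all => w; rewrite big_cons.
Qed.

Lemma pder_sum (K : Type) (r : seq K) C w0 (H : K -> Pt I -> F) (a : K -> F) c :
  (forall k, smooth_fun_of C w0 (H k)) ->
  pder c (fun w => \sum_(k <- r) a k * H k w) w0 = \sum_(k <- r) a k * pder c (H k) w0.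
Proof.
move=> sH; elim: r => [|k r IH].
  rewrite big_nil -[RHS](pder_cst c 0 w0); apply: pder_near.
  by apply: near_all => w; rewrite big_nil.
rewrite big_cons -IH -(pderZ _ _ (sH k)).
rewrite -(pderD c (sfZ (a k) (sH k)) (sf_sum r a sH)); apply: pder_near.
by apply: near_all => w; rewrite big_cons.
Qed.

(** A function does not depend on a coordinate along which its derivative
vanishes near the point: on a box, the mean value theorem compares it with its
values where the coordinates outside [C'] are frozen at [w0]. *)
Lemma sf_drop C (C' : pred I) w0 H : smooth_fun_of C w0 H ->
  (forall c, C c -> ~~ C' c -> \forall w \near w0, pder c H w = 0) ->
  smooth_fun_of C' w0 H.
Proof.
move=> /sf_norm [s [G [us Cs GP]]] H0; have [sG HG] := GP.
have [a aE] : exists a, a = res s w0 by exists (res s w0).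
rewrite -aE in sG.
(* A section of the truncation: coordinates outside s are those of w0. *)
pose emb (z : 'rV[F]_(size s)) : Pt I := fun c =>
  if [pick i | tnth (in_tuple s) i == c] is Some i then z 0 i else w0 c.
have inj : injective (tnth (in_tuple s)) by exact/tuple_uniqP.
have embK z : res s (emb z) = z.
  apply/rowP => i; rewrite mxE /emb; case: pickP => [j /eqP/inj ->//|/(_ i)].
  by rewrite eqxx.
have emba : emb a = w0.
  by apply/funext => c; rewrite /emb; case: pickP => // i /eqP <-; rewrite aE mxE.
have embc : {for a, continuous emb}.
  apply: into_ptws_cts => c; rewrite /emb; case: pickP => [i _|_].
    exact: coord_continuous.
  exact: cst_continuous.
pose keep i := C' (tnth (in_tuple s) i).
have D0 : \forall z \near a, forall i, ~~ keep i -> 'D_('e_i) G z = 0.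
  apply: near_forall => i; have [ki|ki] := boolP (keep i); first by apply: near_all.
  have Hi := H0 _ (allP Cs _ (mem_tnth i (in_tuple s))) ki.
  have Hi2 : \forall w \near w0, 'D_('e_i) G (res s w) = 0.
    by apply: (nearS2 _ (sf_on_near GP) Hi) => w w1; rewrite (sf_on_pder i us w1).
  have : \forall z \near a, 'D_('e_i) G (res s (emb z)) = 0.
    by apply: (near_comp (P := fun w => 'D_('e_i) G (res s w) = 0) embc); rewrite emba.
  by apply: nearS => z + _; rewrite embK.
have dG : \forall z \near a, differentiable G z.
  by apply: nearS (smooth_near sG) => z /smooth_diff.
have [r [r0 box]] := near_box (nearS2 (fun z z1 z2 => conj z1 z2) D0 dG).
pose fr (z : 'rV[F]_(size s)) : 'rV[F]_(size s) :=
  \row_i (if keep i then z 0 i else a 0 i).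
have Gfr (z : 'rV[F]_(size s)) : (forall i, `|z 0 i - a 0 i| <= r) -> G z = G (fr z).
  move=> zr; have bx x i : 0 <= x <= 1 -> `|(fr z + x *: (z - fr z)) 0 i - a 0 i| <= r.
    move=> /andP[x0 x1]; rewrite !mxE; case: ifP => _.
      by rewrite subrr mulr0 addr0; exact: zr.
    rewrite addrAC subrr add0r normrM ger0_norm //.
    by rewrite (le_trans _ (zr i)) // ler_piMl.
  have [|x xI] := @MVT_line F _ G (fr z) (z - fr z) 0 1 ltr01.
    by move=> x xI; have [] := box _ (fun i => bx x i xI).
  have xI' : 0 <= x <= 1 by case/andP: xI => /ltW -> /ltW ->.
  have [D0x dGx] := box _ (fun i => bx x i xI').
  rewrite scale1r scale0r addr0 (addrC (fr z) (z - _)) subrK subr0 mulr1 => GE.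
  apply/eqP; rewrite -subr_eq0 GE; apply/eqP.
  rewrite (diff_D _ dGx) /dotv big1 // => i _.
  have [ki|ki] := boolP (keep i); last by rewrite D0x // mulr0.
  by rewrite !mxE ki subrr mul0r.
exists #|keep|, (fun i => tnth (in_tuple s) (enum_val i)).
pose frk (y : 'rV[F]_#|keep|) : 'rV[F]_(size s) :=
  \row_i (if [pick k : 'I_#|keep| | enum_val k == i] is Some k then y 0 k else a 0 i).
have frkE w : frk (\row_i w (tnth (in_tuple s) (enum_val i))) = fr (res s w).
  apply/rowP => i; rewrite !mxE; case: pickP => [k /eqP <-|ki].
    by have kk : keep (enum_val k) := enum_valP k; rewrite kk !mxE.
  case: ifP => // kpi; have ik : i \in keep by [].
  by have := ki (enum_rank_in ik i); rewrite enum_rankK_in ?eqxx.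
have fra : fr a = a by apply/rowP => i; rewrite mxE; case: ifP.
exists (fun y => G (frk y)); split.
- by move=> i; have := enum_valP i.
- apply: (@smooth_comp F _ _ frk G); last by rewrite frkE -aE fra.
  move=> i; case E : [pick k : 'I_#|keep| | enum_val k == i] => [k|].
    apply: smooth_ext (smooth_coord _ k).
    by apply: near_all => y; rewrite mxE E.
  apply: smooth_ext (smooth_cst (a 0 i) _).
  by apply: near_all => y; rewrite mxE E.
- apply: (nearS2 _ HG (near_eval s w0 r0)) => w -> wr.
  rewrite frkE; apply: Gfr => i; rewrite aE !mxE ltW // wr //; exact: mem_tnth.
Qed.

End One.

Section Two.
Variables I J : eqType.
Variables (Y : Pt J -> Pt I).
Implicit Types (C : pred I) (B : pred J) (p : Pt J).

Lemma sf_comp C B p0 (H : Pt I -> F) : smooth_fun_of C (Y p0) H ->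
  (forall c, {for p0, continuous (fun p => Y p c)}) ->
  (forall c, C c -> smooth_fun_of B p0 (fun p => Y p c)) ->
  smooth_fun_of B p0 (fun p => H (Y p)).
Proof.
move=> /sf_norm [s [G [us Cs [sG HG]]]] cY sY.
have cY' : {for p0, continuous Y} by exact: into_ptws_cts.
have sYi (i : 'I_(size s)) : smooth_fun_of B p0 (fun p => Y p (tnth (in_tuple s) i)).
  by apply: sY; apply: (allP Cs); exact: mem_tnth.
have [//|s' [us' Bs' _ [G' GP']]] := sf_family sYi (s0 := [::]).
pose Phi (z : 'rV[F]_(size s')) : 'rV[F]_(size s) := \row_i G' i z.
have PhiE : \forall p \near p0, res s (Y p) = Phi (res s' p).
  have : \forall p \near p0, forall i, Y p (tnth (in_tuple s) i) = G' i (res s' p).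
    by apply: near_forall => i; have [] := GP' i.
  by apply: nearS => p E; apply/rowP => i; rewrite !mxE E.
apply: (sf_on_sf Bs' (G := fun z => G (Phi z))); split.
  apply: (@smooth_comp F _ _ Phi G); last by rewrite -(nbhs_singleton PhiE).
  move=> i; have [sGi _] := GP' i; apply: smooth_ext sGi.
  by apply: near_all => z; rewrite mxE.
apply: (nearS2 _ PhiE (near_comp (P := fun w => H w = G (res s w)) cY' HG)) => p.
by move=> <-.
Qed.

(** The chain rule.  The point is arbitrary, so that relations between
differentials can be read off near p0 and not only at p0. *)
Lemma chain_at s G (K : Pt J -> F) p : smooth_at G (res s (Y p)) ->
  (\forall q \near p, K q = G (res s (Y q))) ->
  (forall c, c \in s -> smooth_fun_of predT p (fun q => Y q c)) ->
  forall d, pder d K p =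
    \sum_i 'D_('e_i) G (res s (Y p)) * pder d (fun q => Y q (tnth (in_tuple s) i)) p.
Proof.
move=> sG KG sY d.
have sYi (i : 'I_(size s)) : smooth_fun_of predT p (fun q => Y q (tnth (in_tuple s) i)).
  by apply: sY; exact: mem_tnth.
have [//|s' [us' Bs' _ [G' GP']]] := sf_family sYi (s0 := [::]).
pose Phi (z : 'rV[F]_(size s')) : 'rV[F]_(size s) := \row_i G' i z.
have PhiE : \forall q \near p, res s (Y q) = Phi (res s' q).
  have : \forall q \near p, forall i, Y q (tnth (in_tuple s) i) = G' i (res s' q).
    by apply: near_forall => i; have [] := GP' i.
  by apply: nearS => q E; apply/rowP => i; rewrite !mxE E.
have n1 : \forall q \near p, K q = G (Phi (res s' q)).
  by apply: (nearS2 _ KG PhiE) => q -> ->.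
rewrite (pder_near _ n1).
have [/(@tnthP _ _ (in_tuple s')) [i ->]|ds] := boolP (d \in s'); last first.
  rewrite (pder_res0 (fun z => G (Phi z))) // big1 // => i _.
  by rewrite (sf_on_pder0 ds (GP' i)) mulr0.
rewrite (pder_res (fun z => G (Phi z))) // derive_comp; last 2 first.
- by rewrite -(nbhs_singleton PhiE); exact: smooth_diff.
- move=> j; have [sGj _] := GP' j; apply: near_eq_differentiable (smooth_diff sGj).
  by apply: near_all => z; rewrite mxE.
apply: eq_bigr => j _; rewrite mulrC (nbhs_singleton PhiE); congr (_ * _).
rewrite (sf_on_pder i us' (GP' j)); congr (derive _ _ _).
by apply/funext => z; rewrite mxE.
Qed.

(** The list [s] is the same for all points near p0, and it is complete:
the derivatives of [H] along the other coordinates vanish. *)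
Lemma chain_near2 C p0 (H : Pt I -> F) : smooth_fun_of C (Y p0) H ->
  (forall c, {for p0, continuous (fun p => Y p c)}) ->
  (forall c, C c -> smooth_fun_of predT p0 (fun p => Y p c)) ->
  exists s, [/\ uniq s, all C s &
    \forall p \near p0, (forall d, pder d (fun q => H (Y q)) p =
      \sum_(c <- s) pder c H (Y p) * pder d (fun q => Y q c) p) /\
      (forall c, c \notin s -> pder c H (Y p) = 0)].
Proof.
move=> /sf_norm [s [G [us Cs GP]]] cY sY; have [_ HG] := GP.
have cY' : {for p0, continuous Y} by exact: into_ptws_cts.
exists s; split=> //.
have n1 := near_comp (P := fun w => sf_on w H G) cY' (sf_on_near GP).
have n2 := near_near (near_comp (P := fun w => H w = G (res s w)) cY' HG).
have n3 : \forall p \near p0, forall c, c \in s -> smooth_fun_of predT p (fun q => Y q c).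
  by apply: near_seq => c cs; apply: sf_near; apply: sY; exact: (allP Cs).
apply: (nearS2 _ (near_and n1 n2) n3) => p [p1 p2] p3.
split=> [d|c cs]; last exact: sf_on_pder0 cs p1.
have [p1a _] := p1; rewrite (chain_at p1a p2 p3) [in RHS]big_tnth.
by apply: eq_bigr => i _; rewrite (sf_on_pder _ us p1).
Qed.

Lemma chain_near C p0 (H : Pt I -> F) : smooth_fun_of C (Y p0) H ->
  (forall c, {for p0, continuous (fun p => Y p c)}) ->
  (forall c, C c -> smooth_fun_of predT p0 (fun p => Y p c)) ->
  exists s, [/\ uniq s, all C s &
    \forall p \near p0, forall d, pder d (fun q => H (Y q)) p =
      \sum_(c <- s) pder c H (Y p) * pder d (fun q => Y q c) p].
Proof.
move=> sH cY sY; have [s [us Cs ch]] := chain_near2 sH cY sY.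
by exists s; split=> //; apply: nearS ch => p [].
Qed.

End Two.
End SmoothFun.

(** * Implicit functions on a product of lines *)
Lemma unitmx_ker0 (F : fieldType) n (A : 'M[F]_n) :
  (forall x : 'cV[F]_n, A *m x = 0 -> x = 0) -> A \in unitmx.
Proof.
move=> A0; rewrite -unitmx_tr -row_free_unit -kermx_eq0.
apply/rowV0P => v /sub_kermxP vA.
apply: trmx_inj; rewrite trmx0; apply: A0.
by rewrite -[A]trmxK -trmx_mul vA trmx0.
Qed.

(** The equations H_i = w(d_i), with d_i new coordinates outside C, are solved
for the old coordinates c_i.  [exch_up] computes the new coordinates from the
old ones and [exch_down] goes back, with [T] as the solution. *)
Section ImplicitExchange.
Variables (F : realType) (I : eqType) (C : pred I).
Local Notation Pt I := {ptws I -> F}.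
Variables (w0 w1 : Pt I) (k : nat) (c d : 'I_k -> I) (H : 'I_k -> Pt I -> F).

Definition exch_vars : pred I :=
  fun e => (C e && (e \notin codom c)) || (e \in codom d).

Definition exch_up (w : Pt I) : Pt I :=
  fun e => if [pick j | d j == e] is Some j then H j w else w e.

Definition exch_down (T : 'I_k -> Pt I -> F) (w : Pt I) : Pt I :=
  fun e => if [pick j | c j == e] is Some j then T j w
           else if C e then w e else w0 e.

Hypotheses (ci : injective c) (di : injective d).
Hypotheses (Cc : forall i, C (c i)) (Cd : forall i, ~~ C (d i)).
Hypothesis sH : forall i, smooth_fun_of C w0 (H i).
Hypothesis Hrank : (\matrix_(i, j) pder (c j) (H i) w0 : 'M[F]_k) \in unitmx.
Hypothesis w1C : forall e, C e -> e \notin codom c -> w1 e = w0 e.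
Hypothesis w1d : forall i, w1 (d i) = H i w0.

(** All the H_i depend on one finite list of coordinates.  On it, the map Phi
which puts H_j in place of c_j has an invertible Jacobian, and the components of
its local inverse at the positions c_j are the solutions T_j.  Beside
smoothness, the solutions depend exactly, and not only near w1, on nothing but
the listed variables; this allows equalities between them without shrinking
neighbourhoods. *)
Lemma implicit_exchange : exists T : 'I_k -> Pt I -> F,
  [/\ forall i, smooth_fun_of exch_vars w1 (T i),
      forall i w w', (forall e, exch_vars e -> w e = w' e) -> T i w = T i w',
      \forall w \near w0, forall i, T i (exch_up w) = w (c i),
      exch_down T w1 = w0 &
      \forall w \near w1, forall i, H i (exch_down T w) = w (d i)].
Proof.
have Ccs : all C (codom c) by apply/allP => e /codomP [i ->].
have [s [us Cs cs [G GP]]] := sf_family sH Ccs.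
have sinj : injective (tnth (in_tuple s)) by exact/tuple_uniqP.
have [pos posP] : exists pos, forall j, tnth (in_tuple s) (pos j) = c j.
  have /choice [f fP] : forall j, exists e, tnth (in_tuple s) e = c j.
    move=> j; have /(@tnthP _ _ (in_tuple s)) [e ->] := cs _ (codom_f c j).
    by exists e.
  by exists f.
pose pk (e : 'I_(size s)) := [pick j | c j == tnth (in_tuple s) e].
have pkpos j : pk (pos j) = Some j.
  rewrite /pk posP; case: pickP => [l /eqP/ci -> //|/(_ j)].
  by rewrite eqxx.
have pkS e j : pk e = Some j -> e = pos j.
  by rewrite /pk; case: pickP => // l /eqP E [<-]; apply: sinj; rewrite posP.
have pkN e : pk e = None -> tnth (in_tuple s) e \notin codom c.
  rewrite /pk; case: pickP => // H0 _; apply/negP => /codomP [j E].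
  by have := H0 j; rewrite E eqxx.
pose Phi (z : 'rV[F]_(size s)) : 'rV[F]_(size s) :=
  \row_e (if pk e is Some j then G j z else z 0 e).
have [a aE] : exists a, a = res s w0 by exists (res s w0).
have sPhi e : smooth_at (fun z => Phi z 0 e : F) a.
  case E : (pk e) => [j|].
    have [sG _] := GP j; rewrite -aE in sG; apply: smooth_ext sG.
    by apply: near_all => z; rewrite mxE E.
  by apply: smooth_ext (smooth_coord a e); apply: near_all => z; rewrite mxE E.
have DPhi i e : jac Phi a i e =
    if pk e is Some j then 'D_('e_i) (G j) a else (i == e)%:R.
  rewrite mxE; case E : (pk e) => [j|].
    by congr (derive _ _ _); apply/funext => z; rewrite mxE E.
  rewrite (near_eq_derive (g := fun z : 'rV[F]_(size s) => z 0 e)).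
    by rewrite derive_coord mxE eqxx eq_sym.
  by apply: near_all => z; rewrite mxE E.
have ju : jac Phi a \in unitmx.
  apply: unitmx_ker0 => x Jx.
  have key i : (if pk i is None then x i 0 else 0) +
      \sum_j 'D_('e_i) (G j) a * x (pos j) 0 = 0.
    have := congr1 (fun z : 'cV[F]__ => z i 0) Jx.
    rewrite [LHS]mxE [X in _ = X -> _]mxE => E; rewrite -[RHS]E.
    have fe e : jac Phi a i e * x e 0 =
        (if pk e is None then (i == e)%:R * x e 0 else 0) +
        \sum_j (if e == pos j then 'D_('e_i) (G j) a * x (pos j) 0 else 0).
      rewrite DPhi; case E' : (pk e) => [j|].
        rewrite add0r (bigD1 j) //= (pkS _ _ E') eqxx big1 ?addr0 // => l lj.
        case: eqP => // /(congr1 pk); rewrite !pkpos => -[jl].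
        by rewrite jl eqxx in lj.
      rewrite big1 ?addr0 // => l _; case: eqP => // el.
      by move: E'; rewrite el pkpos.
    rewrite (eq_bigr _ (fun e _ => fe e)) big_split /=; congr (_ + _).
      rewrite (bigD1 i) //= eqxx mul1r big1 ?addr0 // => e ei.
      by case: (pk e) => //; rewrite eq_sym (negbTE ei) mul0r.
    by rewrite [RHS]exchange_big /=; apply: eq_bigr => j _; rewrite -big_mkcond big_pred1_eq.
  have xpos j : x (pos j) 0 = 0.
    pose y : 'cV[F]_k := \col_j x (pos j) 0.
    pose M : 'M[F]_k := \matrix_(i, j) pder (c j) (H i) w0.
    have yM : M^T *m y = 0.
      apply/colP => l; rewrite [RHS]mxE [LHS]mxE.
      have := key (pos l); rewrite pkpos add0r => E; rewrite -[RHS]E; apply: eq_bigr => i _.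
      by rewrite !mxE -(posP l) (sf_on_pder _ us (GP i)) aE.
    have Mu : M^T \in unitmx by rewrite unitmx_tr.
    have y0 : y = 0 by rewrite -[y](mulKmx Mu) yM mulmx0.
    by have := congr1 (fun z : 'cV[F]__ => z j 0) y0; rewrite !mxE.
  apply/colP => i; rewrite [RHS]mxE.
  case E : (pk i) => [j|]; first by rewrite (pkS _ _ E).
  have := key i; rewrite E big1 ?addr0 // => j _.
  by rewrite xpos mulr0.
have [_ [Psi [sPsi PK PK']]] := inverse_function sPhi ju.
pose t (e : 'I_(size s)) : I := if pk e is Some j then d j else tnth (in_tuple s) e.
have tv e : exch_vars (t e).
  rewrite /t /exch_vars; case E : (pk e) => [j|]; first by rewrite codom_f orbT.
  by rewrite pkN // (allP Cs) // mem_tnth.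
pose rr (w : Pt I) : 'rV[F]_(size s) := \row_e w (t e).
pose T (i : 'I_k) w := Psi (rr w) 0 (pos i).
have rrw1 : rr w1 = Phi a.
  apply/rowP => e; rewrite !mxE /t; case E : (pk e) => [j|].
    by rewrite w1d aE; have [_ /nbhs_singleton] := GP j.
  by rewrite aE mxE w1C ?pkN // (allP Cs) // mem_tnth.
have Pa : Psi (Phi a) = a := nbhs_singleton PK.
have crr : {for w1, continuous rr}.
  apply/cts_ltP => e e0; apply: nearS (near_eval (codom t) w1 e0) => w Hw.
  rewrite [ltLHS]/Num.Def.normr /= mx_normrE.
  apply/bigmax_ltP; split=> // -[i j] _ /=.
  by rewrite !mxE distrC Hw ?codom_f.
have sT i : smooth_fun_of exch_vars w1 (T i).
  exists (size s), t, (fun z => Psi z 0 (pos i)); split=> //.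
    by have := sPsi (pos i); rewrite -rrw1.
  exact: near_all.
have Tw1 i : T i w1 = w0 (c i) by rewrite /T rrw1 Pa aE mxE posP.
have down1 : exch_down T w1 = w0.
  apply/funext => e; rewrite /exch_down; case: pickP => [j /eqP <-|pe].
    exact: Tw1.
  case: ifP => // Ce; apply: w1C => //; apply/negP => /codomP [j E].
  by have := pe j; rewrite E eqxx.
have cdown : {for w1, continuous (exch_down T)}.
  apply: into_ptws_cts => e; rewrite /exch_down; case: pickP => [j _|_].
    exact: sf_cts (sT j).
  by case: (C e); [exact: eval_cts|exact: cst_continuous].
exists T; split=> //.
- move=> i w w' ww; rewrite /T; congr (Psi _ 0 _).
  by apply/rowP => e; rewrite !mxE; apply: ww.
- have nG : \forall w \near w0, forall i, H i w = G i (res s w).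
    by apply: near_forall => i; have [] := GP i.
  have nPK : \forall w \near w0, Psi (Phi (res s w)) = res s w.
    apply: (near_comp (P := fun z => Psi (Phi z) = z) (@res_cts F I s w0)).
    by rewrite -aE.
  apply: (nearS2 _ nG nPK) => w HG PsiK i.
  have -> : T i (exch_up w) = Psi (Phi (res s w)) 0 (pos i).
    rewrite /T; congr (Psi _ 0 _); apply/rowP => e; rewrite !mxE /t /exch_up.
    case E : (pk e) => [j|].
      case: pickP => [l /eqP/di ->//|/(_ j)]; by rewrite eqxx.
    case: pickP => [l /eqP dl|_]; last by [].
    by have := Cd l; rewrite dl (allP Cs) // mem_tnth.
  by rewrite PsiK mxE posP.
- have nG : \forall w \near w1, forall i, H i (exch_down T w) = G i (res s (exch_down T w)).
    apply: near_forall => i.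
    apply: (near_comp (P := fun w => H i w = G i (res s w)) cdown).
    by rewrite down1; have [] := GP i.
  have nPK : \forall w \near w1, Phi (Psi (rr w)) = rr w.
    by apply: (near_comp (P := fun z => Phi (Psi z) = z) crr); rewrite rrw1.
  apply: (nearS2 _ nG nPK) => w HG PhiK i; rewrite HG.
  have -> : res s (exch_down T w) = Psi (rr w).
    apply/rowP => e; rewrite mxE /exch_down -/(pk e).
    case E : (pk e) => [j|]; first by rewrite /T (pkS _ _ E).
    rewrite (allP Cs) ?mem_tnth //.
    have := congr1 (fun z : 'rV[F]__ => z 0 e) PhiK.
    by rewrite !mxE /t E.
  have := congr1 (fun z : 'rV[F]__ => z 0 (pos i)) PhiK.
  by rewrite !mxE /t pkpos.
Qed.

End ImplicitExchange.

(** * Spans of differentials *)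
Section Span.
Variables (F : fieldType) (V : lmodType F).
Implicit Types (S : set V) (v : V).

(** Combinations of arbitrary subsets, because the space of covectors on
trajectories has infinite dimension. *)
Definition span S v := exists r : seq (F * V),
  (forall x, x \in r -> S x.2) /\ v = \sum_(x <- r) x.1 *: x.2.

Lemma span_gen S v : S v -> span S v.
Proof.
move=> Sv; exists [:: (1, v)]; split; last by rewrite big_seq1 scale1r.
by move=> x; rewrite inE => /eqP ->.
Qed.

Lemma span0 S : span S 0.
Proof. by exists [::]; rewrite big_nil. Qed.

Lemma spanD S u v : span S u -> span S v -> span S (u + v).
Proof.
move=> [r [rS ->]] [t [tS ->]]; exists (r ++ t); rewrite big_cat; split=> // x.
by rewrite mem_cat => /orP[/rS|/tS].
Qed.

Lemma spanZ S a v : span S v -> span S (a *: v).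
Proof.
move=> [r [rS ->]]; exists [seq (a * x.1, x.2) | x <- r]; split.
  by move=> x /mapP [y yr ->]; exact: (rS y yr).
rewrite big_map scaler_sumr; apply: eq_bigr => x _ /=.
by rewrite scalerA.
Qed.

Lemma spanN S v : span S v -> span S (- v).
Proof. by rewrite -scaleN1r; exact: spanZ. Qed.

Lemma span_sum S (I : eqType) (r : seq I) (P : pred I) (G : I -> V) :
  (forall i, i \in r -> P i -> span S (G i)) -> span S (\sum_(i <- r | P i) G i).
Proof.
move=> SG; rewrite big_seq_cond.
elim/big_ind : _ => [|u v|i /andP[]].
- exact: span0.
- exact: spanD.
- exact: SG.
Qed.

Lemma span_trans S S' v : (forall u, S u -> span S' u) -> span S v -> span S' v.
Proof.
move=> SS' [r [rS ->]]; apply: span_sum => x xr _.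
by apply: spanZ; apply: SS'; exact: rS.
Qed.

Lemma span_sub S S' v : S `<=` S' -> span S v -> span S' v.
Proof. by move=> SS'; apply: span_trans => u /SS'; exact: span_gen. Qed.

Lemma span_bounded (S : nat -> set V) v : (forall N, S N `<=` S N.+1) ->
  span (\bigcup_N S N) v -> exists N, span (S N) v.
Proof.
move=> SS [r [rS ->]].
have mon N N' : (N <= N')%N -> S N `<=` S N'.
  move=> /subnK <-; elim: (N' - N)%N => [|k IH] u // /IH; rewrite addSn; exact: SS.
elim: r rS => [|x r IH] rS; first by exists 0%N; rewrite big_nil; exact: span0.
have [N HN] : exists N, span (S N) (\sum_(x <- r) x.1 *: x.2).
  by apply: IH => y yr; apply: rS; rewrite in_cons yr orbT.
have [N' _ SN'] := rS x (mem_head _ _).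
exists (maxn N N'); rewrite big_cons; apply: spanD.
  by apply: spanZ; apply: span_gen; apply: (mon N'); rewrite ?leq_maxr.
by apply: span_sub HN; apply: mon; rewrite leq_maxl.
Qed.

Lemma span_fin (J : finType) (P : pred J) (g : J -> V) S v :
  (forall u, S u -> exists2 j, P j & u = g j) -> span S v ->
  exists a : J -> F, v = \sum_(j | P j) a j *: g j.
Proof.
move=> Sg [r [rS ->]]; elim: r rS => [|x r IH] rS.
  by exists (fun=> 0); rewrite big_nil big1 // => j _; rewrite scale0r.
have [a E] : exists a : J -> F, \sum_(x <- r) x.1 *: x.2 = \sum_(j | P j) a j *: g j.
  by apply: IH => y yr; apply: rS; rewrite in_cons yr orbT.
have [j Pj xj] := Sg _ (rS x (mem_head _ _)).
exists (fun i => a i + (if i == j then x.1 else 0)).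
rewrite big_cons E xj addrC.
under [RHS]eq_bigr do rewrite scalerDl.
rewrite big_split /=; congr (_ + _).
rewrite (bigD1 j) //= eqxx big1 ?addr0 // => i /andP[_ /negbTE ->].
by rewrite scale0r.
Qed.

Definition indep (I : finType) (f : I -> V) :=
  forall a : I -> F, \sum_i a i *: f i = 0 -> forall i, a i = 0.

Lemma indep_notin (I : finType) (f : I -> V) i :
  indep f -> ~ span [set f j | j in [set j | j != i]] (f i).
Proof.
move=> fi S.
have [a E] : exists a : I -> F, f i = \sum_(j | j != i) a j *: f j.
  by apply: (span_fin (P := fun j => j != i)) S => _ [j ji <-]; exists j.
have := fi (fun j => if j == i then -1 else a j).
rewrite (bigD1 i) //= eqxx scaleN1r (eq_bigr (fun j => a j *: f j)); last first.
  by move=> j /negbTE ->.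
by rewrite -E addNr => /(_ erefl i); rewrite eqxx => /eqP; rewrite oppr_eq0 oner_eq0.
Qed.

(** The coefficient matrix of f over g has independent rows, so it has at least
as many columns as rows. *)
Lemma span_card (I J : finType) (P : pred J) (f : I -> V) (g : J -> V) :
  indep f -> (forall i, span [set g j | j in [set j | P j]] (f i)) ->
  (#|I| <= #|P|)%N.
Proof.
move=> fi fs.
have /choice [A AE] : forall i, exists a : J -> F, f i = \sum_(j | P j) a j *: g j.
  by move=> i; apply: (span_fin (P := P) (g := g)) (fs i) => u [j Pj <-]; exists j.
pose M : 'M[F]_(#|I|, #|P|) := \matrix_(i, j) A (enum_val i) (enum_val j).
suff : row_free M by move=> /eqP <-; exact: rank_leq_col.
rewrite -kermx_eq0; apply/rowV0P => x /sub_kermxP xM.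
have := fi (fun i => x 0 (enum_rank i)) _.
move=> /(_ _) H; apply/rowP => i; rewrite [RHS]mxE -(enum_valK i); apply: H.
rewrite (reindex (enum_val : 'I_#|I| -> I)) /=; last first.
  by exists enum_rank => ? _; rewrite ?enum_valK ?enum_rankK.
under eq_bigr => k _ do rewrite enum_valK AE scaler_sumr.
rewrite exchange_big /= big1 // => j Pj.
under eq_bigr => k _ do rewrite scalerA.
rewrite -scaler_suml.
have := congr1 (fun z : 'rV[F]__ => z 0 (enum_rank_in (Pj : j \in P) j)) xM.
rewrite !mxE => E; rewrite (_ : \sum_k _ = 0) ?scale0r // -[RHS]E.
by apply: eq_bigr => k _; rewrite mxE enum_rankK_in.
Qed.

End Span.

Section Dif.
Variable F : realType.
Local Notation Pt I := {ptws I -> F}.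

Section D1.
Variable J : eqType.
Implicit Types (p : Pt J) (h : Pt J -> F).

Definition dif p h : J -> F := fun c => pder c h p.

Lemma dif_near p h h' : (\forall q \near p, h q = h' q) -> dif p h = dif p h'.
Proof. by move=> hh; apply/funext => c; exact: pder_near. Qed.

Lemma dif_sum (K : Type) (r : seq K) C p (h : K -> Pt J -> F) (a : K -> F) :
  (forall k, smooth_fun_of C p (h k)) ->
  dif p (fun w => \sum_(k <- r) a k * h k w) = \sum_(k <- r) a k *: dif p (h k).
Proof.
by move=> sh; apply/funext => c; rewrite /dif (pder_sum _ _ _ sh) fct_sumE.
Qed.

End D1.

Lemma expr_by_span (I J : eqType) (Y : Pt J -> Pt I) (C : pred I) p0 h :
  expr_by Y C p0 h ->
  (forall c, {for p0, continuous (fun p => Y p c)}) ->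
  (forall c, C c -> smooth_fun_of predT p0 (fun p => Y p c)) ->
  \forall p \near p0, span [set dif p (fun q => Y q c) | c in [set c | C c]] (dif p h).
Proof.
move=> [H [sH HE]] cY sY; have [s [us Cs ch]] := chain_near sH cY sY.
apply: (nearS2 _ ch (near_near HE)) => p pch pHE.
have -> : dif p h = \sum_(c <- s) pder c H (Y p) *: dif p (fun q => Y q c).
  rewrite (dif_near pHE); apply/funext => d.
  by rewrite /dif pch fct_sumE.
apply: span_sum => c cs _; apply: spanZ; apply: span_gen.
by exists c => //=; exact: (allP Cs).
Qed.

(** At a fixed point of Y, a linear relation sum a_i dg_i = 0 may be composed
with Y: the function K = sum a_i g_i has zero differential, hence so has K o Y
by the chain rule. *)
Lemma span_dif_shift (J : eqType) (Y : Pt J -> Pt J) p0 (A : set (Pt J -> F)) h :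
  Y p0 = p0 -> (forall c, smooth_fun_of predT p0 (fun p => Y p c)) ->
  (forall g, A g -> smooth_fun_of predT p0 g) -> smooth_fun_of predT p0 h ->
  span [set dif p0 g | g in A] (dif p0 h) ->
  span [set dif p0 (fun p => g (Y p)) | g in A] (dif p0 (fun p => h (Y p))).
Proof.
move=> Yp0 sY sA sh [r [rS E]].
have cY c : {for p0, continuous (fun p => Y p c)} by exact: sf_cts (sY c).
have sYg g : smooth_fun_of predT p0 g -> smooth_fun_of predT p0 (fun p => g (Y p)).
  by move=> sg; apply: (sf_comp (C := predT)) => //; rewrite Yp0.
have /choice [G GP] : forall x : F * (J -> F), exists g, smooth_fun_of predT p0 g /\
    (x \in r -> A g /\ x.2 = dif p0 g).
  move=> x; have [xr|xr] := boolP (x \in r).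
    have [g Ag gx] := rS x xr.
    by exists g; split; [exact: sA|].
  by exists (fun=> 0); split=> //; exact: sf_cst.
pose g0 (x : option (F * (J -> F))) := if x is Some x then G x else h.
pose a0 (x : option (F * (J -> F))) := if x is Some x then - x.1 else 1.
have sg0 x : smooth_fun_of predT p0 (g0 x) by case: x => [x|] //; exact: (GP x).1.
pose rr := None :: [seq Some x | x <- r].
(* The function h - sum a_i g_i, with None standing for h. *)
pose K p := \sum_(x <- rr) a0 x * g0 x p.
have sK : smooth_fun_of predT p0 K := sf_sum rr a0 sg0.
have dK c : pder c K p0 = 0.
  rewrite /K (pder_sum _ _ _ sg0) big_cons big_map /= mul1r.
  rewrite -[pder c h p0]/(dif p0 h c) E fct_sumE -big_split /= big_seq big1 // => x xr.
  have [_ /(_ xr) [_ xE]] := GP x.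
  by rewrite mulNr {1}xE -[(_ *: _) c]/(x.1 * pder c (G x) p0) subrr.
have dKY : dif p0 (fun p => K (Y p)) = 0.
  have sK' : smooth_fun_of predT (Y p0) K by rewrite Yp0.
  have [s [us _ /nbhs_singleton ch]] := chain_near sK' cY (fun c _ => sY c).
  by apply/funext => d; rewrite /dif ch big1 // => c _; rewrite Yp0 dK mul0r.
have sg0Y x : smooth_fun_of predT p0 (fun p => g0 x (Y p)) by exact: sYg.
have : \sum_(x <- rr) a0 x *: dif p0 (fun p => g0 x (Y p)) = 0.
  by rewrite -(dif_sum _ _ sg0Y) -dKY.
rewrite big_cons big_map scale1r => /eqP; rewrite addr_eq0 => /eqP ->.
apply: spanN; apply: span_sum => x xr _; apply: spanZ; apply: span_gen.
by exists (G x) => //; have [_ /(_ xr) []] := GP x.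
Qed.

End Dif.

(** * Differentials of a flat output *)
Section VectorSmooth.
Variable F : realType.

(** Smoothness of a vector-valued map is defined by derivatives of vectors; this
passes to the components. *)
Lemma smooth_at_coord N k (g : 'rV[F]_N -> 'rV[F]_k) a j :
  smooth_at g a -> smooth_at (fun z => g z 0 j : F) a.
Proof.
move=> sg.
pose U := interior [set z | forall s, differentiable (foldr (fun i h => 'D_('e_i) h) g s) z].
have oU : open U by exact: open_interior.
have dU s z : U z -> differentiable (foldr (fun i h => 'D_('e_i) h) g s) z.
  by move=> /interior_subset.
have E s z : U z -> foldr (fun i h => 'D_('e_i) h) (fun z => g z 0 j : F) s z =
    foldr (fun i h => 'D_('e_i) h) g s z 0 j.
  elim: s z => [|i s IH] z Uz //=.
  have n1 : \forall y \near z, foldr (fun i h => 'D_('e_i) h) (fun z => g z 0 j : F) s y =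
    foldr (fun i h => 'D_('e_i) h) g s y 0 j.
    by apply: nearS (near_open oU Uz) => y; exact: IH.
  rewrite (near_eq_derive _ n1) derive_mx ?mxE //.
  exact/diff_derivable/dU.
have Ua : U a by exact: sg.
apply: nearS (near_open oU Ua) => z Uz s.
apply: (@near_eq_differentiable F N (fun y => foldr (fun i h => 'D_('e_i) h) g s y 0 j)).
  by apply: nearS (near_open oU Uz) => y /E ->.
apply: (@differentiable_comp F _ _ _ (foldr (fun i h => 'D_('e_i) h) g s)
  (fun M : 'rV[F]_k => M 0 j)); first exact: dU.
exact: differentiable_coord.
Qed.

End VectorSmooth.

Section System.
Variables (F : realType) (n m : nat) (sys : dtsystem F n m).
Local Notation p0 := (eq_traj sys).
Local Notation sh := (shift sys).
Local Notation traj := (traj F n m).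
Local Notation sm := (smooth_fun_of predT p0).

Lemma xu_p0 : xu_of p0 = row_mx (sys_x0 sys) (sys_u0 sys).
Proof. by congr row_mx; apply/rowP => i; rewrite mxE. Qed.

Lemma shift_p0 : sh p0 = p0.
Proof.
apply/funext => -[[|b] j|i|a j] //=; rewrite ?xu_p0 //.
by rewrite -sys_equilibrium.
Qed.

Definition xu_vars : pred (coord n m) := fun c =>
  match c with Zeta _ _ => false | Xc _ => true | Uc a _ => a == 0%N end.

Lemma sf_xu k (g : 'rV[F]_(n + m) -> 'rV[F]_k) j :
  smooth_at g (row_mx (sys_x0 sys) (sys_u0 sys)) ->
  smooth_fun_of xu_vars p0 (fun p : traj => g (xu_of p) 0 j).
Proof.
move=> sg.
pose t (i : 'I_(n + m)) : coord n m :=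
  match fintype.split i with inl i => Xc i | inr j => Uc 0 j end.
have E (p : traj) : \row_i p (t i) = xu_of p.
  apply/rowP => i; rewrite !mxE /t; case: (fintype.split i) => k'; by rewrite mxE.
exists (n + m)%N, t, (fun z => g z 0 j); split.
- by move=> i; rewrite /t; case: (fintype.split i).
- by rewrite E xu_p0; exact: smooth_at_coord.
- by apply: near_all => w; rewrite E.
Qed.

Lemma sf_sysf i : smooth_fun_of xu_vars p0 (fun p : traj => sys_f sys (xu_of p) 0 i).
Proof. by apply: sf_xu; exact: sys_f_smooth. Qed.

Lemma sf_sysg j : smooth_fun_of xu_vars p0 (fun p : traj => sys_g sys (xu_of p) 0 j).
Proof. by apply: sf_xu; exact: sys_g_smooth. Qed.

Lemma sf_shift c : sm (fun p => sh p c).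
Proof.
case: c => [[|b] j|i|a j] /=.
- exact: sf_sub (sf_sysg j).
- exact: sf_coord.
- exact: sf_sub (sf_sysf i).
- exact: sf_coord.
Qed.

Lemma iter_shift_p0 a : iter a sh p0 = p0.
Proof. by elim: a => //= a ->; exact: shift_p0. Qed.

Lemma sf_iter_shift a c : sm (fun p => iter a sh p c).
Proof.
elim: a c => [|a IH] c /=; first exact: sf_coord.
apply: (sf_comp (C := predT) (H := fun p => sh p c)) => //.
  rewrite iter_shift_p0; exact: sf_shift.
by move=> d; exact: sf_cts (IH d).
Qed.

Lemma cts_iter_shift a : {for p0, continuous (iter a sh)}.
Proof. by apply: into_ptws_cts => c; exact: sf_cts (sf_iter_shift a c). Qed.

Lemma near_shift a (P : traj -> Prop) : (\forall p \near p0, P p) ->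
  \forall p \near p0, P (iter a sh p).
Proof.
move=> nP; apply: (near_comp (P := P) (@cts_iter_shift a)).
by rewrite iter_shift_p0.
Qed.

Lemma sf_fshift a h : sm h -> sm (fshift sys a h).
Proof.
move=> sh'; apply: (sf_comp (C := predT) (H := h)).
- by rewrite iter_shift_p0.
- by move=> c; exact: sf_cts (sf_iter_shift a c).
- by move=> c _; exact: sf_iter_shift.
Qed.

Lemma span_fshift a (A : set (traj -> F)) h : (forall g, A g -> sm g) -> sm h ->
  span [set dif p0 g | g in A] (dif p0 h) ->
  span [set dif p0 (fshift sys a g) | g in A] (dif p0 (fshift sys a h)).
Proof.
move=> sA sh'; apply: (span_dif_shift (Y := iter a sh)) => //.
  exact: iter_shift_p0.
exact: sf_iter_shift.
Qed.

Variables (q1 : nat) (phi : 'I_m -> traj -> F) (R : 'I_m -> nat).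
Hypothesis fo : flat_output sys q1 phi R.

Local Notation y j a := (fshift sys a (phi j)).
Local Notation dy j a := (dif p0 (y j a)).

Lemma sf_phi j : sm (phi j).
Proof. by have [sp _ _] := fo; exact: sf_sub (sp j). Qed.

Lemma sf_y j a : sm (y j a).
Proof. by apply: sf_fshift; exact: sf_phi. Qed.

Lemma cts_yshifts : forall c, {for p0, continuous (fun p => yshifts sys phi p c)}.
Proof. by move=> [a j]; exact: sf_cts (sf_y j a). Qed.

Definition dy_set (P : nat -> 'I_m -> Prop) : set (coord n m -> F) :=
  [set dy aj.2 aj.1 | aj in [set aj | P aj.1 aj.2]].

Lemma dy_setS (P P' : nat -> 'I_m -> Prop) v : (forall a j, P a j -> P' a j) ->
  span (dy_set P) v -> span (dy_set P') v.
Proof. by move=> PP; apply: span_sub => _ [[a j] /= /PP H <-]; exists (a, j). Qed.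

Lemma span_y_shift b (P : nat -> 'I_m -> Prop) h : sm h -> span (dy_set P) (dif p0 h) ->
  span (dy_set (fun a j => exists2 a', P a' j & a = (a' + b)%N)) (dif p0 (fshift sys b h)).
Proof.
move=> sh' S.
have := @span_fshift b [set y aj.2 aj.1 | aj in [set aj | P aj.1 aj.2]] h _ sh' _.
have sA g : [set y aj.2 aj.1 | aj in [set aj | P aj.1 aj.2]] g -> sm g.
  by move=> [[a j] _ <-]; exact: sf_y.
have S' : span [set dif p0 g | g in [set y aj.2 aj.1 | aj in [set aj | P aj.1 aj.2]]] (dif p0 h).
  by apply: span_sub S => _ [[a j] Pa <-]; exists (y j a) => //; exists (a, j).
move=> /(_ sA S'); apply: span_sub => _ [g [[a j] /= Pa <-] <-].
exists ((a + b)%N, j) => /=; first by exists a.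
by congr dif; apply/funext => p; rewrite /fshift iterD.
Qed.

Lemma span_y_x i : span (dy_set (fun a j => (a < R j)%N)) (dif p0 (fun p : traj => p (Xc i))).
Proof.
have [_ [/(_ i) ex _] _] := fo.
have := nbhs_singleton (expr_by_span ex cts_yshifts (fun c _ => sf_y c.2 c.1)).
by apply: span_sub => _ [[a j] /= aj <-]; exists (a, j).
Qed.

Lemma span_y_u j : span (dy_set (fun a j => (a <= R j)%N)) (dif p0 (fun p : traj => p (Uc 0 j))).
Proof.
have [_ [_ /(_ j) ex] _] := fo.
have := nbhs_singleton (expr_by_span ex cts_yshifts (fun c _ => sf_y c.2 c.1)).
by apply: span_sub => _ [[a l] /= aj <-]; exists (a, l).
Qed.

Lemma fshift_u a j : fshift sys a (fun p : traj => p (Uc 0 j)) = (fun p => p (Uc a j)).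
Proof.
apply/funext => p; rewrite /fshift.
suff E b : iter a sh p (Uc b j) = p (Uc (b + a) j) by rewrite E.
by elim: a b => [|a IH] b /=; rewrite ?addn0 // IH addSnnS.
Qed.

Lemma span_y_u_shift b j :
  span (dy_set (fun a j => (a <= R j + b)%N)) (dif p0 (fun p : traj => p (Uc b j))).
Proof.
rewrite -fshift_u; have := span_y_shift b _ (span_y_u j).
move=> /(_ (sf_coord _ (isT : predT _))); apply: dy_setS => a l [a' al ->].
by rewrite leq_add2r.
Qed.

Lemma dif_coord (c : coord n m) p : dif p (fun q : traj => q c) = fun d => (d == c)%:R.
Proof. by apply/funext => d; rewrite /dif pder_coord. Qed.

Lemma indep_coord (I : finType) (f : I -> coord n m) p : injective f ->
  indep (fun i => dif p (fun q : traj => q (f i))).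
Proof.
move=> fi a a0 i; have := congr1 (fun v : coord n m -> F => v (f i)) a0.
rewrite fct_sumE (bigD1 i) //= big1 ?addr0.
  rewrite -[(a i *: _) _]/(a i * _) dif_coord eqxx mulr1 => ->.
  by [].
move=> j ji; rewrite -[(a j *: _) _]/(a j * _) dif_coord (inj_eq fi) eq_sym (negbTE ji).
by rewrite mulr0.
Qed.

(** A relation expressing dy^{j0}_[N] by dy_[0,N-1] and the other dy^l_[N] would
propagate: its shifts express all the later dy^{j0} as well.  Then dy_[0,N+B-1]
lies in a span of N m + B (m - 1) covectors, which contains the
(N + B - max R) m independent covectors du_[a], a < N + B - max R. *)
Lemma dy_top_notin N j0 : ~ span (dy_set (fun a j => (a < N)%N \/ a = N /\ j != j0)) (dy j0 N).
Proof.
move=> S.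
pose Rm := \max_j R j.
(* Large enough for (N + B - Rm) m > N m + B (m - 1), that is B > Rm m. *)
pose B := (Rm * m).+1.
pose g (x : 'I_N * 'I_m + 'I_B * 'I_m.-1) : coord n m -> F :=
  match x with inl x => dy x.2 x.1 | inr x => dy (lift j0 x.2) (N + x.1) end.
pose gS : set (coord n m -> F) := [set g x | x in [set x | xpredT x]].
have red K j : (K < N + B)%N -> span gS (dy j K).
  elim/ltn_ind: K j => K IH j KNB.
  have [KN|NK] := ltnP K N.
    by apply: span_gen; exists (inl (Ordinal KN, j)).
  have KB : (K - N < B)%N by rewrite ltn_subLR // ltnW // ltn_psubLR.
  have E : (N + (K - N))%N = K by rewrite subnKC.
  have gen l : l != j0 -> span gS (dy l K).
    move=> lj; case: (unliftP j0 l) lj => [l' ->|->]; last by rewrite eqxx.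
    by move=> _; apply: span_gen; exists (inr (Ordinal KB, l')) => //=; rewrite E.
  have [jj|] := eqVneq j j0; last exact: gen.
  have := span_y_shift (K - N) (sf_y j0 N) S.
  have -> : fshift sys (K - N) (y j0 N) = y j0 K.
    by apply/funext => p; rewrite -{2}E [in RHS]addnC /fshift addnC iterD.
  rewrite jj; apply: span_trans => _ [[a l] /= [a' [a'N|[-> lj]] ->] <-].
    by apply: IH; lia.
  by rewrite E; exact: gen.
pose f (x : 'I_(N + B - Rm) * 'I_m) : coord n m -> F :=
  dif p0 (fun p : traj => p (Uc x.1 x.2)).
have fi : indep f.
  apply: (@indep_coord _ (fun x : 'I_(N + B - Rm) * 'I_m => Uc x.1 x.2)).
  by move=> [a j] [b l] /= [/val_inj -> ->].
have fs x : span [set g j | j in [set j | xpredT j]] (f x).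
  case: x => a j; apply: span_trans (span_y_u_shift a j).
  move=> _ [[k l] /= kl <-]; apply: red.
  have aN := ltn_ord a; have RlRm : (R l <= Rm)%N := leq_bigmax l.
  by lia.
have := span_card fi fs.
rewrite card_prod card_sum !card_prod !card_ord.
have m0 : (0 < m)%N by case: (j0) => k /(leq_ltn_trans (leq0n _)).
apply/negP; rewrite -ltnNge.
have arith M r b : (0 < M)%N -> (r * M < b)%N ->
    (N * M + b * M.-1 < (N + b - r) * M)%N.
  case: M => // k _ rb.
  have rb' : (r <= b)%N by nia.
  by rewrite -addnBA //= mulnDl mulnBl; nia.
exact: arith.
Qed.

End System.

Section Openness.
Variable F : realType.

Lemma cvg_prodr (T I : Type) (L : set_system T) (r : seq I)
    (f : I -> T -> F) (a : I -> F) {FL : Filter L} :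
  (forall i, f i x @[x --> L] --> a i) ->
  \prod_(i <- r) f i x @[x --> L] --> \prod_(i <- r) a i.
Proof.
move=> fa; elim: r => [|i r IH].
  rewrite big_nil; under eq_fun do rewrite big_nil; exact: cvg_cst.
by rewrite big_cons; under eq_fun do rewrite big_cons; exact: cvgM.
Qed.

Lemma near_unitmx (T : topologicalType) (p0 : T) k (A : T -> 'M[F]_k) :
  (forall i j, {for p0, continuous (fun p => A p i j)}) ->
  A p0 \in unitmx -> \forall p \near p0, A p \in unitmx.
Proof.
move=> cA; rewrite unitmxE unitfE => d0.
have : {for p0, continuous (fun p => \det (A p))}.
  rewrite /prop_for /continuous_at /determinant.
  apply: (@cvg_sumr F _ _ (nbhs p0)) => s; apply: cvgMl_tmp.
  apply: (@cvg_prodr _ _ (nbhs p0)) => i; exact: cA.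
have nd : 0 < `|\det (A p0)| by rewrite normr_gt0.
move=> /cts_ltP/(_ _ nd); apply: nearS => p dp.
rewrite unitmxE unitfE; apply: contraTN dp => /eqP ->.
by rewrite subr0 ltxx.
Qed.

(** A right inverse at p0 remains one up to a matrix close to the identity. *)
Lemma near_row_free (T : topologicalType) (p0 : T) k l (A : T -> 'M[F]_(k, l)) :
  (forall i j, {for p0, continuous (fun p => A p i j)}) ->
  row_free (A p0) -> \forall p \near p0, row_free (A p).
Proof.
move=> cA /row_freeP [B AB].
have : \forall p \near p0, A p *m B \in unitmx.
  apply: near_unitmx; last by rewrite AB unitmx1.
  move=> i j; rewrite (_ : (fun p => _) = (fun p => \sum_e A p i e * B e j)).
    rewrite /prop_for /continuous_at.
    by apply: (@cvg_sumr F _ _ (nbhs p0)) => e; apply: cvgMr_tmp; exact: cA.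
  by apply/funext => p; rewrite mxE.
apply: nearS => p pu; apply/row_freeP; exists (B *m invmx (A p *m B)).
by rewrite mulmxA mulmxV.
Qed.

(** Independence is an open condition, since the differentials depend on finitely
many partial derivatives, which are continuous. *)
Lemma indep_near (J : eqType) (I : finType) (p0 : {ptws J -> F})
    (h : I -> {ptws J -> F} -> F) :
  (forall i, smooth_fun_of predT p0 (h i)) ->
  indep (fun i => dif p0 (h i)) -> \forall p \near p0, indep (fun i => dif p (h i)).
Proof.
move=> sh ih.
have [//|s [us _ _ [G GP]]] := sf_family sh (s0 := [::]).
pose A (p : {ptws J -> F}) : 'M[F]_(#|I|, size s) :=
  \matrix_(i, e) 'D_('e_e) (G (enum_val i)) (res s p).
have nA : \forall p \near p0, forall i, sf_on p (h i) (G i).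
  by apply: near_forall => i; exact: sf_on_near (GP i).
have dA p : (forall i, sf_on p (h i) (G i)) -> forall i e,
    dif p (h i) (tnth (in_tuple s) e) = A p (enum_rank i) e.
  by move=> pG i e; rewrite /dif (sf_on_pder e us (pG i)) mxE enum_rankK.
have rf : row_free (A p0).
  rewrite -kermx_eq0; apply/rowV0P => x /sub_kermxP xA.
  have x0 : forall i, x 0 (enum_rank i) = 0.
    apply: ih; apply/funext => c; rewrite fct_sumE.
    have [/(@tnthP _ _ (in_tuple s)) [e ->]|cs] := boolP (c \in s); last first.
      by rewrite big1 // => i _; rewrite -[LHS]/(_ * dif p0 (h i) c) /dif (sf_on_pder0 cs (GP i)) mulr0.
    have := congr1 (fun z : 'rV[F]__ => z 0 e) xA; rewrite [X in _ = X -> _]mxE => E.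
    rewrite -[RHS]E mxE (reindex (enum_rank : I -> 'I_#|I|)) /=; last first.
      by exists enum_val => ? _; rewrite ?enum_valK ?enum_rankK.
    by apply: eq_bigr => i _; rewrite -[LHS]/(_ * dif p0 (h i) _) (dA _ GP).
  by apply/rowP => i; rewrite [RHS]mxE -(enum_valK i) x0.
have cA i e : {for p0, continuous (fun p => A p i e)}.
  have [sG _] := GP (enum_val i).
  apply/cts_ltP => r r0; have /cts_ltP/(_ r r0) n1 := smooth_cts (smooth_D e sG).
  apply: nearS (near_comp (P := fun z => `|'D_('e_e) (G (enum_val i)) (res s p0) -
    'D_('e_e) (G (enum_val i)) z| < r) (@res_cts F J s p0) n1) => p.
  by rewrite !mxE.
apply: (nearS2 _ nA (near_row_free cA rf)) => p pG /row_freeP [B AB] a a0 i.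
pose x : 'rV[F]_#|I| := \row_i a (enum_val i).
have xA : x *m A p = 0.
  apply/rowP => e; rewrite [RHS]mxE.
  have := congr1 (fun v : J -> F => v (tnth (in_tuple s) e)) a0.
  rewrite fct_sumE -[X in _ = X -> _]/0 => E; rewrite -[RHS]E mxE.
  rewrite (reindex (enum_rank : I -> 'I_#|I|)) /=; last first.
    by exists enum_val => ? _; rewrite ?enum_valK ?enum_rankK.
  apply: eq_bigr => k _; rewrite -[RHS]/(_ * dif p (h k) _) (dA _ pG).
  by rewrite mxE enum_rankK.
have x0 : x = 0 by rewrite -[x]mulmx1 -AB mulmxA xA mul0mx.
have := congr1 (fun z : 'rV[F]__ => z 0 (enum_rank i)) x0.
by rewrite !mxE enum_rankK.
Qed.

End Openness.

Section YIndep.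
Variables (F : realType) (n m : nat) (sys : dtsystem F n m).
Local Notation p0 := (eq_traj sys).
Local Notation sh := (shift sys).
Local Notation traj := (traj F n m).
Local Notation sm := (smooth_fun_of predT p0).
Variables (q1 : nat) (phi : 'I_m -> traj -> F) (R : 'I_m -> nat).
Hypothesis fo : flat_output sys q1 phi R.
Local Notation y j a := (fshift sys a (phi j)).
Local Notation dy j a := (dif p0 (y j a)).
Local Notation dy_set := (dy_set sys phi).

(** In a nontrivial relation, the terms of highest order contradict
[dy_top_notin]. *)
Lemma dy_indep N : indep (fun x : 'I_N * 'I_m => dy x.2 x.1).
Proof.
move=> a a0 x0; apply/eqP; apply: contraT => ax0; exfalso.
case: (@arg_maxnP _ x0 (fun x => a x != 0) (fun x : 'I_N * 'I_m => x.1 : nat) ax0) => x ax xmax.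
apply: (dy_top_notin fo (N := x.1) (j0 := x.2)).
have -> : dy x.2 x.1 = - (a x)^-1 *: \sum_(j | j != x) a j *: dy j.2 j.1.
  move: a0; rewrite (bigD1 x) //= => /eqP; rewrite addrC addr_eq0 => /eqP ->.
  by rewrite scalerN scaleNr opprK scalerA mulVf // scale1r.
apply: spanZ; apply: span_sum => z _ zx.
have [->|az] := eqVneq (a z) 0; first by rewrite scale0r; exact: span0.
apply: spanZ; apply: span_gen; exists (z.1 : nat, z.2) => //=.
have := xmax z az; rewrite /= leq_eqVlt => /orP[/eqP zx1|zx1]; last by left.
right; split=> //; apply: contra zx => /eqP zx2.
by apply/eqP; case: (z) (x) zx1 zx2 => [z1 z2] [x1 x2] /= /val_inj -> ->.
Qed.

Lemma dy_notin k j : ~ span (dy_set (fun a l => (a, l) != (k, j))) (dy j k).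
Proof.
move=> S.
have [N SN] : exists N, span (dy_set (fun a l => (a < N)%N && ((a, l) != (k, j)))) (dy j k).
  apply: span_bounded.
    move=> N _ [[a l] /= /andP[aN al] <-]; exists (a, l) => //=.
    by rewrite al andbT ltnW.
  apply: span_sub S => _ [[a l] /= al <-].
  by exists a.+1 => //; exists (a, l) => //=; rewrite ltnSn.
pose N' := maxn N k.+1.
have kN : (k < N')%N by rewrite leq_max ltnSn orbT.
pose x0 : 'I_N' * 'I_m := (Ordinal kN, j).
apply: (indep_notin (i := x0) (@dy_indep N')).
apply: span_sub SN => _ [[a l] /= /andP[aN al] <-].
have aN' : (a < N')%N by rewrite leq_max aN.
by exists (Ordinal aN', l) => //=; apply: contra al => /eqP [-> ->].
Qed.

Definition zx_vars q : pred (coord n m) := fun c =>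
  match c with Zeta b _ => (b < q)%N | Xc _ => true | Uc _ _ => false end.

Definition dzx_set (p : traj) q : set (coord n m -> F) :=
  [set dif p (fun w : traj => w c) | c in [set c | zx_vars q c]].

Lemma iter_shift_zeta b j (p : traj) :
  iter b.+1 sh p (Zeta b j) = sys_g sys (xu_of p) 0 j.
Proof. by elim: b p => // b IH p; rewrite iterS. Qed.

Lemma span_sf C p (h : traj -> F) : smooth_fun_of C p h ->
  span [set dif p (fun w : traj => w c) | c in [set c | C c]] (dif p h).
Proof.
move=> sh'.
have ex : expr_by (fun w : traj => w) C p h by exists h; split=> //; exact: near_all.
apply: (nbhs_singleton (expr_by_span ex _ _)).
  by move=> c; exact: eval_cts.
by move=> c _; exact: sf_coord.
Qed.

(** After q shifts zeta_[-q,-1] has become values of g(x,u) at present or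
future times, which flatness expresses by y. *)
Lemma span_w_shift q c : zx_vars q c ->
  span (dy_set (fun a j => (a < R j + q)%N)) (dif p0 (fshift sys q (fun p : traj => p c))).
Proof.
case: c => [b j|i|//] /=.
  move=> bq; rewrite (_ : fshift _ _ _ = fshift sys (q - b.+1) (fun p => sys_g sys (xu_of p) 0 j)).
    have sg := sf_sysg sys j.
    have S : span (dy_set (fun a j => (a <= R j)%N)) (dif p0 (fun p : traj => sys_g sys (xu_of p) 0 j)).
      apply: span_trans (span_sf sg) => _ [[//|i|a l] /= al <-].
        by apply: dy_setS (span_y_x fo i) => a l /ltnW.
      by rewrite (eqP al); exact: span_y_u fo l.
    have sg' : sm (fun p : traj => sys_g sys (xu_of p) 0 j) by exact: sf_sub sg.
    apply: dy_setS (span_y_shift fo (q - b.+1) sg' S) => a l [a' al ->]; lia.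
  apply/funext => p; rewrite /fshift.
  by rewrite -{1}(subnKC bq) iterD iter_shift_zeta.
move=> _; have sx : sm (fun p : traj => p (Xc i)) by exact: sf_coord.
by apply: dy_setS (span_y_shift fo q sx (span_y_x fo i)) => a l [a' al ->]; lia.
Qed.

(** After q shifts the dzeta and dx are absorbed by dy_[0,R+q-1], which does not
contain dy^j_[k+q] because k >= R^j; so the relation contradicts the
independence of the dy. *)
Lemma dy_notin_dzx q k j : (R j <= k)%N ->
  ~ span (dzx_set p0 q `|` dy_set (fun a l => (a, l) != (k, j))) (dy j k).
Proof.
move=> Rk S.
pose A : set (traj -> F) := [set (fun p => p c) | c in [set c | zx_vars q c]] `|`
   [set y al.2 al.1 | al in [set al | al != (k, j)]].
have sA g : A g -> sm g.
  by move=> [[c _ <-]|[al _ <-]]; [exact: sf_coord|exact: sf_y fo _ _].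
have S' : span [set dif p0 g | g in A] (dy j k).
  apply: span_sub S => v [[c zc <-]|[[a l] al <-]].
    by exists (fun p => p c) => //; left; exists c.
  by exists (y l a) => //; right; exists (a, l).
have := span_fshift q sA (sf_y fo j k) S'.
have -> : fshift sys q (y j k) = y j (k + q) by apply/funext => p; rewrite /fshift iterD.
move=> S2; apply: (@dy_notin (k + q)%N j); apply: span_trans S2.
move=> _ [g [[c zc <-]|[[a l] /= al <-]] <-].
  apply: dy_setS (span_w_shift zc) => a l aR; apply: contraTneq aR => -[-> ->].
  by rewrite -leqNgt leq_add2r.
apply: span_gen; exists ((a + q)%N, l) => /=.
  by apply: contra al => /eqP [/addIn -> ->].
by congr dif; apply/funext => p; rewrite /fshift iterD.
Qed.

End YIndep.

(** * Trajectories in the coordinates of the procedure *)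

(** [X] and [X'] agree near [a] in each coordinate, but not on a common
neighbourhood for all of them; a smooth function sees only finitely many. *)
Lemma sf_agree (F : realType) (I : eqType) (T : topologicalType) (C : pred I)
    (h : {ptws I -> F} -> F) (X X' : T -> {ptws I -> F}) a :
  smooth_fun_of C (X a) h -> X' a = X a ->
  {for a, continuous X} -> {for a, continuous X'} ->
  (forall c, C c -> \forall q \near a, X q c = X' q c) ->
  \forall q \near a, h (X q) = h (X' q).
Proof.
move=> /sf_norm [s [G [us Cs [sG HG]]]] Xa cX cX' XX.
have n1 := near_comp (P := fun w => h w = G (res s w)) cX HG.
have n2 : \forall q \near a, h (X' q) = G (res s (X' q)).
  by apply: (near_comp (P := fun w => h w = G (res s w)) cX'); rewrite Xa.
have n3 : \forall q \near a, forall c, c \in s -> X q c = X' q c.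
  by apply: near_seq => c cs; apply: XX; exact: (allP Cs).
apply: (nearS2 _ (near_and n1 n2) n3) => q [-> ->] E.
by congr G; apply/rowP => i; rewrite !mxE E // mem_tnth.
Qed.

Lemma cts_comp (T1 T2 T3 : topologicalType) (f : T1 -> T2) (g : T2 -> T3) a b :
  f a = b -> {for a, continuous f} -> {for b, continuous g} ->
  {for a, continuous (fun x => g (f x))}.
Proof. by move=> <- cf cg P nP; exact: cf _ (cg P nP). Qed.

Section Charts.
Variables (F : realType) (n m : nat) (sys : dtsystem F n m).
Local Notation p0 := (eq_traj sys).
Local Notation sh := (shift sys).
Local Notation traj := (traj F n m).
Local Notation sm := (smooth_fun_of predT p0).
Local Notation vcoord := (vcoord n m).
Local Notation vpt := {ptws vcoord -> F}.
Variables (q1 : nat) (phi : 'I_m -> traj -> F) (R : 'I_m -> nat).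
Hypothesis fo : flat_output sys q1 phi R.
Local Notation y j a := (fshift sys a (phi j)).

(** [U0 w] is to be the input u_[0] as a function of the new coordinates w.  The
shift of trajectories then becomes the map [vshift] on these coordinates, and
[inv_chart] reconstructs the trajectory by taking the input u_[a] as [U0] of the
coordinates shifted a times.  For any [U0] whatever these two maps intertwine
with the shift ([shift_inv_chart]), without restriction to a neighbourhood. *)
Section ChartOps.
Variable U0 : vpt -> 'I_m -> F.

Definition xu_chart (w : vpt) : 'rV[F]_(n + m) :=
  row_mx (\row_i w (inl (Xc i))) (\row_j U0 w j).

Definition vshift (w : vpt) : vpt := fun c =>
  match c with
  | inl (Zeta 0 j) => sys_g sys (xu_chart w) 0 j
  | inl (Zeta b.+1 j) => w (inl (Zeta b j))
  | inl (Xc i) => sys_f sys (xu_chart w) 0 i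
  | inl (Uc a j) => w (inl (Uc a.+1 j))
  | inr (a, j) => w (inr (a.+1, j))
  end.

Definition inv_chart (w : vpt) : traj := fun c =>
  match c with Uc a j => U0 (iter a vshift w) j | _ => w (inl c) end.

Lemma xu_inv_chart w : xu_of (inv_chart w) = xu_chart w.
Proof. by congr row_mx; apply/rowP => i; rewrite !mxE. Qed.

Lemma shift_inv_chart w : sh (inv_chart w) = inv_chart (vshift w).
Proof.
apply/funext => -[[|b] j|i|a j] //=; rewrite ?xu_inv_chart //.
by rewrite -iterSr.
Qed.

Lemma iter_shift_inv_chart a w : iter a sh (inv_chart w) = inv_chart (iter a vshift w).
Proof. by elim: a => //= a ->; exact: shift_inv_chart. Qed.

Lemma iter_vshift_inr a b j w : iter a vshift w (inr (b, j)) = w (inr ((b + a)%N, j)).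
Proof. by elim: a b => [|a IH] b /=; rewrite ?addn0 // IH addSnnS. Qed.

Lemma iter_vshift_u a b j w : iter a vshift w (inl (Uc b j)) = w (inl (Uc (b + a) j)).
Proof. by elim: a b => [|a IH] b /=; rewrite ?addn0 // IH addSnnS. Qed.

End ChartOps.

(** The variables on which the first orders may depend: of the remaining inputs
no shifts occur. *)
Definition unshifted_vars (r : seq (step m)) : pred vcoord := fun c =>
  match c with
  | inl (Zeta b _) => (b < q1)%N
  | inl (Xc _) => true
  | inl (Uc a j) => (a == 0%N) && (j \notin ins r)
  | inr (_, j) => j \in outs r
  end.

Lemma unshifted_chart_vars r c : unshifted_vars r c -> chart_vars r c.
Proof. by case: c => [[b j|i|a j]|[a j]] //= /andP[]. Qed.

Lemma zxv_unshifted r c : zxv_vars q1 r c -> unshifted_vars r c.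
Proof. by case: c => [[b j|i|a j]|[a j]]. Qed.

Local Notation ch r := (chart sys phi (kap r)).

(** [U0] recovers the input of every trajectory near p0.  Nothing is said about
coordinates which do not come from a trajectory. *)
Record input_map (r : seq (step m)) (U0 : vpt -> 'I_m -> F) : Prop := {
  ch_exact : forall w w' j, (forall c, unshifted_vars r c -> w c = w' c) -> U0 w j = U0 w' j;
  ch_smooth : forall j, smooth_fun_of (unshifted_vars r) (ch r p0) (fun w => U0 w j);
  ch_rest : forall w j, j \notin ins r -> U0 w j = w (inl (Uc 0 j));
  ch_inv : \forall p \near p0, forall j, U0 (ch r p) j = p (Uc 0 j) }.

Lemma sf_chart k c : sm (fun p => chart sys phi k p c).
Proof. by case: c => [c|[a j]] /=; [exact: sf_coord|exact: sf_y fo _ _]. Qed.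

Lemma cts_chart k : {for p0, continuous (chart sys phi k)}.
Proof. by apply: into_ptws_cts => c; exact: sf_cts (sf_chart k c). Qed.

Section Chart0.
Variables (r : seq (step m)) (U0 : vpt -> 'I_m -> F).
Hypothesis cU : input_map r U0.
Local Notation Y := (ch r).
Local Notation w0 := (ch r p0).
Local Notation sig := (vshift U0).
Local Notation Inv := (inv_chart U0).
Local Notation C := (@chart_vars n m r).
Local Notation C0 := (unshifted_vars r).

Lemma chart_shift p : (forall j, U0 (Y p) j = p (Uc 0 j)) -> Y (sh p) = sig (Y p).
Proof.
move=> Up.
have E : xu_chart U0 (Y p) = xu_of p.
  by congr row_mx; apply/rowP => i; rewrite !mxE.
apply/funext => -[[[|b] j|i|a j]|[a j]] //=; rewrite ?E //.
by rewrite addnS /fshift iterSr.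
Qed.

(** The number of shifts must be fixed in advance: the neighbourhood depends on
it. *)
Lemma chart_iter_shift a : \forall p \near p0, Y (iter a sh p) = iter a sig (Y p).
Proof.
elim: a => [|a IH]; first by apply: near_all.
apply: (nearS2 _ IH (near_shift a (ch_inv cU))) => p /= E Up.
by rewrite chart_shift // E.
Qed.

Lemma vshift_w0 : sig w0 = w0.
Proof. by rewrite -chart_shift ?shift_p0 //; exact: (nbhs_singleton (ch_inv cU)). Qed.

Lemma iter_vshift_w0 a : iter a sig w0 = w0.
Proof. by elim: a => //= a ->; exact: vshift_w0. Qed.

Lemma inv_chart_w0 : Inv w0 = p0.
Proof.
apply/funext => -[b j|i|a j] //=.
by rewrite iter_vshift_w0 (nbhs_singleton (ch_inv cU)).
Qed.

Lemma unshiftedW c : C0 c -> C c. Proof. exact: unshifted_chart_vars. Qed.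

Lemma U0_w0 j : U0 w0 j = sys_u0 sys 0 j.
Proof. by rewrite (nbhs_singleton (ch_inv cU)). Qed.

Lemma sf_U0 (C' : pred vcoord) j : (forall c, C0 c -> C' c) ->
  smooth_fun_of C' w0 (fun w => U0 w j).
Proof. by move=> CC; exact: sf_sub CC (ch_smooth cU j). Qed.

Lemma sf_xu_chart k (g : 'rV[F]_(n + m) -> 'rV[F]_k) j :
  smooth_at g (row_mx (sys_x0 sys) (sys_u0 sys)) ->
  smooth_fun_of C0 w0 (fun w => g (xu_chart U0 w) 0 j).
Proof.
move=> sg.
pose X (w : vpt) : traj := fun c => if c is Uc _ j then U0 w j else w (inl c).
have X0 : X w0 = p0.
  by apply/funext => -[b l|i|a l] //=; rewrite U0_w0.
have XE w : xu_of (X w) = xu_chart U0 w.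
  by congr row_mx; apply/rowP => i; rewrite !mxE.
have sX c : smooth_fun_of predT w0 (fun w => X w c).
  by case: c => [b l|i|a l] /=; [exact: sf_coord|exact: sf_coord|exact: sf_U0].
apply: (sf_ext (H := fun w => g (xu_of (X w)) 0 j)); first by apply: near_all => w; rewrite XE.
apply: (sf_comp (C := @xu_vars n m) (H := fun p : traj => g (xu_of p) 0 j)).
- by rewrite X0; exact: sf_xu.
- by move=> c; exact: sf_cts (sX c).
- by case=> [//|i|a l] _ /=; [exact: sf_coord|exact: sf_U0].
Qed.

Lemma sf_vshift_zxv c : zxv_vars q1 r c -> smooth_fun_of C0 w0 (fun w => sig w c).
Proof.
case: c => [[[|b] j|i|//]|[a j]] /= cz.
- by apply: sf_xu_chart; exact: sys_g_smooth.
- by apply: sf_coord => /=; exact: ltnW.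
- by apply: sf_xu_chart; exact: sys_f_smooth.
- exact: sf_coord.
Qed.

Lemma sf_vshift (C' : pred vcoord) c : (forall d, C d -> C' d) -> C' c ->
  (forall a j, C' (inl (Uc a j)) = C' (inl (Uc a.+1 j))) ->
  (forall a j, C' (inr (a, j)) = C' (inr (a.+1, j))) ->
  smooth_fun_of C' w0 (fun w => sig w c).
Proof.
move=> CC; have CC0 d : C0 d -> C' d by move=> /unshiftedW/CC.
case: c => [[[|b] j|i|a j]|[a j]] Cc uS vS /=.
- by apply: (sf_sub CC0); apply: sf_xu_chart; exact: sys_g_smooth.
- by apply: sf_coord => /=; exact: CC.
- by apply: (sf_sub CC0); apply: sf_xu_chart; exact: sys_f_smooth.
- by apply: sf_coord; rewrite -uS.
- by apply: sf_coord; rewrite -vS.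
Qed.

Lemma sf_vshift_all c : smooth_fun_of predT w0 (fun w => sig w c).
Proof. exact: sf_vshift. Qed.

Lemma sf_iter_vshift a (C' : pred vcoord) c : (forall d, C d -> C' d) -> C' c ->
  (forall a j, C' (inl (Uc a j)) = C' (inl (Uc a.+1 j))) ->
  (forall a j, C' (inr (a, j)) = C' (inr (a.+1, j))) ->
  smooth_fun_of C' w0 (fun w => iter a sig w c).
Proof.
move=> CC Cc uS vS.
suff : smooth_fun_of C' w0 (fun w => iter a sig w c) /\
  forall d, smooth_fun_of predT w0 (fun w => iter a sig w d) by case.
elim: a c Cc => [|a IH] c Cc; first by split=> [|d]; exact: sf_coord.
have cts d : {for w0, continuous (fun w => iter a sig w d)}.
  by have [_ /(_ d)/sf_cts] := IH c Cc.
split=> [|d] /=.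
  apply: (sf_comp (C := C') (H := fun w => sig w c)) => //.
    by rewrite iter_vshift_w0; exact: sf_vshift.
  by move=> d Cd; have [] := IH d Cd.
apply: (sf_comp (C := predT) (H := fun w => sig w d)) => //.
  by rewrite iter_vshift_w0; exact: sf_vshift_all.
by move=> e _; have [_] := IH c Cc.
Qed.

Lemma sf_iter_vshift_all a c : smooth_fun_of predT w0 (fun w => iter a sig w c).
Proof. exact: sf_iter_vshift. Qed.

Lemma sf_iter_vshift_vars a c : C c -> smooth_fun_of C w0 (fun w => iter a sig w c).
Proof. by move=> Cc; exact: sf_iter_vshift. Qed.

Lemma cts_iter_vshift a : {for w0, continuous (iter a sig)}.
Proof. by apply: into_ptws_cts => c; exact: sf_cts (sf_iter_vshift_all a c). Qed.

Lemma near_vshift a (P : vpt -> Prop) : (\forall w \near w0, P w) ->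
  \forall w \near w0, P (iter a sig w).
Proof.
by move=> nP; apply: (near_comp (P := P) (@cts_iter_vshift a)); rewrite iter_vshift_w0.
Qed.

Lemma sf_inv_chart c : smooth_fun_of C w0 (fun w => Inv w c).
Proof.
case: c => [b j|i|a j] /=; try by exact: sf_coord.
apply: (sf_comp (C := C) (H := fun w => U0 w j)).
- by rewrite iter_vshift_w0; apply: sf_U0; exact: unshiftedW.
- by move=> c; exact: sf_cts (sf_iter_vshift_all a c).
- by move=> c Cc; exact: sf_iter_vshift_vars.
Qed.

Lemma cts_inv_chart : {for w0, continuous Inv}.
Proof. by apply: into_ptws_cts => c; exact: sf_cts (sf_inv_chart c). Qed.

Lemma near_inv_chart (P : traj -> Prop) : (\forall p \near p0, P p) ->
  \forall w \near w0, P (Inv w).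
Proof.
by move=> nP; apply: (near_comp (P := P) cts_inv_chart); rewrite inv_chart_w0.
Qed.

Lemma near_chart (P : vpt -> Prop) : (\forall w \near w0, P w) ->
  \forall p \near p0, P (Y p).
Proof. by move=> nP; exact: (near_comp (P := P) (@cts_chart (kap r)) nP). Qed.

Lemma inv_chartK c : \forall p \near p0, Inv (Y p) c = p c.
Proof.
case: c => [b j|i|a j]; try by apply: near_all.
apply: (nearS2 _ (chart_iter_shift a) (near_shift a (ch_inv cU))) => p E Up /=.
rewrite -E Up.
suff Ei b : iter a sh p (Uc b j) = p (Uc (b + a) j) by rewrite Ei.
by elim: a {E Up} b => [|a IH] b /=; rewrite ?addn0 // IH addSnnS.
Qed.

(** The whole trajectory is reconstructed smoothly from the new coordinates, so
they serve to express any function of it. *)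
Lemma sf_of_chart h : sm h -> smooth_fun_of C w0 (fun w => h (Inv w)).
Proof.
move=> sh'; apply: (sf_comp (C := predT) (H := h)).
- by rewrite inv_chart_w0.
- by move=> c; exact: sf_cts (sf_inv_chart c).
- by move=> c _; exact: sf_inv_chart.
Qed.

Lemma of_chartK h : sm h -> \forall p \near p0, h (Inv (Y p)) = h p.
Proof.
move=> sh'; have cIY : {for p0, continuous (fun p => Inv (Y p))}.
  exact: cts_comp erefl (@cts_chart (kap r)) cts_inv_chart.
apply: (sf_agree (C := predT) (X := fun p => Inv (Y p)) (X' := fun p => p)).
- by rewrite inv_chart_w0.
- by rewrite inv_chart_w0.
- exact: cIY.
- exact: cvg_id.
- by move=> c _; exact: inv_chartK.
Qed.

Lemma expr_by_chart h : sm h -> expr_by Y C p0 h.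
Proof.
move=> sh'; exists (fun w => h (Inv w)); split; first exact: sf_of_chart.
by apply: nearS (of_chartK sh') => p ->.
Qed.

(** y^j_[k-1] is a function of zeta, x and v by assumption, and one more shift
introduces the inputs only through x^+ and zeta_[-1]^+, hence without shifts. *)
Lemma first_order_unshifted j k :
  (forall k', (k' < k)%N -> depends_only_zxv sys q1 phi r (y j k')) ->
  (forall c, zxv_vars q1 r c -> \forall w \near w0, Y (Inv w) c = w c) ->
  smooth_fun_of C0 w0 (fun w => y j k (Inv w)).
Proof.
move=> dep YI; case: k dep => [_|k /(_ k (ltnSn k)) [E [sE EY]]].
  apply: (sf_comp (C := @zxu_vars n m q1) (H := phi j)).
  - by rewrite inv_chart_w0; have [sp _ _] := fo.
  - by move=> c; exact: sf_cts (sf_inv_chart c).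
  - case=> [b l|i|a l] /= cz; try by exact: sf_coord.
    by rewrite (eqP cz) /=; exact: sf_U0.
apply: (sf_ext (H := fun w => E (sig w))); last first.
  apply: (sf_comp (C := zxv_vars q1 r) (H := E)).
  - by rewrite vshift_w0.
  - by move=> c; exact: sf_cts (sf_vshift_all c).
  - exact: sf_vshift_zxv.
(* E represents the previous order; both equations are used after one shift. *)
have n1 : \forall w \near w0, y j k (Inv w) = E (Y (Inv w)) := near_inv_chart EY.
have cYI : {for w0, continuous (fun w => Y (Inv w))}.
  exact: cts_comp inv_chart_w0 cts_inv_chart (@cts_chart (kap r)).
have n2 : \forall w \near w0, E (Y (Inv w)) = E w.
  apply: (sf_agree (C := zxv_vars q1 r) (X := fun w => Y (Inv w)) (X' := fun w => w)).
  - by rewrite inv_chart_w0.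
  - by rewrite inv_chart_w0.
  - exact: cYI.
  - exact: cvg_id.
  - exact: YI.
apply: (nearS2 _ (near_vshift 1 n1) (near_vshift 1 n2)) => w /= e1 e2.
by rewrite -e2 -e1 /fshift iterSr shift_inv_chart.
Qed.

End Chart0.

(** The second half says that v may be prescribed arbitrarily near its value at
the equilibrium: the coordinates are independent. *)
Definition charted r U0 := input_map r U0 /\
  forall j, j \in outs r -> \forall w \near ch r p0,
    y j (kap r j) (inv_chart U0 w) = w (inr (0%N, j)).

Section Charted.
Variables (r : seq (step m)) (U0 : vpt -> 'I_m -> F).
Hypothesis cU : charted r U0.
Local Notation Y := (ch r).
Local Notation w0 := (ch r p0).
Local Notation Inv := (inv_chart U0).
Local Notation C := (@chart_vars n m r).
Local Notation C0 := (unshifted_vars r).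

Lemma chartK c : C c -> \forall w \near w0, Y (Inv w) c = w c.
Proof.
have [c0 cv] := cU.
case: c => [[b j|i|a j]|[a j]] /= Cc; try by apply: near_all.
  apply: near_all => w; rewrite (ch_rest c0) //.
  by rewrite iter_vshift_u.
apply: nearS (near_vshift c0 a (cv j Cc)) => w; rewrite /fshift => E.
by rewrite iterD iter_shift_inv_chart E iter_vshift_inr.
Qed.

Lemma cts_chart_inv : {for w0, continuous (fun w => Y (Inv w))}.
Proof.
have [c0 _] := cU.
exact: cts_comp (inv_chart_w0 c0) (cts_inv_chart c0) (@cts_chart (kap r)).
Qed.

(** The coordinates of trajectories fill a neighbourhood of w0, which determines
the representation. *)
Lemma chart_repr_unique h H : smooth_fun_of C w0 H ->
  (\forall p \near p0, h p = H (Y p)) -> \forall w \near w0, H w = h (Inv w).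
Proof.
move=> sH hH; have [c0 _] := cU.
have n1 := near_inv_chart c0 hH.
have n2 : \forall w \near w0, H (Y (Inv w)) = H w.
  apply: (sf_agree (C := C) (X := fun w => Y (Inv w)) (X' := fun w => w)).
  - by rewrite inv_chart_w0.
  - by rewrite inv_chart_w0.
  - exact: cts_chart_inv.
  - exact: cvg_id.
  - exact: chartK.
by apply: (nearS2 _ n1 n2) => w -> ->.
Qed.

Lemma first_order_charted j k :
  (forall k', (k' < k)%N -> depends_only_zxv sys q1 phi r (y j k')) ->
  smooth_fun_of C0 w0 (fun w => y j k (Inv w)).
Proof.
have [c0 _] := cU.
move=> dep; apply: first_order_unshifted => // c zc; apply: chartK.
exact/unshifted_chart_vars/zxv_unshifted.
Qed.

(** Composed with [inv_chart], the coordinate functions become coordinates. *)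
Lemma indep_chart (I : finType) (f : I -> vcoord) : injective f -> (forall i, C (f i)) ->
  indep (fun i => dif p0 (fun p => Y p (f i))).
Proof.
move=> fi Cf a a0 i; have [c0 _] := cU.
pose K p := \sum_i a i * Y p (f i).
have sK : sm K by apply: sf_sum => l; exact: sf_chart.
have dK : dif p0 K = 0 by rewrite (dif_sum _ _ (fun l => sf_chart (kap r) (f l))).
have sK' : smooth_fun_of predT (Inv w0) K by rewrite inv_chart_w0.
have [s [_ _ /nbhs_singleton chn]] := chain_near sK' (fun c => sf_cts (sf_inv_chart c0 c))
  (fun c _ => sf_sub (fun _ _ => isT) (sf_inv_chart c0 c)).
have KI : \forall w \near w0, K (Inv w) = \sum_i a i * w (f i).
  have : \forall w \near w0, forall i, Y (Inv w) (f i) = w (f i).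
    by apply: near_forall => l; exact: chartK.
  by apply: nearS => w E; apply: eq_bigr => l _; rewrite E.
have : pder (f i) (fun w => K (Inv w)) w0 = 0.
  rewrite chn big1 // => c _; rewrite inv_chart_w0 //.
  by rewrite -[pder c K p0]/(dif p0 K c) dK mul0r.
have sc l : smooth_fun_of predT w0 (fun w => w (f l)) by exact: sf_coord.
rewrite (pder_near _ KI) (pder_sum _ _ _ sc).
rewrite (bigD1 i) //= pder_coord eqxx mulr1 big1 ?addr0 // => l li.
by rewrite pder_coord (inj_eq fi) eq_sym (negbTE li) mulr0.
Qed.

End Charted.
End Charts.

(** * One step of the procedure *)
Lemma cast_unitmx (F : fieldType) k l (e : k = l) (A : 'M[F]_(k, l)) :
  \rank A = k -> (\matrix_(i, j) A i (cast_ord e j) : 'M[F]_k) \in unitmx.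
Proof.
case: _ / e A => A rA.
rewrite (_ : (\matrix_(i, j) _) = A); first by rewrite -row_free_unit /row_free rA.
by apply/matrixP => i j; rewrite mxE cast_ord_id.
Qed.

Section Steps.
Variable m : nat.
Implicit Types (r : seq (step m)) (st : step m).

Lemma outs_cat r r' : outs (r ++ r') = outs r :|: outs r'.
Proof. by rewrite /outs big_cat. Qed.
Lemma outs_cons st r : outs (st :: r) = st_out st :|: outs r.
Proof. by rewrite /outs big_cons. Qed.
Lemma outs_rcons r st : outs (rcons r st) = outs r :|: st_out st.
Proof. by rewrite -cats1 outs_cat /outs big_seq1. Qed.
Lemma ins_rcons r st : ins (rcons r st) = ins r :|: st_in st.
Proof. by rewrite -cats1 /ins big_cat big_seq1. Qed.
Lemma outs_nil : outs ([::] : seq (step m)) = finset.set0.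
Proof. by rewrite /outs big_nil. Qed.
Lemma ins_nil : ins ([::] : seq (step m)) = finset.set0.
Proof. by rewrite /ins big_nil. Qed.

Lemma mem_outs_split r j : j \in outs r ->
  exists r1 st r2, r = r1 ++ st :: r2 /\ j \in st_out st.
Proof.
elim: r => [|st r IH]; first by rewrite outs_nil inE.
rewrite outs_cons inE => /orP[js|/IH [r1 [st' [r2 [-> js]]]]].
  by exists [::], st, r.
by exists (st :: r1), st', r2.
Qed.

Lemma kap_notin r j : j \notin outs r -> kap r j = 0%N.
Proof.
elim: r => //= st r IH; rewrite outs_cons !inE negb_or => /andP[/negbTE -> /IH].
by [].
Qed.

Lemma kap_cat r r' j : kap (r ++ r') j = if j \in outs r then kap r j else kap r' j.
Proof.
elim: r => [|st r IH] /=; first by rewrite outs_nil inE.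
by rewrite outs_cons inE IH; case: (j \in st_out st).
Qed.

Lemma kap_rcons r st j : kap (rcons r st) j =
  if j \in outs r then kap r j else if j \in st_out st then st_K st j else 0%N.
Proof. by rewrite -cats1 kap_cat. Qed.

End Steps.

Section Runs.
Variables (F : realType) (n m : nat) (sys : dtsystem F n m).
Local Notation p0 := (eq_traj sys).
Local Notation traj := (traj F n m).
Local Notation vcoord := (vcoord n m).
Local Notation vpt := {ptws vcoord -> F}.
Variables (q1 : nat) (phi : 'I_m -> traj -> F) (R : 'I_m -> nat).
Hypothesis fo : flat_output sys q1 phi R.
Local Notation y j a := (fshift sys a (phi j)).
Local Notation ch r := (chart sys phi (kap r)).
Local Notation charted r := (charted sys q1 phi r).

Lemma charted_nil : exists U0, charted [::] U0.
Proof.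
exists (fun w j => w (inl (Uc 0 j))); split; last by move=> j; rewrite outs_nil inE.
split.
- by move=> w w' j; apply; rewrite /= ins_nil inE.
- by move=> j; apply: sf_coord; rewrite /= ins_nil inE.
- by [].
- by apply: near_all.
Qed.

(** The coordinates u_i ([cc]) are exchanged for v_i ([dd]), where v_i is given by
the functions [Hf] in the old coordinates. *)
Section OneStep.
Variables (r : seq (step m)) (st : step m) (U0 : vpt -> 'I_m -> F).
Hypothesis cU : charted r U0.
Hypothesis sst : is_step sys q1 phi r st.
Local Notation r' := (rcons r st).
Local Notation w0 := (ch r p0).
Local Notation w1 := (ch r' p0).
Local Notation Inv := (inv_chart sys U0).
Local Notation K := (st_K st).
Local Notation C0 := (unshifted_vars q1 r).

Let io : #|st_out st| = #|st_in st|.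
Proof. by case: sst => _ _ _ [_ e] _; exact: esym. Qed.

Let outN j : j \in st_out st -> j \notin outs r.
Proof. by case: sst => _ _ /fintype.subsetP s _ _ /s; rewrite inE. Qed.
Let inN j : j \in st_in st -> j \notin ins r.
Proof. by case: sst => _ _ _ [/fintype.subsetP s _] _ /s; rewrite inE. Qed.

Let fout (i : 'I_#|st_out st|) : 'I_m := enum_val i.
Let fin (i : 'I_#|st_out st|) : 'I_m := enum_val (cast_ord io i).
Let cc i : vcoord := inl (Uc 0 (fin i)).
Let dd i : vcoord := inr (0%N, fout i).
Let Hf i (w : vpt) := y (fout i) (K (fout i)) (Inv w).

Let fout_out i : fout i \in st_out st. Proof. exact: enum_valP. Qed.
Let fin_in i : fin i \in st_in st. Proof. exact: enum_valP. Qed.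
Let foutP j : j \in st_out st -> exists i, j = fout i.
Proof. by move=> jo; exists (enum_rank_in jo j); rewrite /fout enum_rankK_in. Qed.
Let finP j : j \in st_in st -> exists i, j = fin i.
Proof.
move=> ji; exists (cast_ord (esym io) (enum_rank_in ji j)).
by rewrite /fin cast_ordKV enum_rankK_in.
Qed.

Let cci : injective cc.
Proof. by move=> i j [/enum_val_inj/cast_ord_inj]. Qed.
Let ddi : injective dd.
Proof. by move=> i j [/enum_val_inj]. Qed.
Let Ccc i : C0 (cc i).
Proof. by rewrite /= inN ?fin_in. Qed.
Let Cdd i : ~~ C0 (dd i).
Proof. by rewrite /= outN ?fout_out. Qed.

Let ccP j : inl (Uc 0 j) \in codom cc = (j \in st_in st).
Proof.
apply/codomP/idP => [[i [->]]|/finP [i ->]]; first exact: fin_in.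
by exists i.
Qed.

Let sHf i : smooth_fun_of C0 w0 (Hf i).
Proof.
have [_ fs _ _ _] := sst; have [fo1 _] := fs _ (outN (fout_out i)).
exact: (first_order_charted fo cU fo1).
Qed.

Let Hrank : (\matrix_(i, j) pder (cc j) (Hf i) w0 : 'M[F]_#|st_out st|) \in unitmx.
Proof.
have [_ _ _ _ [H Hr /nbhs_singleton [_ rk]]] := sst.
have := cast_unitmx io rk.
rewrite (_ : (\matrix_(i, j) _) = \matrix_(i, j) pder (cc j) (Hf i) w0) //.
apply/matrixP => i j; rewrite !mxE.
have [sH HE] := Hr _ (outN (fout_out i)).
exact: pder_near (chart_repr_unique fo cU sH HE).
Qed.

Let kapr j : j \in outs r -> kap r' j = kap r j.
Proof. by rewrite kap_rcons => ->. Qed.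
Let kapK j : j \in st_out st -> kap r' j = K j.
Proof. by move=> jo; rewrite kap_rcons (negbTE (outN jo)) jo. Qed.

Let w1C p e : C0 e -> e \notin codom cc -> ch r' p e = ch r p e.
Proof. by case: e => [//|[a j]] /= jo _; rewrite kapr. Qed.

Let w1d p i : ch r' p (dd i) = y (fout i) (K (fout i)) p.
Proof. by rewrite /= kapK ?fout_out // addn0. Qed.

(** The new input map is U1 = U0 o [down], where [down] solves for u_i.  To
compare the reconstructed trajectories, [Th] transports all the new coordinates
to old ones, the shifted inputs u_i,[a] being [down] after a shifts.  It
intertwines the two versions of [vshift] on the coordinates which matter, so
both reconstructions give the same trajectory. *)
Lemma charted_step : exists U1, charted r' U1.
Proof.
have [c0 cv] := cU.
have w1d0 i : w1 (dd i) = Hf i w0 by rewrite w1d /Hf (inv_chart_w0 c0).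
have [T [sT exT upT down1 downT]] :=
  implicit_exchange cci ddi Ccc Cdd sHf Hrank (w1C p0) w1d0.
set down := exch_down C0 w0 cc T in down1 downT.
have exv e : exch_vars C0 cc dd e -> unshifted_vars q1 r' e.
  rewrite /exch_vars => /orP[/andP[]|/codomP [i ->]]; last first.
    by rewrite /= outs_rcons inE fout_out orbT.
  case: e => [[b j|i|a j]|[a j]] //=.
    move=> /andP[/eqP -> jr]; rewrite ccP => ji.
    by rewrite ins_rcons inE negb_or jr ji.
  by rewrite outs_rcons inE => ->.
have downN w e : C0 e -> e \notin codom cc -> down w e = w e.
  move=> Ce ec; rewrite /down /exch_down; case: pickP => [i /eqP E|_]; last by rewrite Ce.
  by rewrite -E codom_f in ec.
have downC w i : down w (cc i) = T i w.
  rewrite /down /exch_down; case: pickP => [j /eqP/cci -> //|/(_ i)].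
  by rewrite eqxx.
have sdown e (C' : pred vcoord) : (forall e, exch_vars C0 cc dd e -> C' e) ->
    smooth_fun_of C' w1 (fun w => down w e).
  move=> eC; rewrite /down /exch_down; case: pickP => [i _|ne].
    exact: sf_sub eC (sT i).
  have [Ce|_] := boolP (C0 e); last exact: sf_cst.
  apply: sf_coord; apply: eC; rewrite /exch_vars Ce /=; apply/orP; left.
  by apply/negP => /codomP [i E]; have := ne i; rewrite -E eqxx.
have cdown : {for w1, continuous down}.
  by apply: into_ptws_cts => e; apply: sf_cts; exact: (sdown e predT).
pose U1 (w : vpt) j := U0 (down w) j.
have down_ex w w' : (forall e, unshifted_vars q1 r' e -> w e = w' e) ->
    forall e, C0 e -> down w e = down w' e.
  move=> ww e Ce; have [/codomP [i ->]|ec] := boolP (e \in codom cc).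
    by rewrite !downC; apply: exT => d /exv/ww.
  by rewrite !downN // ww // exv // /exch_vars Ce ec.
have c1 : input_map sys q1 phi r' U1.
  split.
  - by move=> w w' j ww; apply: (ch_exact c0) => e; exact: down_ex.
  - move=> j; apply: (sf_comp (C := C0) (H := fun w => U0 w j)).
    + by rewrite down1; exact: ch_smooth c0 j.
    + by move=> e; apply: sf_cts; exact: (sdown e predT).
    + by move=> e _; exact: sdown.
  - move=> w j; rewrite ins_rcons inE negb_or => /andP[jr ji].
    by rewrite /U1 (ch_rest c0) // downN ?ccP //= jr.
  - have n1 : \forall p \near p0, forall i, T i (exch_up dd Hf (ch r p)) = ch r p (cc i).
      exact: (near_chart fo upT).
    have n2 : \forall p \near p0, forall i, Hf i (ch r p) = y (fout i) (K (fout i)) p.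
      by apply: near_forall => i; apply: (of_chartK fo c0); exact: sf_y fo _ _.
    apply: (nearS2 _ (near_and n1 n2) (ch_inv c0)) => p [Tup HE] Up j.
    rewrite -Up; apply: (ch_exact c0) => e Ce.
    have [/codomP [i ->]|ec] := boolP (e \in codom cc); last by rewrite downN // w1C.
    rewrite downC -Tup; apply: exT => d /orP[/andP[Cd dc]|/codomP [l ->]].
      rewrite w1C // /exch_up; case: pickP => // l /eqP E.
      by have := Cdd l; rewrite E Cd.
    rewrite w1d /exch_up; case: pickP => [l' /eqP/ddi ->|/(_ l)]; first by rewrite HE.
    by rewrite eqxx.
exists U1; split=> //.
pose sig0 := vshift sys U0; pose sig1 := vshift sys U1.
pose Th (w : vpt) : vpt := fun c =>
  match c with
  | inl (Uc a j) => down (iter a sig1 w) (inl (Uc 0 j))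
  | inr (a, j) => if j \in outs r then w c else w0 c
  | _ => w c
  end.
have Th0 w e : C0 e -> Th w e = down w e.
  case: e => [[b j|i|a j]|[a j]] Ce.
  - by rewrite downN //; apply/codomP => -[l]; rewrite /cc.
  - by rewrite downN //; apply/codomP => -[l]; rewrite /cc.
  - by have := Ce; rewrite /= => /andP[/eqP -> _].
  - have jo : j \in outs r by exact: Ce.
    by rewrite /= jo downN //; apply/codomP => -[l]; rewrite /cc.
have U1Th w j : U1 w j = U0 (Th w) j.
  by apply: (ch_exact c0) => e Ce; rewrite Th0.
have ThS w e : chart_vars r e -> sig0 (Th w) e = Th (sig1 w) e.
  have xuE : xu_chart U0 (Th w) = xu_chart U1 w.
    by congr row_mx; apply/rowP => i; rewrite !mxE ?U1Th.
  case: e => [[[|b] j|i|a j]|[a j]] //= Ce.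
  - by rewrite xuE.
  - by rewrite xuE.
  - by rewrite -iterSr.
  - by rewrite Ce.
have sig0C w w' : (forall e, chart_vars r e -> w e = w' e) ->
    forall e, chart_vars r e -> sig0 w e = sig0 w' e.
  move=> ww; have xuE : xu_chart U0 w = xu_chart U0 w'.
    congr row_mx; apply/rowP => i; rewrite !mxE; first by apply: ww.
    by apply: (ch_exact c0) => e Ce; apply/ww/(unshifted_chart_vars Ce).
  by case=> [[[|b] j|i|a j]|[a j]] //= Ce; rewrite ?xuE //; apply: ww.
have ThI a w e : chart_vars r e -> iter a sig0 (Th w) e = Th (iter a sig1 w) e.
  elim: a e => [|a IH] e Ce //=.
  by rewrite (sig0C _ (Th (iter a sig1 w))) // ThS.
have InvTh w : Inv (Th w) = inv_chart sys U1 w.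
  apply/funext => -[b j|i|a j] //=.
  rewrite U1Th; apply: (ch_exact c0) => e Ce; apply: ThI; exact: unshifted_chart_vars Ce.
have Th1 : Th w1 = w0.
  apply/funext => -[[b j|i|a j]|[a j]] //=.
    by rewrite (iter_vshift_w0 c1) down1.
  by case: ifP => // jo; rewrite kapr.
have cTh : {for w1, continuous Th}.
  apply: into_ptws_cts => -[[b j|i|a j]|[a j]] /=; try exact: eval_cts.
    have cs := cts_iter_vshift c1 (a := a).
    apply: (cts_comp (f := iter a sig1) (g := fun w => down w (inl (Uc 0 j))) _ cs).
      exact: (iter_vshift_w0 c1).
    by apply: sf_cts; exact: (sdown _ predT).
  by case: (j \in outs r); [exact: eval_cts|exact: cst_continuous].
move=> j; rewrite outs_rcons inE => /orP[jo|jo].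
  have n1 := near_comp (P := fun w => y j (kap r j) (Inv w) = w (inr (0%N, j))) cTh.
  rewrite Th1 in n1; have := n1 (cv j jo); apply: nearS => w.
  by rewrite InvTh kapr // => ->; rewrite /= jo.
have [i ji] := foutP jo.
have n1 : \forall w \near w1, Hf i (Th w) = Hf i (down w).
  apply: (sf_agree (C := C0)) => //.
  - by rewrite Th1; exact: sHf.
  - by rewrite Th1 down1.
  - by move=> e Ce; apply: near_all => w; exact: Th0.
apply: (nearS2 _ n1 downT) => w e1 e2.
by rewrite kapK // -InvTh; have := e2 i; rewrite -e1 /Hf /dd -ji.
Qed.

End OneStep.

Lemma charted_run r : is_run sys q1 phi r -> exists U0, charted r U0.
Proof.
elim=> [|{}r st _ [U0 cU] sst]; first exact: charted_nil.
exact: charted_step cU sst.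
Qed.

End Runs.

(** * Existence of first orders and termination *)
Section Minors.
Variable F : fieldType.

(** A maximal set of independent rows, and then of columns. *)
Lemma exists_minor a b (M : 'M[F]_(a, b)) :
  exists (f : 'I_(\rank M) -> 'I_a) (g : 'I_(\rank M) -> 'I_b),
    [/\ injective f, injective g & (\matrix_(i, j) M (f i) (g j)) \in unitmx].
Proof.
pose f := maxrankfun M; pose B := rowsub f M.
have rB : row_full B^T by rewrite /row_full mxrank_tr; exact: maxrowsub_free.
exists f, (fullrankfun rB); split.
- exact: maxrankfun_inj.
- exact: fullrankfun_inj.
- rewrite -unitmx_tr (_ : _^T = rowsub (fullrankfun rB) B^T).
    exact: fullrowsub_unit.
  by apply/matrixP => i j; rewrite !mxE.
Qed.

Lemma mxrank_minor a b k l (M : 'M[F]_(a, b)) (f : 'I_k -> 'I_a) (g : 'I_l -> 'I_b) :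
  (\rank (\matrix_(i, j) M (f i) (g j)) <= \rank M)%N.
Proof.
rewrite (_ : (\matrix_(i, j) _) = (rowsub g (rowsub f M)^T)^T); last first.
  by apply/matrixP => i j; rewrite !mxE.
rewrite mxrank_tr; have h1 := mxrankS (rowsub_sub g (rowsub f M)^T).
have h2 := mxrankS (rowsub_sub f M); rewrite mxrank_tr in h1.
exact: leq_trans h1 h2.
Qed.

End Minors.

Lemma setI0_subC (T : finType) (A B : {set T}) : B \subset ~: A ->
  A :&: B = finset.set0.
Proof.
move=> BA; apply/setP => x; rewrite !inE; apply/negP => /andP[xA xB].
by have := fintype.subsetP BA x xB; rewrite inE xA.
Qed.

Section Clauses.
Variables (F : realType) (n m : nat) (sys : dtsystem F n m).
Local Notation p0 := (eq_traj sys).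
Local Notation traj := (traj F n m).
Local Notation vcoord := (vcoord n m).
Variables (q1 : nat) (phi : 'I_m -> traj -> F) (R : 'I_m -> nat).
Hypothesis fo : flat_output sys q1 phi R.
Local Notation y j a := (fshift sys a (phi j)).
Local Notation ch r := (chart sys phi (kap r)).
Local Notation charted r := (charted sys q1 phi r).
Local Notation dy_set := (dy_set sys phi).

Lemma is_run_rcons_inv r st : is_run sys q1 phi (rcons r st) ->
  is_run sys q1 phi r /\ is_step sys q1 phi r st.
Proof.
move: {-1}(rcons r st) (erefl (rcons r st)) => x xE rx.
case: rx xE => [|r' st' rr' ss' /rcons_inj [-> ->]] //.
by move=> /(congr1 size); rewrite size_rcons.
Qed.

Lemma is_run_cat r r' : is_run sys q1 phi (r ++ r') -> is_run sys q1 phi r.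
Proof.
elim/last_ind: r' => [|r' st IH]; first by rewrite cats0.
by rewrite -rcons_cat => /is_run_rcons_inv [/IH].
Qed.

Lemma is_run_split r st r' : is_run sys q1 phi (r ++ st :: r') ->
  is_run sys q1 phi r /\ is_step sys q1 phi r st.
Proof. by rewrite -cat_rcons => /is_run_cat/is_run_rcons_inv. Qed.

Lemma depends_span r h : depends_only_zxv sys q1 phi r h ->
  span (dzx_set p0 q1 `|` dy_set (fun _ l => l \in outs r)) (dif p0 h).
Proof.
move=> dep.
have := nbhs_singleton (expr_by_span dep (fun c => sf_cts (sf_chart fo (kap r) c))
  (fun c _ => sf_chart fo (kap r) c)).
apply: span_sub => _ [[[b j|i|//]|[a j]] /= cz <-].
- by left; exists (Zeta b j).
- by left; exists (Xc i).
- by right; exists ((kap r j + a)%N, j).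
Qed.

(** Otherwise dy^j_[k] would be a combination of dzeta, dx and the dy^l with l
already selected. *)
Lemma depends_lt r j k : j \notin outs r -> depends_only_zxv sys q1 phi r (y j k) ->
  (k < R j)%N.
Proof.
move=> jr dep; rewrite ltnNge; apply/negP => Rk.
apply: (dy_notin_dzx fo (q := q1) Rk).
apply: span_sub (depends_span dep) => v [|[[a l] /= lr <-]]; first by left.
right; exists (a, l) => //=; apply: contraNneq jr => -[_ <-].
exact: lr.
Qed.

Lemma exists_first_order r j : j \notin outs r ->
  exists k, first_order sys q1 phi r j k.
Proof.
move=> jr.
have ex : exists k, `[< ~ depends_only_zxv sys q1 phi r (y j k) >].
  by exists (R j); apply/asboolP => /(depends_lt jr); rewrite ltnn.
exists (ex_minn ex); case: ex_minnP => k /asboolP nk kmin; split=> // k' k'k.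
apply: contrapT => nk'; have : (k <= k')%N by apply: kmin; apply/asboolP.
by rewrite leqNgt k'k.
Qed.

Lemma exists_repr r : is_run sys q1 phi r ->
  exists Ki H, first_orders sys q1 phi r Ki /\ coord_repr sys phi r Ki H.
Proof.
move=> /(charted_run fo) [U0 [c0 cv]].
have /choice [Ki KP] : forall j, exists k, j \notin outs r -> first_order sys q1 phi r j k.
  move=> j; have [jr|jr] := boolP (j \in outs r); first by exists 0%N.
  by have [k kP] := exists_first_order jr; exists k.
exists Ki, (fun j w => y j (Ki j) (inv_chart sys U0 w)); split=> // j jr; split.
  by apply: (sf_of_chart c0); exact: sf_y fo _ _.
by apply: nearS (of_chartK fo c0 (sf_y fo j (Ki j))) => p ->.
Qed.

Lemma outs_neqT r : outs r != [set: 'I_m]%SET -> exists j, j \notin outs r.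
Proof.
move=> ro; apply: contrapT => ne; case/eqP: ro; apply/setP => j; rewrite inE.
by apply: contraT => jr; case: ne; exists j.
Qed.

(** If all derivatives with respect to u_rest vanish near the equilibrium, then
y^j_[k] depends only on zeta, x and v, and k is not its first order. *)
Lemma rank_pos r U0 Ki H : charted r U0 -> outs r != [set: 'I_m]%SET ->
  first_orders sys q1 phi r Ki -> coord_repr sys phi r Ki H ->
  ~ \forall p \near p0, \rank (jac_u H (~: outs r) (~: ins r) (ch r p)) = 0%N.
Proof.
move=> cU /outs_neqT [j jr] fK cr r0; have [c0 cv] := cU.
have [dep ndep] := fK j jr; have [sH HE] := cr j jr.
set w0 := ch r p0 in sH; set k := Ki j in dep ndep HE.
pose H' w := y j k (inv_chart sys U0 w).
have sH' : smooth_fun_of (unshifted_vars q1 r) w0 H' by exact: (first_order_charted fo cU dep).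
have HH' := chart_repr_unique fo cU sH HE.
have D0 l : l \notin ins r -> \forall w \near w0, pder (inl (Uc 0 l) : vcoord) H' w = 0.
  move=> lr; set c : vcoord := inl (Uc 0 l).
  have n1 : \forall p \near p0, pder c (H j) (ch r p) = 0.
    apply: nearS r0 => p /eqP; rewrite mxrank_eq0 => /eqP J0.
    have jA : j \in ~: outs r by rewrite inE.
    have lB : l \in ~: ins r by rewrite inE.
    have := congr1 (fun M : 'M[F]_(_, _) => M (enum_rank_in jA j) (enum_rank_in lB l)) J0.
    by rewrite !mxE !enum_rankK_in.
  have n2 := near_inv_chart c0 n1.
  have n3 : \forall w \near w0, pder c (H j) (ch r (inv_chart sys U0 w)) = pder c (H j) w.
    apply: (sf_agree (C := @chart_vars n m r) (X := fun w => ch r (inv_chart sys U0 w))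
      (X' := fun w => w)).
    - by rewrite (inv_chart_w0 c0); exact: sf_pder.
    - by rewrite (inv_chart_w0 c0).
    - exact: (cts_chart_inv fo cU).
    - exact: cvg_id.
    - by move=> e; exact: (chartK cU).
  apply: (nearS2 _ (near_and n2 n3) (near_near HH')) => w [e1 e2] e3.
  by rewrite -(pder_near c e3) -e2 e1.
apply: ndep; exists H'; split; last first.
  by apply: nearS (of_chartK fo c0 (sf_y fo j k)) => p E; exact: esym E.
apply: sf_drop sH' _ => -[[b l|i|a l]|[a l]] //= => [->//|/andP[/eqP -> lr] _|->//].
exact: D0.
Qed.

Lemma step_nonempty r st : is_run sys q1 phi r -> is_step sys q1 phi r st ->
  (0 < #|st_out st|)%N.
Proof.
move=> /(charted_run fo) [U0 cU] [ro fK _ _ [H cr rk]]; rewrite lt0n; apply/eqP => s0.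
apply: (rank_pos cU ro fK cr); apply: nearS rk => p [-> _].
exact: s0.
Qed.

Lemma run_size r : is_run sys q1 phi r -> (size r <= #|outs r|)%N /\ #|ins r| = #|outs r|.
Proof.
elim=> [|{}r st rr [IH IH2] ss]; first by rewrite outs_nil ins_nil cards0.
have ne := step_nonempty rr ss; have [_ _ so [si sio] _] := ss.
have dj := setI0_subC so; have dji := setI0_subC si.
rewrite size_rcons outs_rcons ins_rcons !cardsU.
rewrite dj dji cards0 !subn0 IH2 sio; split=> //.
by rewrite -addn1 leq_add.
Qed.

Lemma run_size_le r : is_run sys q1 phi r -> (size r <= m)%N.
Proof.
move=> /run_size [/leq_trans -> //].
by rewrite -[X in (_ <= X)%N](card_ord m) max_card.
Qed.

(** An invertible minor at the equilibrium selects the components and the inputs.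
It stays invertible nearby, so both ranks equal its size there if the full rank
is constant. *)
Lemma extend_run r : constant_ranks sys q1 phi -> is_run sys q1 phi r ->
  outs r != [set: 'I_m]%SET -> exists st, is_step sys q1 phi r st.
Proof.
move=> cr rr ro.
have [Ki [H [fK cH]]] := exists_repr rr.
have [rho rk] := cr r Ki H rr ro fK cH.
set A := ~: outs r in rk; set B := ~: ins r in rk.
have rk0 := nbhs_singleton rk.
have [f [g [fi gi fgu]]] := exists_minor (jac_u H A B (ch r p0)).
move: f g fi gi fgu; rewrite rk0 => f g fi gi fgu.
pose out := [set enum_val (f i) | i in 'I_rho]%SET.
pose inn := [set enum_val (g i) | i in 'I_rho]%SET.
have cout : #|out| = rho.
  by rewrite card_imset ?card_ord // => i j /enum_val_inj/fi.
have cinn : #|inn| = rho.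
  by rewrite card_imset ?card_ord // => i j /enum_val_inj/gi.
have fo_out i : enum_val (f i) \in out by apply: imset_f.
have go_in i : enum_val (g i) \in inn by apply: imset_f.
pose M (p : traj) : 'M[F]_rho := \matrix_(i, j) jac_u H A B (ch r p) (f i) (g j).
have nM : \forall p \near p0, M p \in unitmx.
  apply: near_unitmx => // i j.
  have jr : enum_val (f i) \notin outs r by have := enum_valP (f i); rewrite inE.
  have [sH _] := cH _ jr.
  have := cts_comp erefl (cts_chart fo (k := kap r))
    (sf_cts (sf_pder (inl (Uc 0 (enum_val (g j)))) sH)).
  rewrite (_ : (fun p => M p i j) = (fun p => pder (inl (Uc 0 (enum_val (g j))) : vcoord)
    (H (enum_val (f i))) (ch r p))) //.
  by apply/funext => p; rewrite !mxE.
exists (Step Ki out inn); split=> //=.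
- by apply/fintype.subsetP => j /imsetP [i _ ->]; exact: enum_valP.
- split; last by rewrite cout cinn.
  by apply/fintype.subsetP => j /imsetP [i _ ->]; exact: enum_valP.
- exists H => //; apply: (nearS2 _ rk nM) => p rkp Mp; split; first by rewrite rkp cout.
  apply/eqP; rewrite eqn_leq rank_leq_row /= [X in (X <= _)%N]cout.
  have := mxrank_unit Mp.
  rewrite (_ : M p = \matrix_(i, j) jac_u H out inn (ch r p)
     (enum_rank_in (fo_out i) (enum_val (f i))) (enum_rank_in (go_in j) (enum_val (g j)))).
    by move=> {1}<-; exact: mxrank_minor.
  by apply/matrixP => i j; rewrite !mxE !enum_rankK_in.
Qed.

Lemma complete_run r : constant_ranks sys q1 phi -> is_run sys q1 phi r ->
  exists r', is_complete_run sys q1 phi (r ++ r').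
Proof.
move=> cr.
have [k kr] := ubnP (m - #|outs r|)%N; elim: k r kr => // k IH r kr rr.
have [ro|ro] := eqVneq (outs r) [set: 'I_m]%SET.
  by exists [::]; rewrite cats0; split.
have [st ss] := extend_run cr rr ro.
have rr' : is_run sys q1 phi (rcons r st) by exact: run_rcons.
have [] := IH (rcons r st) _ rr'.
  rewrite outs_rcons; have ne := step_nonempty rr ss.
  have [_ _ so _ _] := ss.
  rewrite cardsU (setI0_subC so) cards0 subn0.
  have : (#|outs r| < m)%N.
    by rewrite -[X in (_ < X)%N](card_ord m) -cardsT proper_card // properT.
  by lia.
by move=> r' cr'; exists (st :: r'); rewrite -cat_rcons.
Qed.

End Clauses.

(** * Triangular form *)
Section Expr.
Variables (F : realType) (J I : eqType) (Y : {ptws J -> F} -> {ptws I -> F}).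
Variable p0 : {ptws J -> F}.

Lemma expr_sub (C C' : pred I) h : (forall c, C c -> C' c) ->
  expr_by Y C p0 h -> expr_by Y C' p0 h.
Proof. by move=> CC [H [sH HE]]; exists H; split=> //; exact: sf_sub sH. Qed.

Lemma expr_transfer (Y' : {ptws J -> F} -> {ptws I -> F}) (C : pred I) h :
  {for p0, continuous Y} -> (forall p c, C c -> Y p c = Y' p c) ->
  expr_by Y C p0 h -> expr_by Y' C p0 h.
Proof.
move=> cY YY [H [[N [t [G [Ct sG HG]]]] HE]].
have E p : \row_i Y p (t i) = \row_i Y' p (t i).
  by apply/rowP => i; rewrite !mxE YY.
exists (fun w => G (\row_i w (t i))); split.
  exists N, t, G; split=> //; first by rewrite -E.
  exact: near_all.
have n1 := near_comp (P := fun w => H w = G (\row_i w (t i))) cY HG.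
by apply: (nearS2 _ n1 HE) => p e1 e2; rewrite -E -e1.
Qed.

(** The substitutions for the single coordinates hold on neighbourhoods which
depend on the coordinate; [sf_agree] deals with this. *)
Lemma expr_comp (C : pred I) (Cx : pred J) k : {for p0, continuous Y} ->
  smooth_fun_of Cx p0 k -> (forall c, Cx c -> expr_by Y C p0 (fun p => p c)) ->
  expr_by Y C p0 k.
Proof.
move=> cY sk ex.
have /choice [H HP] : forall c, exists H : {ptws I -> F} -> F,
    smooth_fun_of C (Y p0) H /\ (H (Y p0) = p0 c /\
    (Cx c -> \forall p \near p0, p c = H (Y p))).
  move=> c; have [Cc|Cc] := boolP (Cx c).
    have [H [sH HE]] := ex c Cc; exists H; split=> //; split=> //.
    by rewrite -(nbhs_singleton HE).
  exists (fun=> p0 c); split; first exact: sf_cst.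
  by split.
pose X (w : {ptws I -> F}) : {ptws J -> F} := fun c => H c w.
have X0 : X (Y p0) = p0 by apply/funext => c; have [_ []] := HP c.
have sX c : smooth_fun_of C (Y p0) (fun w => X w c) by have [] := HP c.
have cX : {for Y p0, continuous X} by apply: into_ptws_cts => c; exact: sf_cts (sX c).
exists (fun w => k (X w)); split.
  apply: (sf_comp (C := Cx) (H := k)); first by rewrite X0.
    by move=> c; exact: sf_cts (sX c).
  by move=> c _; exact: sX.
apply: (sf_agree (C := Cx) (X := fun p => p) (X' := fun p => X (Y p))).
- exact: sk.
- exact: X0.
- exact: cvg_id.
- exact: cts_comp erefl cY cX.
- by move=> c Cc; have [_ [_ /(_ Cc)]] := HP c.
Qed.

End Expr.

Section Triangular.
Variables (F : realType) (n m : nat) (sys : dtsystem F n m).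
Local Notation p0 := (eq_traj sys).
Local Notation sh := (shift sys).
Local Notation traj := (traj F n m).
Local Notation sm := (smooth_fun_of predT p0).
Local Notation vcoord := (vcoord n m).

(** One step back in time, x and u_[0] are recovered from x and zeta_[-1] by the
local inverse of (f,g); the other coordinates move by one place. *)
Lemma backward_shift : exists Bk : traj -> traj,
  [/\ {for p0, continuous Bk}, Bk p0 = p0 & \forall p \near p0, sh (Bk p) = p].
Proof.
have [Psi [sPsi PK PK']] := sys_invertible sys.
set z0 := row_mx (sys_x0 sys) (sys_u0 sys) in sPsi PK PK'.
set Phi := (fun z => row_mx (sys_f sys z) (sys_g sys z)) in sPsi PK PK'.
pose xz (p : traj) : 'rV[F]_(n + m) :=
  row_mx (\row_i p (Xc i)) (\row_j p (Zeta 0 j)).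
have xz0 : xz p0 = Phi z0.
  rewrite /Phi /z0 -sys_equilibrium; congr row_mx; apply/rowP => i; by rewrite !mxE.
have Pz0 : Psi (Phi z0) = z0 := nbhs_singleton PK.
pose Bk (p : traj) : traj := fun c =>
  match c with
  | Zeta b j => p (Zeta b.+1 j)
  | Xc i => Psi (xz p) 0 (lshift m i)
  | Uc 0 j => Psi (xz p) 0 (rshift n j)
  | Uc a.+1 j => p (Uc a j)
  end.
have cxz : {for p0, continuous xz}.
  apply: row_cts => i; rewrite (_ : (fun p => _) = (fun p : traj =>
    p (match fintype.split i with inl i => Xc i | inr j => Zeta 0 j end))).
    exact: eval_cts.
  by apply/funext => p; rewrite !mxE; case: (fintype.split i) => k; rewrite mxE.
have cP i : {for p0, continuous (fun p => Psi (xz p) 0 i)}.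
  apply: (cts_comp (g := fun z : 'rV[F]_(n + m) => Psi z 0 i) xz0 cxz).
  exact: smooth_cts (smooth_at_coord i sPsi).
exists Bk; split.
- apply: into_ptws_cts => -[b j|i|[|a] j] /=; by [exact: eval_cts|exact: cP].
- apply/funext => -[b j|i|[|a] j] //=; rewrite xz0 Pz0 /z0.
    by rewrite row_mxEl.
  by rewrite row_mxEr.
- have n1 : \forall p \near p0, Phi (Psi (xz p)) = xz p.
    by apply: (near_comp (P := fun w => Phi (Psi w) = w) cxz); rewrite xz0.
  apply: nearS n1 => p E.
  have xuE : xu_of (Bk p) = Psi (xz p).
    rewrite -[RHS]hsubmxK; congr row_mx; apply/rowP => i; by rewrite !mxE.
  have [Ef Eg] := eq_row_mx E.
  apply/funext => -[[|b] j|i|a j] //=; rewrite xuE.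
    by rewrite Eg mxE.
  by rewrite Ef mxE.
Qed.

(** The shift is open at p0, having a continuous right inverse. *)
Lemma near_unshift q (P : traj -> Prop) :
  (\forall p \near p0, P (iter q sh p)) -> \forall p \near p0, P p.
Proof.
have [Bk [cB B0 shB]] := backward_shift.
elim: q P => [|q IH] P nP //; apply: IH.
have n1 : \forall p \near p0, P (iter q.+1 sh (Bk p)).
  by apply: (near_comp (P := fun p => P (iter q.+1 sh p)) cB); rewrite B0.
by apply: (nearS2 _ n1 shB) => p; rewrite iterSr => e1 e2; rewrite e2 in e1.
Qed.

Variables (q1 : nat) (phi : 'I_m -> traj -> F) (R : 'I_m -> nat).
Hypothesis fo : flat_output sys q1 phi R.
Local Notation y j a := (fshift sys a (phi j)).
Local Notation ch r := (chart sys phi (kap r)).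
Local Notation charted r := (charted sys q1 phi r).
Local Notation ys := (yshifts sys phi).

Lemma cts_ys : {for p0, continuous ys}.
Proof. by apply: into_ptws_cts => c; exact: (cts_yshifts fo). Qed.

Lemma expr_fshift b (C : pred (nat * 'I_m)) h : expr_by ys C p0 h ->
  expr_by ys (fun c => (b <= c.1)%N && C ((c.1 - b)%N, c.2)) p0 (fshift sys b h).
Proof.
move=> [H [sH HE]].
pose Rb (w : {ptws (nat * 'I_m)%type -> F}) : {ptws (nat * 'I_m)%type -> F} :=
  fun c => w ((c.1 + b)%N, c.2).
have RE p : Rb (ys p) = ys (iter b sh p).
  by apply/funext => -[a j]; rewrite /Rb /yshifts /fshift /= iterD.
exists (fun w => H (Rb w)); split.
  apply: (sf_comp (C := C) (H := H)).
  - by rewrite RE iter_shift_p0.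
  - by move=> c; exact: eval_cts.
  - by move=> [a j] Cc; apply: sf_coord; rewrite /= leq_addl addnK.
by apply: nearS (near_shift b HE) => p; rewrite RE.
Qed.

Lemma expr_zx_shift q c : zx_vars q c ->
  expr_by ys (fun c => (c.1 < R c.2 + q)%N) p0 (fshift sys q (fun p : traj => p c)).
Proof.
have [_ [ex eu] _] := fo.
case: c => [b j|i|//] /=.
  move=> bq; rewrite (_ : fshift _ _ _ = fshift sys (q - b.+1) (fun p => sys_g sys (xu_of p) 0 j)).
    have eg : expr_by ys (fun c => c.1 <= R c.2)%N p0 (fun p : traj => sys_g sys (xu_of p) 0 j).
      apply: (expr_comp cts_ys (sf_sysg sys j)) => -[//|i|a l] /=.
        by move=> _; apply: expr_sub (ex i) => c /ltnW.
      by move=> /eqP ->; exact: eu.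
    by apply: expr_sub (expr_fshift (q - b.+1) eg) => c /= /andP[]; lia.
  apply/funext => p; rewrite /fshift.
  by rewrite -{1}(subnKC bq) iterD iter_shift_zeta.
by move=> _; apply: expr_sub (expr_fshift q (ex i)) => c /= /andP[]; lia.
Qed.

(** Let E represent y^j_[a] in zeta, x and v.  If dE/dv^l_[b] were nonzero at a
point delta^q1(p), then differentiating y^j_[a+q1](p) = E(coordinates of
delta^q1(p)) would express dy^l_[k], k = kappa^l + b + q1, at p by other dy:
the shifted zeta and x contribute only orders below R + q1, which do not include
k, the other v contribute other dy, and l differs from j.  So the derivative
vanishes at delta^q1(p) for all p near p0, and these points fill a
neighbourhood. *)
Lemma repr_pder_zero r U0 j a E b l : charted r U0 -> j \notin outs r ->
  smooth_fun_of (zxv_vars q1 r) (ch r p0) E ->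
  (\forall p \near p0, y j a p = E (ch r p)) ->
  l \in outs r -> (R l <= kap r l + b)%N ->
  \forall w \near ch r p0, pder (inr (b, l) : vcoord) E w = 0.
Proof.
move=> cU jr sE EY lr Rlb; have [c0 cv] := cU.
set c : vcoord := inr (b, l).
pose Z p := ch r (iter q1 sh p).
have Z0 : Z p0 = ch r p0 by rewrite /Z iter_shift_p0.
have sZ d : sm (fun p => Z p d) := sf_fshift q1 (sf_chart fo (kap r) d).
have sE' : smooth_fun_of (zxv_vars q1 r) (Z p0) E by rewrite Z0.
have [s [us Cs chn]] := chain_near2 sE' (fun d => sf_cts (sZ d)) (fun d _ => sZ d).
pose ord (d : vcoord) := if d is inr (b, l) then (kap r l + b + q1)%N else 0%N.
(* Beyond the order of every dy which occurs in the computation. *)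
pose N := (\max_(d <- s) ord d + \max_l R l + q1 + a).+1.
have ordN d : d \in s -> (ord d < N)%N.
  move=> ds; have h1 : (ord d <= \max_(d <- s) ord d)%N by exact: leq_bigmax_seq.
  by rewrite /N !ltnS -!addnA (leq_trans h1) ?leq_addr.
have RN i : (R i + q1 <= N)%N.
  have h1 : (R i <= \max_l R l)%N by exact: leq_bigmax.
  by rewrite /N; move: h1; set u := (\max_l R l)%N; set v := (\max_(d <- s) ord d)%N; lia.
have aN : (a + q1 < N)%N.
  by rewrite /N; set u := (\max_l R l)%N; set v := (\max_(d <- s) ord d)%N; lia.
have n2 := near_near (near_shift q1 EY).
have n3 : \forall p \near p0, forall d, d \in s -> (if d is inl d' then
    span [set dif p (fun q => ys q c) | c in [set c | (c.1 < R c.2 + q1)%N]]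
      (dif p (fun q => Z q d)) else True).
  apply: near_seq => -[d|d] ds; last by apply: near_all.
  have zd : zx_vars q1 d by have := allP Cs _ ds; case: (d).
  have := expr_by_span (expr_zx_shift zd) (cts_yshifts fo) (fun c _ => sf_y fo c.2 c.1).
  exact.
have n4 := indep_near (fun x : 'I_N * 'I_m => sf_y fo x.2 x.1) (@dy_indep _ _ _ _ _ _ _ fo N).
have nz : \forall p \near p0, pder c E (Z p) = 0.
  apply: (nearS2 _ (near_and chn n2) (near_and n3 n4)) => p [[pch p0c] p2] [p3 p4].
  have [cs|cs] := boolP (c \in s); last exact: p0c.
  apply/eqP; apply: contraT => v0; exfalso.
  have kN := ordN _ cs; rewrite /= in kN.
  set k := (kap r l + b + q1)%N in kN.
  apply: (indep_notin (i := (Ordinal kN, l)) p4) => /=.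
  have gen k' l' : (k' < N)%N -> (k', l') != (k, l) ->
      span [set dif p (y j0.2 j0.1) | j0 in [set j0 : 'I_N * 'I_m | j0 != (Ordinal kN, l)]]
        (dif p (y l' k')).
    by move=> kN' kl; apply: span_gen; exists (Ordinal kN', l').
  have e1 : dif p (y j (a + q1)) = \sum_(d <- s) pder d E (Z p) *: dif p (fun q => Z q d).
    rewrite (dif_near (h' := fun q => E (Z q))).
      by apply/funext => d; rewrite /dif pch fct_sumE.
    by apply: nearS p2 => q <-; rewrite /fshift iterD.
  have -> : dif p (y l k) = (pder c E (Z p))^-1 *: (dif p (y j (a + q1)) -
      \sum_(d <- s | d != c) pder d E (Z p) *: dif p (fun q => Z q d)).
    rewrite e1 (bigD1_seq c) //= addrK scalerA mulVf // scale1r.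
    by congr dif; apply/funext => q; rewrite /k /Z /c /= /fshift -iterD.
  apply: spanZ; apply: spanD.
    apply: gen => //; apply: contraNneq jr => -[_ ->]; exact: lr.
  apply: spanN; apply: span_sum => d ds dc; apply: spanZ.
  case: d ds dc => [d|[b' l']] ds dc.
    apply: span_trans (p3 _ ds) => _ [[k' l'] /= kR <-]; apply: gen.
      by rewrite (leq_trans kR).
    apply: contraTneq kR => -[-> ->]; rewrite -leqNgt /k; lia.
  have -> : dif p (fun q => Z q (inr (b', l'))) = dif p (y l' (kap r l' + b' + q1)).
    by congr dif; apply/funext => q; rewrite /Z /= /fshift -iterD.
  apply: gen; first exact: ordN ds.
  by apply: contra dc => /eqP [kk ll]; rewrite /c -ll; apply/eqP; do 2 f_equal;
    move: kk; rewrite /k ll; lia.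
have n5 := near_inv_chart c0 (near_unshift (P := fun p => pder c E (ch r p) = 0) nz).
have n6 : \forall w \near ch r p0, pder c E (ch r (inv_chart sys U0 w)) = pder c E w.
  apply: (sf_agree (C := zxv_vars q1 r) (X := fun w => ch r (inv_chart sys U0 w))
    (X' := fun w => w)).
  - by rewrite (inv_chart_w0 c0); exact: sf_pder.
  - by rewrite (inv_chart_w0 c0).
  - exact: (cts_chart_inv fo cU).
  - exact: cvg_id.
  - move=> d zd; apply: (chartK cU); apply: (@unshifted_chart_vars _ _ q1); exact: zxv_unshifted.
by apply: (nearS2 _ n5 n6) => w -> <-.
Qed.

Lemma kap_split (r1 r2 : seq (step m)) (st : step m) j : j \notin outs r1 -> j \in st_out st ->
  kap (r1 ++ st :: r2) j = st_K st j.
Proof. by move=> /negbTE jr js; rewrite kap_cat jr /= js. Qed.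

Lemma run_out_notin r st j : is_step sys q1 phi r st -> j \in st_out st -> j \notin outs r.
Proof. by case=> _ _ /fintype.subsetP so _ _ /so; rewrite inE. Qed.

Lemma run_triangular r : is_run sys q1 phi r -> triangular_form sys q1 phi R r.
Proof.
move=> rr r1 st r2 rE j js; split; last by move=> p; rewrite /= addn0.
have [rr1 ss] : is_run sys q1 phi r1 /\ is_step sys q1 phi r1 st.
  by apply: (is_run_split (r' := r2)); rewrite -rE.
have jr := run_out_notin ss js.
move=> a; rewrite {1}rE kap_split // => ak.
have [U1 cU] := charted_run fo rr1.
have [_ /(_ j jr) [dep _] _ _ _] := ss.
have [E [sE EY]] := dep a ak.
apply: (expr_transfer (Y := ch r1)); first exact: (cts_chart fo).
  move=> p [//|[b l]] /= /andP[lr _]; by rewrite rE kap_cat lr.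
exists E; split=> //.
apply: (sf_drop sE) => -[[b l|i|//]|[b l]] //=; first by move=> ->.
move=> lr; rewrite lr /= -leqNgt leq_subLR rE kap_cat lr => Rb.
exact: repr_pder_zero cU jr sE EY lr Rb.
Qed.

Lemma run_kap_le r j : is_run sys q1 phi r -> (kap r j <= R j)%N.
Proof.
move=> rr; have [jr|jr] := boolP (j \in outs r); last by rewrite kap_notin.
have [r1 [st [r2 [rE js]]]] := mem_outs_split jr.
rewrite rE in rr; have [rr1 ss] := is_run_split rr.
have jr1 := run_out_notin ss js.
rewrite rE kap_split // leqNgt; apply/negP => RK.
have [_ /(_ j jr1) [dep _] _ _ _] := ss.
by have := depends_lt fo jr1 (dep _ RK); rewrite ltnn.
Qed.

End Triangular.

(** * Independence along lists *)
Section ListIndep.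
Variables (F : fieldType) (V : lmodType F) (T : eqType).
Implicit Types (s : seq T) (f : T -> V).

(** Counting is done with lists of coordinates, where unions and subsets are
easier to handle than with index types. *)
Definition lindep s f := forall c : T -> F,
  \sum_(x <- s) c x *: f x = 0 -> forall x, x \in s -> c x = 0.

Lemma lindep_indep s f : uniq s -> lindep s f ->
  indep (fun i : 'I_(size s) => f (tnth (in_tuple s) i)).
Proof.
move=> us fs a a0 i.
pose c x := if [pick i | tnth (in_tuple s) i == x] is Some i then a i else 0.
have inj : injective (tnth (in_tuple s)) by exact/tuple_uniqP.
have cE j : c (tnth (in_tuple s) j) = a j.
  by rewrite /c; case: pickP => [k /eqP/inj -> //|/(_ j)]; rewrite eqxx.
rewrite -cE; apply: fs; last exact: mem_tnth.
by rewrite big_tnth -[RHS]a0; apply: eq_bigr => j _; rewrite cE.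
Qed.

Lemma indep_lindep s f : indep (fun i : 'I_(size s) => f (tnth (in_tuple s) i)) ->
  lindep s f.
Proof.
move=> fs c c0 x /(@tnthP _ _ (in_tuple s)) [i ->].
apply: (fs (fun i => c (tnth (in_tuple s) i))).
by rewrite -[RHS]c0 [in RHS]big_tnth.
Qed.

Lemma span_list s (P : pred T) f v :
  span [set f x | x in [set x | x \in s /\ P x]] v ->
  uniq s -> exists c : T -> F, v = \sum_(x <- s | P x) c x *: f x.
Proof.
move=> S us.
have [a ->] : exists a : 'I_(size s) -> F, v = \sum_(i | P (tnth (in_tuple s) i))
    a i *: f (tnth (in_tuple s) i).
  apply: (span_fin (g := fun i => f (tnth (in_tuple s) i))
    (P := fun i => P (tnth (in_tuple s) i))) S.
  by move=> _ [x [/(@tnthP _ _ (in_tuple s)) [i ->] Px] <-]; exists i.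
have inj : injective (tnth (in_tuple s)) by exact/tuple_uniqP.
pose c x := if [pick i | tnth (in_tuple s) i == x] is Some i then a i else 0.
exists c; rewrite [RHS]big_tnth; apply: eq_bigr => j _; congr (_ *: _).
by rewrite /c; case: pickP => [k /eqP/inj -> //|/(_ j)]; rewrite eqxx.
Qed.

Lemma lindep_inter0 s (P : pred T) f v : uniq s -> lindep s f ->
  span [set f x | x in [set x | x \in s /\ P x]] v ->
  span [set f x | x in [set x | x \in s /\ ~~ P x]] v -> v = 0.
Proof.
move=> us fs /span_list/(_ us) [a E] /(@span_list s (predC P) f v)/(_ us) [b E'].
have c0 : forall x, x \in s -> (if P x then a x else - b x) = 0.
  apply: fs; rewrite (bigID P) /=.
  rewrite (eq_bigr (fun x => a x *: f x)) => [|x ->//].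
  rewrite -E (eq_bigr (fun x => - (b x *: f x))) => [|x /negbTE ->]; last by rewrite scaleNr.
  by rewrite sumrN -[X in _ - X]E' subrr.
rewrite E big_seq_cond big1 // => x /andP[xs Px].
by have := c0 x xs; rewrite Px => ->; rewrite scale0r.
Qed.

Lemma span_setU (A B : set V) v : span (A `|` B) v ->
  exists u w, [/\ span A u, span B w & v = u + w].
Proof.
move=> [r [rS ->]]; elim: r rS => [|x r IH] rS.
  by exists 0, 0; rewrite big_nil addr0; split=> //; exact: span0.
have [u [w [Au Bw E]]] : exists u w, [/\ span A u, span B w & \sum_(x <- r) x.1 *: x.2 = u + w].
  by apply: IH => z zr; apply: rS; rewrite in_cons zr orbT.
rewrite big_cons E; case: (rS x (mem_head _ _)) => [Ax|Bx].
  exists (x.1 *: x.2 + u), w; rewrite addrA; split=> //.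
  by apply: spanD => //; apply: spanZ; exact: span_gen.
exists u, (x.1 *: x.2 + w); rewrite addrCA; split=> //.
by apply: spanD => //; apply: spanZ; exact: span_gen.
Qed.

End ListIndep.

(** Otherwise f together with w would be an independent family in the span of
g with more than #|J| members. *)
Lemma span_full (F : fieldType) (V : lmodType F) (I J : finType) (f : I -> V) (g : J -> V) w :
  indep f -> (forall i, span [set g j | j in [set: J]] (f i)) -> (#|J| <= #|I|)%N ->
  span [set g j | j in [set: J]] w -> span [set f i | i in [set: I]] w.
Proof.
move=> fi fg JI gw; apply: contrapT => nw.
pose h (x : I + 'I_1) := if x is inl i then f i else w.
have hi : indep h.
  move=> a; rewrite big_sumType big_ord1 /= => E.
  have aN : a (inr ord0) = 0.
    apply/eqP; apply: contraT => a0; exfalso; apply: nw.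
    have -> : w = - (a (inr ord0))^-1 *: \sum_i a (inl i) *: f i.
      move/eqP: E; rewrite addr_eq0 => /eqP ->.
      by rewrite scaleNr scalerN opprK scalerA mulVf // scale1r.
    by apply: spanZ; apply: span_sum => i _ _; apply: spanZ; apply: span_gen; exists i.
  move: E; rewrite aN scale0r addr0 => /fi aS.
  by case=> [i|i]; rewrite ?aS // (ord1 i).
have hg x : span [set g j | j in [set j | predT j]] (h x).
  by case: x => [i|i] /=; [apply: span_sub (fg i)|apply: span_sub gw] => _ [j _ <-]; exists j.
have := span_card hi hg.
by rewrite card_sum card_ord addn1 => /leq_trans /(_ JI); rewrite ltnn.
Qed.

Lemma span_eval0 (F : realType) (T : eqType) (S : set (T -> F)) c v :
  (forall u, S u -> u c = 0) -> span S v -> v c = 0.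
Proof.
move=> S0 [r [rS ->]]; rewrite fct_sumE big_seq big1 // => x xr.
by rewrite -[(_ *: _) c]/(x.1 * x.2 c) S0 ?mulr0 //; exact: rS.
Qed.

Lemma lin_indep_atP (F : realType) (I : eqType) (T : eqType) (p : {ptws I -> F})
    (s : seq T) (g : T -> {ptws I -> F} -> F) :
  uniq s ->
  (lin_indep_at p [seq g x | x <- s] <-> lindep s (fun x => dif p (g x))).
Proof.
move=> us; split=> H.
  move=> c c0 x xs.
  have xi : (index x s < size [seq g x | x <- s])%N by rewrite size_map index_mem.
  have := H (fun i => c (nth x s i)) _ (Ordinal xi); rewrite /= nth_index //; apply.
  move=> d; have := congr1 (fun v : I -> F => v d) c0.
  rewrite fct_sumE -[X in _ = X -> _]/0 => E; rewrite -[RHS]E.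
  rewrite (big_nth x) -(size_map g) big_mkord; apply: eq_bigr => i _.
  by rewrite (nth_map x) // -(size_map g) ltn_ord.
move=> a a0 i.
case: s us H a a0 i => [|x0 s] us H a a0 i; first by case: i.
have is' : (i < size (x0 :: s))%N by rewrite -(size_map g) ltn_ord.
pose c x := if [pick i : 'I_(size [seq g x | x <- x0 :: s]) | nth x0 (x0 :: s) i == x]
  is Some i then a i else 0 : F.
have cE (j : 'I_(size [seq g x | x <- x0 :: s])) : c (nth x0 (x0 :: s) j) = a j.
  have js : (j < size (x0 :: s))%N by rewrite -(size_map g) ltn_ord.
  rewrite /c; case: pickP => [k /eqP|/(_ j)]; last by rewrite eqxx.
  have ks : (k < size (x0 :: s))%N by rewrite -(size_map g) ltn_ord.
  by move=> /eqP; rewrite nth_uniq // => /eqP/val_inj ->.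
rewrite -cE; apply: H; last exact: mem_nth.
apply/funext => d; rewrite fct_sumE -[RHS](a0 d).
rewrite (big_nth x0) -(size_map g) big_mkord; apply: eq_bigr => j _.
have js : (j < size (x0 :: s))%N by rewrite -(size_map g) ltn_ord.
by rewrite cE (nth_map x0).
Qed.

(** * Counting covectors *)
Section CoordList.
Variables n m : nat.
Local Notation vcoord := (vcoord n m).
Implicit Types (A B : 'I_m -> nat) (c : vcoord).

(** In these lists [inr (a, j)] stands for y^j_[a] itself, which is the
coordinate v^j_[a] for kappa = 0; this is why [chart] is used with zero
exponents below. *)
Definition zxy_list q A B : seq vcoord :=
  [seq inl (Zeta b j) | b <- iota 0 q, j <- enum 'I_m] ++
  [seq inl (Xc i) | i <- enum 'I_n] ++
  [seq inr (a, j) | j <- enum 'I_m, a <- iota (A j) (B j - A j)].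

Definition zxy_vars q A B : pred vcoord := fun c =>
  match c with
  | inl (Zeta b _) => (b < q)%N
  | inl (Xc _) => true
  | inl (Uc _ _) => false
  | inr (a, j) => (A j <= a < B j)%N
  end.

Lemma mem_zxy_list q A B c : (c \in zxy_list q A B) = zxy_vars q A B c.
Proof.
rewrite !mem_cat; apply/idP/idP.
  case/or3P => [/allpairsPdep[b [j [+ _ ->]]]|/mapP[i _ ->//]|/allpairsPdep[j [a [_ + ->]]]].
    by rewrite mem_iota add0n.
  by rewrite mem_iota /=; lia.
case: c => [[b j|i|//]|[a j]] /= H.
- by apply/orP; left; apply/allpairsPdep; exists b, j; rewrite mem_iota mem_enum.
- by apply/or3P; apply: Or32; apply/mapP; exists i; rewrite ?mem_enum.
- apply/or3P; apply: Or33; apply/allpairsPdep; exists j, a.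
  by rewrite mem_iota mem_enum; split=> //; lia.
Qed.

Lemma uniq_zxy_list q A B : uniq (zxy_list q A B).
Proof.
rewrite !cat_uniq; apply/and5P; split.
- by apply: allpairs_uniq; rewrite ?iota_uniq ?enum_uniq // => -[? ?] [? ?] _ _ /= [-> ->].
- apply/hasPn => c; rewrite mem_cat => /orP[/mapP[i _ ->]|/allpairsPdep[j [a [_ _ ->]]]];
    by apply/allpairsPdep => -[? [? [_ _]]].
- by rewrite map_inj_uniq ?enum_uniq // => i j [].
- apply/hasPn => c /allpairsPdep[j [a [_ _ ->]]]; by apply/mapP => -[? _].
- apply: allpairs_uniq_dep; rewrite ?enum_uniq //.
    by move=> j _; exact: iota_uniq.
  by move=> [j a] [j' a'] _ _ /= [-> ->].
Qed.

Lemma size_zxy_list q A B :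
  size (zxy_list q A B) = (q * m + (n + \sum_(j < m) (B j - A j)))%N.
Proof.
rewrite !size_cat size_allpairs size_iota (size_map (fun i => inl (Xc i))) !size_enum_ord.
rewrite size_allpairs_dep; congr (_ + (_ + _))%N.
rewrite sumnE big_map big_enum /=; apply: eq_bigr => j _; exact: size_iota.
Qed.

Lemma sum_subn N A : (forall j, A j <= N)%N ->
  (\sum_(j < m) (N - A j) + msum A = N * m)%N.
Proof.
move=> AN; rewrite /msum -big_split /= (eq_bigr (fun=> N)) => [|j _]; last exact: subnK.
by rewrite sum_nat_const card_ord mulnC.
Qed.

Lemma mmin_le A j : (mmin A <= A j)%N.
Proof.
rewrite /mmin; move: (\max_(_ < m) _)%N => M.
have : j \in index_enum 'I_m by rewrite mem_index_enum.
elim: (index_enum _) => [//|i s IH]; rewrite in_cons big_cons geq_min.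
by case/predU1P => [<-|/IH ->]; rewrite ?leqnn ?orbT.
Qed.

Variables (F : realType) (sys : dtsystem F n m) (phi : 'I_m -> traj F n m -> F).

Lemma feasible_listE q1 R A : feasible_list sys q1 phi R A =
  [seq (fun p => chart sys phi (fun=> 0%N) p c) | c <- zxy_list (q1 - mmin A) A R].
Proof.
rewrite /feasible_list /zxy_list !map_cat !map_allpairs.
congr (_ ++ (_ ++ _)).
exact: (map_comp (fun c => (chart sys phi (fun=> 0%N))^~ c) (fun i => inl (Xc i)) (enum 'I_n)).
Qed.

End CoordList.

Section ListCount.
Variables (F : fieldType) (V : lmodType F) (T T' : eqType).
Variables (s : seq T) (t : seq T') (f : T -> V) (g : T' -> V).

Definition spans_list (t : seq T') (g : T' -> V) (v : V) :=
  span [set g y | y in [set y | y \in t]] v.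

Lemma spans_list_ord v : spans_list t g v ->
  span [set g (tnth (in_tuple t) i) | i in [set: 'I_(size t)]] v.
Proof.
by apply: span_sub => _ [y /(@tnthP _ _ (in_tuple t)) [i ->] <-]; exists i.
Qed.

Lemma lindep_size : uniq s -> lindep s f -> (forall x, x \in s -> spans_list t g (f x)) ->
  (size s <= size t)%N.
Proof.
move=> us fs fg; rewrite -[size t]card_ord -[size s]card_ord.
apply: (span_card (P := predT) (lindep_indep us fs)) => i.
by apply: span_sub (spans_list_ord (fg _ (mem_tnth i (in_tuple s)))) => _ [j _ <-]; exists j.
Qed.

Lemma lindep_full v : uniq s -> lindep s f -> (forall x, x \in s -> spans_list t g (f x)) ->
  (size t <= size s)%N -> spans_list t g v -> span [set f x | x in [set x | x \in s]] v.
Proof.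
move=> us fs fg ts gv.
have := span_full (lindep_indep us fs) (fun i => spans_list_ord (fg _ (mem_tnth i (in_tuple s)))).
rewrite !card_ord => /(_ _ ts (spans_list_ord gv)) S.
apply: span_sub S => _ [i _ <-]; exists (tnth (in_tuple s) i) => //; exact: mem_tnth.
Qed.

Lemma relation_span (c : T -> F) x : uniq s -> \sum_(y <- s) c y *: f y = 0 -> x \in s ->
  c x != 0 -> span [set f y | y in [set y | y \in s /\ y != x]] (f x).
Proof.
move=> us c0 xs cx.
have -> : f x = - (c x)^-1 *: \sum_(y <- s | y != x) c y *: f y.
  move: c0; rewrite (bigD1_seq x) //= => /eqP; rewrite addrC addr_eq0 => /eqP ->.
  by rewrite scalerN scaleNr opprK scalerA mulVf // scale1r.
apply: spanZ; apply: span_sum => y ys yx; apply: spanZ; apply: span_gen.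
by exists y.
Qed.

End ListCount.

Lemma near_lindep (F : realType) (J T : eqType) (p0 : {ptws J -> F}) (s : seq T)
    (g : T -> {ptws J -> F} -> F) : uniq s ->
  (forall x, smooth_fun_of predT p0 (g x)) ->
  lindep s (fun x => dif p0 (g x)) -> \forall p \near p0, lindep s (fun x => dif p (g x)).
Proof.
move=> us sg /(lindep_indep us) si.
apply: (nearS (P := fun p => indep (fun i => dif p (g (tnth (in_tuple s) i))))).
  move=> p; exact: indep_lindep.
by apply: indep_near si => i; exact: sg.
Qed.

Section ZetaOrder.
Variables (F : realType) (n m : nat) (sys : dtsystem F n m).
Local Notation p0 := (eq_traj sys).
Local Notation sh := (shift sys).
Local Notation traj := (traj F n m).

Definition zeta_below q : pred (coord n m) := fun c =>
  if c is Zeta b _ then (b < q)%N else true.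

(** Each shift moves zeta_[-b-1] to zeta_[-b], and zeta_[-1] to a function of x
and u. *)
Lemma sf_iter_shift_below a q c : zeta_below (q + a) c ->
  smooth_fun_of (zeta_below q) p0 (fun p : traj => iter a sh p c).
Proof.
elim: a c => [|a IH] c; first by rewrite addn0; exact: sf_coord.
move=> cq.
have sc : smooth_fun_of (zeta_below (q + a)) (iter a sh p0) (fun p => sh p c).
  rewrite iter_shift_p0; case: c cq => [[|b] j|i|b j] /= cq.
  - by apply: sf_sub (sf_sysg sys j) => -[].
  - by apply: sf_coord => /=; lia.
  - by apply: sf_sub (sf_sysf sys i) => -[].
  - exact: sf_coord.
apply: (sf_comp (Y := fun p : traj => iter a sh p) sc) => [d|d dq].
  exact: sf_cts (sf_iter_shift sys a d).
exact: IH.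
Qed.

Lemma sf_fshift_below a q (h : traj -> F) : smooth_fun_of (zeta_below q) p0 h ->
  smooth_fun_of (zeta_below (q - a)) p0 (fshift sys a h).
Proof.
move=> sh'; apply: (sf_comp (C := zeta_below q) (Y := fun p : traj => iter a sh p)).
- by rewrite iter_shift_p0.
- by move=> d; exact: sf_cts (sf_iter_shift sys a d).
- move=> c cq; apply: sf_iter_shift_below; case: c cq => [b j|//|//] /=; lia.
Qed.

Lemma dif_below q (h : traj -> F) b l : smooth_fun_of (zeta_below q) p0 h -> (q <= b)%N ->
  dif p0 h (Zeta b l) = 0.
Proof.
move=> /span_sf hS qb; apply: span_eval0 hS => _ [c cq <-].
rewrite dif_coord; case: eqP => // cE; move: cq; rewrite /= -cE /=; lia.
Qed.

End ZetaOrder.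

Section Counting.
Variables (F : realType) (n m : nat) (sys : dtsystem F n m).
Local Notation p0 := (eq_traj sys).
Local Notation traj := (traj F n m).
Local Notation vcoord := (vcoord n m).
Variables (q1 : nat) (phi : 'I_m -> traj -> F) (R : 'I_m -> nat).
Hypothesis fo : flat_output sys q1 phi R.
Local Notation y j a := (fshift sys a (phi j)).
Local Notation dzy p := (fun c : vcoord => dif p (fun q => chart sys phi (fun=> 0%N) q c)).
Local Notation zxy := (zxy_list n).

Definition y_list N : seq vcoord := [seq inr (a, j) | j <- enum 'I_m, a <- iota 0 N].

Lemma mem_y_list N c : (c \in y_list N) = (if c is inr (a, _) then (a < N)%N else false).
Proof.
apply/allpairsPdep/idP => [[j [a [_ + ->]]]|]; first by rewrite mem_iota add0n.
by case: c => [//|[a j] aN]; exists j, a; rewrite mem_iota mem_enum.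
Qed.

Lemma uniq_y_list N : uniq (y_list N).
Proof.
by apply: allpairs_uniq; rewrite ?iota_uniq ?enum_uniq // => -[? ?] [? ?] _ _ /= [-> ->].
Qed.

Lemma size_y_list N : size (y_list N) = (N * m)%N.
Proof. by rewrite size_allpairs size_iota size_enum_ord mulnC. Qed.

Lemma lindep_y_list N : lindep (y_list N) (dzy p0).
Proof.
move=> c c0 x; rewrite mem_y_list; case: x => [//|[a j]] aN.
have := dy_indep fo (N := N) (a := fun x => c (inr (val x.1, x.2))).
move=> /(_ _ (Ordinal aN, j)); apply.
rewrite -[RHS]c0 big_allpairs_dep /=.
rewrite -(pair_bigA _ (fun (a : 'I_N) j => c (inr (val a, j)) *: dif p0 (y j a))) /=.
rewrite exchange_big big_enum /=; apply: eq_bigr => k _.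
by rewrite -(subn0 N) -/(index_iota 0 N) big_mkord subn0.
Qed.

Lemma near_zx_y_span N : (forall j, R j <= N)%N ->
  \forall p \near p0, forall i, spans_list (y_list N) (dzy p) (dif p (fun q : traj => q (Xc i))).
Proof.
move=> RN; apply: near_forall => i; have [_ [fx _] _] := fo.
have := expr_by_span (fx i) (cts_yshifts fo) (fun c _ => sf_y fo c.2 c.1).
apply: nearS => p; apply: span_sub => _ [[a j] /= aR <-].
by exists (inr (a, j)) => //=; rewrite mem_y_list (leq_trans aR).
Qed.

Lemma near_u_y_span N : (forall j, R j < N)%N ->
  \forall p \near p0, forall i, spans_list (y_list N) (dzy p) (dif p (fun q : traj => q (Uc 0 i))).
Proof.
move=> RN; apply: near_forall => i; have [_ [_ fu] _] := fo.
have := expr_by_span (fu i) (cts_yshifts fo) (fun c _ => sf_y fo c.2 c.1).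
apply: nearS => p; apply: span_sub => _ [[a j] /= aR <-].
by exists (inr (a, j)) => //=; rewrite mem_y_list (leq_ltn_trans aR).
Qed.

Section CompleteRun.
Variables (r : seq (step m)).
Hypothesis cr : is_complete_run sys q1 phi r.
Local Notation k := (kap r).

Lemma run_chart : exists U0, charted sys q1 phi r U0.
Proof. by case: cr => rr _; exact: charted_run fo _ rr. Qed.

(** These covectors are the differentials of zeta, x and v: y^j_[a] with
a >= kappa^j is the coordinate v^j_[a - kappa^j]. *)
Lemma near_lindep_kap q B : \forall p \near p0, lindep (zxy q k B) (dzy p).
Proof.
apply: near_lindep; [exact: uniq_zxy_list|exact: sf_chart fo _|].
have [U0 cU] := run_chart.
(* Reindexing from y^j_[a] to v^j_[a - kappa^j]. *)
pose conv (c : vcoord) : vcoord := if c is inr (a, j) then inr ((a - k j)%N, j) else c.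
apply: indep_lindep; set l := zxy _ _ _.
have li (i : 'I_(size l)) : zxy_vars q k B (tnth (in_tuple l) i).
  by rewrite -mem_zxy_list; exact: mem_tnth.
have E i : dzy p0 (tnth (in_tuple l) i) =
    dif p0 (fun p => chart sys phi k p (conv (tnth (in_tuple l) i))).
  have := li i; case: (tnth _ _) => [//|[a j]] /= /andP[ka _].
  by rewrite add0n subnKC.
rewrite (_ : (fun i => _) =
    fun i => dif p0 (fun p => chart sys phi k p (conv (tnth (in_tuple l) i)))); last first.
  by apply/funext => i; exact: E.
apply: (indep_chart fo cU (f := fun i => conv (tnth (in_tuple l) i))).
  have inj : injective (tnth (in_tuple l)) by exact/tuple_uniqP/uniq_zxy_list.
  move=> i i' cE; apply: inj; have := li i; have := li i'; move: cE.
  case: (tnth _ i) (tnth _ i') => [c|[a j]] [c'|[a' j']] //= [].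
  by move=> E2 E3; subst j'; move=> /andP[ka1 _] /andP[ka2 _]; congr (inr (_, _)); lia.
move=> i; have := li i; case: (tnth _ i) => [[b j|i'|//]|[a j]] //= _.
by case: cr => _ ->; rewrite inE.
Qed.

End CompleteRun.
End Counting.

(** * The size of kappa *)
Section KappaCount.
Variables (F : realType) (n m : nat) (sys : dtsystem F n m).
Local Notation p0 := (eq_traj sys).
Local Notation traj := (traj F n m).
Local Notation vcoord := (vcoord n m).
Variables (q1 : nat) (phi : 'I_m -> traj -> F) (R : 'I_m -> nat).
Hypothesis fo : flat_output sys q1 phi R.
Local Notation y j a := (fshift sys a (phi j)).
Local Notation dzy p := (fun c : vcoord => dif p (fun q => chart sys phi (fun=> 0%N) q c)).
Local Notation zxy := (zxy_list n).

Variables (r : seq (step m)).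
Hypothesis cr : is_complete_run sys q1 phi r.
Local Notation k := (kap r).

(** For a < kappa^j this is the triangular form, in which v^l_[b] occurs only
for kappa^l + b < R^l <= N. *)
Lemma run_y_span N j a : (forall j, R j <= N)%N -> (a < N)%N ->
  spans_list (zxy q1 k (fun=> N)) (dzy p0) (dif p0 (y j a)).
Proof.
move=> RN aN; have [ka|ak] := leqP (k j) a.
  by apply: span_gen; exists (inr (a, j)) => //=; rewrite mem_zxy_list /= ka.
have [rr oT] := cr.
have jr : j \in outs r by rewrite oT inE.
have [r1 [st [r2 [rE js]]]] := mem_outs_split jr.
have [/(_ a ak) ex _] := run_triangular fo rr rE js.
have := nbhs_singleton (expr_by_span ex (fun c => sf_cts (sf_chart fo k c))
  (fun c _ => sf_chart fo k c)).
apply: span_sub => _ [c cv <-]; move: c cv.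
case=> [[b l|i|//]|[b l]] /= cv.
- by exists (inl (Zeta b l)); rewrite //= mem_zxy_list.
- by exists (inl (Xc i)); rewrite //= mem_zxy_list.
- exists (inr ((k l + b)%N, l)); rewrite //= mem_zxy_list /= leq_addr /=.
  by case/andP: cv => _ bl; have := RN l; have := run_kap_le fo l rr; lia.
Qed.

Lemma kap_le_N N j : (forall j, R j <= N)%N -> (k j <= N)%N.
Proof. by move=> RN; case: cr => rr _; exact: leq_trans (run_kap_le fo j rr) (RN j). Qed.

Lemma size_zxy_kap N q : (forall j, R j <= N)%N ->
  (size (zxy q k (fun=> N)) + msum k = q * m + n + N * m)%N.
Proof.
move=> RN; rewrite size_zxy_list -(@sum_subn m N k) => [|j]; last exact: kap_le_N.
by rewrite !addnA.
Qed.

Lemma near_xy_y_span N : (forall j, R j <= N)%N ->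
  \forall p \near p0, forall c, c \in zxy 0 k (fun=> N) -> spans_list (y_list n m N) (dzy p) (dzy p c).
Proof.
move=> /(near_zx_y_span fo); apply: nearS => p px c; rewrite mem_zxy_list.
case: c => [[b j|i|//]|[a j]] //= H.
by apply: span_gen; exists (inr (a, j)) => //=; rewrite mem_y_list; case/andP: H.
Qed.

Let Rmax := (\max_j R j).+1.
Let RN j : (R j < Rmax)%N. Proof. by rewrite ltnS; exact: leq_bigmax. Qed.
Let RNW j : (R j <= Rmax)%N. Proof. exact: ltnW. Qed.

(** Comparison of n + N m - #kappa independent covectors with the N m covectors
dy_[0,N-1] which span them. *)
Lemma run_kap_ge : (n <= msum k)%N.
Proof.
have := lindep_size (uniq_zxy_list _ _ _ _) (nbhs_singleton (near_lindep_kap fo cr 0 (fun=> Rmax)))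
  (nbhs_singleton (near_xy_y_span RNW)).
rewrite size_y_list; have := size_zxy_kap 0 RNW; rewrite mul0n.
by move: (Rmax * m)%N (msum k) (size _) => *; lia.
Qed.

(** The N m independent dy_[0,N-1] lie in the span of dzeta, dx and
dy_[kappa,N-1]; as none of these dy has a zeta-component, they lie already
in the span of the n + N m - #kappa covectors dx and dy_[kappa,N-1]. *)
Lemma zeta_free_kap : zeta_free sys phi -> (msum k <= n)%N.
Proof.
move=> zf; have := lindep_size (@uniq_y_list n m Rmax) (lindep_y_list fo (N := Rmax))
  (t := zxy 0 k (fun=> Rmax)) (g := dzy p0).
rewrite size_y_list; have := size_zxy_kap 0 RNW; rewrite mul0n; suff H : forall x,
  x \in y_list n m Rmax -> spans_list (zxy 0 k (fun=> Rmax)) (dzy p0) (dzy p0 x).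
  by move=> E /(_ H); move: E; move: (Rmax * m)%N (msum k) (size _) => *; lia.
case=> [c|[a j]]; rewrite mem_y_list // => aN.
have S := run_y_span j RNW aN.
have [v1 [v2 [S1 S2 E]]] : exists u w,
    [/\ span [set dzy p0 c | c in [set c | if c is inl (Zeta _ _) then true else false]] u,
       spans_list (zxy 0 k (fun=> Rmax)) (dzy p0) w & dif p0 (y j a) = u + w].
  apply: span_setU; apply: span_sub S => _ [c + <-]; rewrite /= mem_zxy_list => cv.
  case: c cv => [[b l|i|//]|[b l]] cv.
  - by left; exists (inl (Zeta b l)).
  - by right; exists (inl (Xc i)) => //=; rewrite mem_zxy_list.
  - by right; exists (inr (b, l)) => //=; rewrite mem_zxy_list.
suff v10 : v1 = 0 by rewrite /= E v10 add0r.
apply/funext => -[b l|i|b l]; last 2 first.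
- apply: span_eval0 S1 => _ [[[b' l'|//|//]|//] _ <-]; by rewrite dif_coord.
- apply: span_eval0 S1 => _ [[[b' l'|//|//]|//] _ <-]; by rewrite dif_coord.
have nz j' : smooth_fun_of (zeta_below 0) p0 (phi j').
  by apply: sf_sub (zf j') => -[].
have z0 a' j' : dif p0 (y j' a') (Zeta b l) = 0.
  by apply: dif_below (sf_fshift_below a' (nz j')) _.
have v20 : v2 (Zeta b l) = 0.
  apply: span_eval0 S2 => _ [c + <-]; rewrite /= mem_zxy_list.
  case: c => [[b' l'|i|//]|[b' l']] //= _.
  by rewrite dif_coord.
have : (v1 + v2) (Zeta b l) = 0 by rewrite -E z0.
by rewrite -[(v1 + v2) _]/(v1 _ + v2 _) v20 addr0 => ->.
Qed.

(** Near p0, let w be the part of dphi^j in dzeta and dx.  It is a combination of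
the dy_[0,N-1], hence by equality of the dimensions one of dx and
dy_[kappa,N-1].  Independence of dzeta, dx and dy_[kappa,N-1] removes its
dzeta-part, and phi^j does not depend on zeta. *)
Lemma kap_eq_zeta_free : (msum k <= n)%N -> zeta_free sys phi.
Proof.
move=> kn j; have [sphi _ _] := fo.
have nz : \forall p \near p0, forall b l, pder (Zeta b l) (phi j) p = 0.
  have E1 := near_and (sf_near (sphi j)) (near_and (near_u_y_span fo RN) (near_and (near_xy_y_span RNW)
    (near_and (near_lindep_kap fo cr 0 (fun=> Rmax)) (near_lindep_kap fo cr q1 (fun=> Rmax))))).
  apply: nearS E1 => p [sp [pu [pxy [L0 Lq]]]] b l.
  have [w [u [Sw Su E]]] : exists w u,
      [/\ span (dzx_set p q1) w,
          span [set dif p (fun q : traj => q (Uc 0 i)) | i in [set: 'I_m]] u & dif p (phi j) = w + u].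
    apply: span_setU; apply: span_sub (span_sf sp) => _ [c cv <-].
    case: c cv => [b' l'|i|b' l'] cv; [left|left|right].
    - by exists (Zeta b' l').
    - by exists (Xc i).
    - by exists l' => //; rewrite (eqP cv).
  have wy : spans_list (y_list n m Rmax) (dzy p) w.
    have -> : w = dif p (phi j) - u by rewrite E addrK.
    apply: spanD; first by apply: span_gen; exists (inr (0%N, j)); rewrite //= mem_y_list.
    by apply: spanN; apply: span_trans Su => _ [i _ <-]; exact: pu.
  have wx : span [set dzy p x | x in [set x | x \in zxy 0 k (fun=> Rmax)]] w.
    apply: lindep_full (uniq_zxy_list _ _ _ _) L0 pxy _ wy.
    rewrite size_y_list; have := size_zxy_kap 0 RNW; rewrite mul0n.
    by move: kn; move: (Rmax * m)%N (msum k) (size _) => *; lia.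
  pose isZ (c : vcoord) := if c is inl (Zeta _ _) then true else false.
  have [v [wx' [Sv Sx Ew]]] : exists v wx,
     [/\ span [set dzy p x | x in [set x | x \in zxy q1 k (fun=> Rmax) /\ isZ x]] v,
        span [set dif p (fun q : traj => q (Xc i)) | i in [set: 'I_n]] wx & w = v + wx].
    apply: span_setU; apply: span_sub Sw => _ [c cv <-].
    case: c cv => [b' l'|i|//] cv; [left|right].
      by exists (inl (Zeta b' l')) => //; split=> //; rewrite mem_zxy_list.
    by exists i.
  have v0 : v = 0.
    apply: (lindep_inter0 (P := isZ) (uniq_zxy_list _ _ _ _) Lq) => //.
    have -> : v = w - wx' by rewrite Ew addrK.
    apply: spanD.
      apply: span_sub wx => _ [c + <-]; rewrite /= mem_zxy_list => cv; exists c => //.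
      split; last by case: c cv => [[]|].
      by rewrite mem_zxy_list; case: c cv => [[]|].
    apply: spanN; apply: span_sub Sx => _ [i _ <-]; exists (inl (Xc i)) => //.
    by rewrite /= mem_zxy_list.
  rewrite -[LHS]/(dif p (phi j) (Zeta b l)) E Ew v0 add0r.
  rewrite -[(wx' + u) _]/(wx' _ + u _).
  by rewrite (span_eval0 _ Sx) ?(span_eval0 _ Su) ?addr0 // => _ [i _ <-]; rewrite dif_coord.
apply: (sf_drop (sphi j)) => -[b l|//|//] _ _.
by apply: nearS nz => p; exact.
Qed.

End KappaCount.

(** * Feasible multi-indices *)
Section Feasible.
Variables (F : realType) (n m : nat) (sys : dtsystem F n m).
Local Notation p0 := (eq_traj sys).
Local Notation traj := (traj F n m).
Local Notation vcoord := (vcoord n m).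
Variables (q1 : nat) (phi : 'I_m -> traj -> F) (R : 'I_m -> nat).
Hypothesis fo : flat_output sys q1 phi R.
Local Notation dzy p := (fun c : vcoord => dif p (fun q => chart sys phi (fun=> 0%N) q c)).
Local Notation zxy := (zxy_list n).

(** The additional covectors cannot take part in a relation: dy^j_[a] with
a >= R^j because of [dy_notin_dzx], and dzeta_[-b-1] with b >= q1 - min A because
none of the dy_[a], a >= A, involves these variables. *)
Lemma lindep_extend A N : (forall j, R j <= N)%N ->
  lindep (zxy (q1 - mmin A) A R) (dzy p0) -> lindep (zxy q1 A (fun=> N)) (dzy p0).
Proof.
move=> RN L c c0.
have uz := uniq_zxy_list n q1 A (fun=> N).
have high j a : (R j <= a)%N -> inr (a, j) \in zxy q1 A (fun=> N) -> c (inr (a, j)) = 0.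
  move=> Ra ain; apply/eqP; apply: contraT => ca; exfalso.
  apply: (dy_notin_dzx fo (q := q1) Ra).
  have := relation_span uz c0 ain ca; apply: span_sub => _ [d [+ dn] <-]; rewrite mem_zxy_list.
  case: d dn => [[b l|i|//]|[b l]] dn H.
  - by left; exists (Zeta b l).
  - by left; exists (Xc i).
  - by right; exists (b, l).
have low b l : (q1 - mmin A <= b)%N -> (b < q1)%N -> c (inl (Zeta b l)) = 0.
  move=> qb bq; have := congr1 (fun v => v (Zeta b l)) c0; rewrite fct_sumE -[RHS]/0 => E.
  rewrite -[RHS]E (bigD1_seq (inl (Zeta b l))) ?mem_zxy_list //=.
  rewrite -[(_ *: _) _]/(c (inl (Zeta b l)) * _) dif_coord eqxx mulr1.
  rewrite big_seq_cond big1 ?addr0 // => d /andP[]; rewrite mem_zxy_list.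
  rewrite -[(_ *: _) _]/(c d * dzy p0 d (Zeta b l)).
  case: d => [[b' l'|i|//]|[a j]] /= H dn.
  - rewrite dif_coord (_ : (_ == _) = false) ?mulr0 //; apply/negbTE.
    by apply: contraNneq dn => ->.
  - by rewrite dif_coord mulr0.
  - have [sphi _ _] := fo.
    have sj : smooth_fun_of (zeta_below q1) p0 (phi j) by apply: sf_sub (sphi j) => -[].
    have ab : (q1 - (0 + a) <= b)%N.
      by have := mmin_le A j; move: qb H; move: (mmin A) => M; lia.
    have := dif_below l (sf_fshift_below (0 + a) sj) ab.
    by rewrite /= => ->; rewrite mulr0.
have keep d : d \in zxy q1 A (fun=> N) -> d \notin zxy (q1 - mmin A) A R -> c d = 0.
  rewrite !mem_zxy_list; case: d => [[b l|i|//]|[a j]] //=; rewrite -?leqNgt.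
    by move=> bq qb; exact: low.
  move=> /andP[Aa aN]; rewrite Aa /= -leqNgt => Ra; apply: high => //.
  by rewrite mem_zxy_list /= Aa.
have c0' : \sum_(d <- zxy (q1 - mmin A) A R) c d *: dzy p0 d = 0.
  rewrite -[RHS]c0 [RHS](bigID (fun d => d \in zxy (q1 - mmin A) A R)) /=.
  rewrite [X in _ = _ + X]big_seq_cond [X in _ = _ + X]big1 => [|d /andP[din dn]]; last first.
    by rewrite keep ?scale0r.
  rewrite addr0 -[RHS]big_filter; apply: perm_big; apply: uniq_perm.
  - exact: uniq_zxy_list.
  - by rewrite filter_uniq.
  - move=> d; rewrite mem_filter !mem_zxy_list; case: d => [[b l|i|//]|[a j]] //=.
      by apply: esym; apply: andb_idr => /leq_trans -> //; exact: leq_subr.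
    by apply: esym; apply: andb_idr => /andP[-> /leq_trans ->].
move=> d din; have [ds|ds] := boolP (d \in zxy (q1 - mmin A) A R); last exact: keep.
exact: L c0' d ds.
Qed.

Variables (r : seq (step m)).
Hypothesis cr : is_complete_run sys q1 phi r.
Local Notation k := (kap r).

Lemma kap_feasible : feasible sys q1 phi R k.
Proof.
rewrite /feasible; apply: nearS (near_lindep_kap fo cr (q1 - mmin k) R) => p L.
by rewrite feasible_listE; apply/lin_indep_atP => //; exact: uniq_zxy_list.
Qed.

Lemma kap_minimal A : feasible sys q1 phi R A -> (msum k <= msum A)%N.
Proof.
move=> /nbhs_singleton; rewrite feasible_listE => /lin_indep_atP -/(_ (uniq_zxy_list _ _ _ _)) L.
pose N := (\max_j maxn (R j) (A j))%N.
have RAN j : (maxn (R j) (A j) <= N)%N by exact: (leq_bigmax (F := fun j => maxn (R j) (A j))).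
have RN j : (R j <= N)%N by apply: leq_trans (RAN j); exact: leq_maxl.
have AN j : (A j <= N)%N by apply: leq_trans (RAN j); exact: leq_maxr.
have := lindep_size (uniq_zxy_list _ _ _ _) (lindep_extend RN L) (t := zxy q1 k (fun=> N)) (g := dzy p0).
have sz := size_zxy_kap fo cr q1 RN.
have sA := sum_subn AN.
have zx c : c \in zxy q1 A (fun=> N) -> spans_list (zxy q1 k (fun=> N)) (dzy p0) (dzy p0 c).
  rewrite mem_zxy_list; case: c => [[b l|i|//]|[a j]] H.
  - by apply: span_gen; exists (inl (Zeta b l)) => //=; rewrite mem_zxy_list.
  - by apply: span_gen; exists (inl (Xc i)) => //=; rewrite mem_zxy_list.
  - by apply: run_y_span => //; case/andP: H.
move=> /(_ zx); move: sz; rewrite [X in (X <= _)%N]size_zxy_list.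
by move: sA; move: (size _) (\sum_(j < m) _)%N (msum A) (msum k) (N * m)%N (q1 * m)%N => *; lia.
Qed.

Lemma run_local_coords : local_coords (chart sys phi k) (@chart_vars n m r) p0.
Proof.
have [rr oT] := cr; have [U0 cU] := charted_run fo rr; split=> [c|s us /allP Cs].
  by apply: (expr_by_chart fo cU.1); exact: sf_coord.
have L0 : lindep s (fun c => dif p0 (fun q => chart sys phi k q c)).
  apply: indep_lindep; apply: (indep_chart fo cU (f := tnth (in_tuple s))).
    exact/tuple_uniqP.
  by move=> i; apply: Cs; exact: mem_tnth.
apply: nearS (near_lindep us (fun c => sf_chart fo k c) L0) => p L.
exact/lin_indep_atP.
Qed.

End Feasible.

Theorem theorem4p5 (F : realType) (n m : nat) (sys : dtsystem F n m) (q1 : nat)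
    (phi : 'I_m -> traj F n m -> F) (R : 'I_m -> nat) :
  flat_output sys q1 phi R ->
  [/\ (* termination after s <= m steps *)
      forall r, is_run sys q1 phi r -> (size r <= m)%N,
      forall r, is_run sys q1 phi r -> outs r <> [set: 'I_m]%SET ->
        exists Ki H, first_orders sys q1 phi r Ki /\ coord_repr sys phi r Ki H,
      constant_ranks sys q1 phi ->
        forall r, is_run sys q1 phi r ->
          exists r', is_complete_run sys q1 phi (r ++ r') &
      forall r, is_complete_run sys q1 phi r ->
        let kappa := kap r in
        [/\ local_coords (chart sys phi kappa) (@chart_vars n m r) (eq_traj sys),
            (* (i) *)
            forall j, (kappa j <= R j)%N,
            (* (ii) *)
            (n <= msum kappa)%N /\ (msum kappa = n <-> zeta_free sys phi),
            (* (iii) *)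
            feasible sys q1 phi R kappa /\
            (forall A : 'I_m -> nat,
               feasible sys q1 phi R A -> (msum kappa <= msum A)%N) &
            triangular_form sys q1 phi R r]].
Proof.
move=> fo; split.
- by move=> r; exact: (run_size_le fo).
- by move=> r rr _; exact: (exists_repr fo rr).
- by move=> cst r; exact: (complete_run fo cst).
move=> r cr; have [rr _] := cr; split.
- exact: (run_local_coords fo cr).
- by move=> j; exact: (run_kap_le fo j rr).
- have nk := run_kap_ge fo cr; split=> //; split=> [kn|zf].
    by apply: (kap_eq_zeta_free fo cr); rewrite kn.
  by apply/eqP; rewrite eqn_leq nk (zeta_free_kap fo cr zf).
- by split; [exact: (kap_feasible fo cr)|move=> A; exact: (kap_minimal fo cr)].
- exact: (run_triangular fo rr).
Qed.
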